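(* Let $V$ be a finite-dimensional vector space over $\mathbb{R}$ or over $\mathbb{Q}_p$, and let $\mu\in\mathcal{P}(V)$ be full. Suppose $\mu$ is $(T,n)$-semistable for some continuous automorphism $T$ of $V$ and some integer $n\ge 2$. Then $\mu$ is absolutely continuous with a bounded continuous density.
   Context: $p$ is a prime. $V$ is regarded as a locally compact second countable abelian group under addition. $\mathcal{P}(V)$ is the space of Borel probability measures on $V$. For a continuous automorphism $T$ of $V$ (with continuous inverse) and $\mu\in\mathcal{P}(V)$, $T(\mu)(B)=\mu(T^{-1}(B))$ for Borel sets $B$; $\mu^n$ denotes the $n$-th convolution power of $\mu$. $\mu$ is $(T,n)$-semistable if $T(\mu^n)=\mu$. A measure $\mu$ on $V$ is full if it is not supported on a coset of a proper vector subspace of $V$. Absolute continuity and densities are with respect to a Haar measure on $V$. *)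

(* Defs.v *)
From HB Require Import structures.
From mathcomp Require Import all_boot all_order all_algebra.
From mathcomp Require Import all_classical all_reals all_analysis.

Set Implicit Arguments.
Unset Strict Implicit.
Unset Printing Implicit Defensive.

Import Order.TTheory GRing.Theory Num.Theory.
Import numFieldNormedType.Exports.

Local Open Scope quotient_scope.
Local Open Scope classical_set_scope.
Local Open Scope ring_scope.

(* |q|_p = p ^ (v_p(denominator) - v_p(numerator)). *)
Definition padic_abs (p : nat) (q : rat) : rat :=
  if q == 0 then 0
  else p%:R ^+ logn p `|denq q|%N / p%:R ^+ logn p `|numq q|%N.

Section PadicAbsTheory.
Variables (p : nat) (p_pr : prime p).
Local Notation absp := (padic_abs p).

Let p_gt0 : 0 < p%:R :> rat. Proof. by rewrite ltr0n prime_gt0. Qed.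
Let p_neq0 : p%:R != 0 :> rat. Proof. by rewrite gt_eqF. Qed.
Let pX_neq0 k : p%:R ^+ k != 0 :> rat. Proof. by rewrite expf_neq0. Qed.

Implicit Types q r : rat.

Lemma padic_abs0 : absp 0 = 0. Proof. by rewrite /padic_abs eqxx. Qed.

Lemma padic_abs_frac (a b : int) : a != 0 -> b != 0 ->
  absp (a%:~R / b%:~R) = p%:R ^+ logn p `|b|%N / p%:R ^+ logn p `|a|%N.
Proof.
move=> a0 b0; pose q : rat := a%:~R / b%:~R; rewrite -/q.
have bQ : b%:~R != 0 :> rat by rewrite intr_eq0.
have q0 : q != 0 by rewrite mulf_neq0 ?invr_eq0 ?intr_eq0.
rewrite /padic_abs (negbTE q0).
have E : numq q * b = a * denq q.
  apply/eqP; rewrite -(eqr_int rat) !intrM; apply/eqP.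
  have dQ : (denq q)%:~R != 0 :> rat by rewrite intr_eq0 denq_neq0.
  have {1}-> : (numq q)%:~R = q * (denq q)%:~R.
    by rewrite -{2}[q]divq_num_den mulfVK.
  by rewrite mulrAC /q divfK.
have n0 : (0 < `|numq q|)%N by rewrite absz_gt0 numq_eq0.
have d0 : (0 < `|denq q|)%N by rewrite absz_gt0 denq_eq0.
have := congr1 (fun x : int => logn p `|x|%N) E.
rewrite !abszM !lognM ?absz_gt0 ?numq_eq0 ?denq_eq0 // => /(congr1 (fun k => p%:R ^+ k : rat)).
rewrite !exprD => {}E; apply/eqP; rewrite eqr_div //; apply/eqP.
by rewrite mulrC -E mulrC.
Qed.

Lemma padic_abs_eq0 q : (absp q == 0) = (q == 0).
Proof.
have [->|q0] := eqVneq q 0; first by rewrite padic_abs0 eqxx.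
rewrite /padic_abs (negbTE q0); by apply/negbTE; rewrite mulf_neq0 ?invr_eq0.
Qed.

Lemma padic_abs_ge0 q : 0 <= absp q.
Proof.
by rewrite /padic_abs; case: ifP => // _; rewrite divr_ge0 ?exprn_ge0 ?ler0n.
Qed.

Lemma padic_absM q r : absp (q * r) = absp q * absp r.
Proof.
have [->|q0] := eqVneq q 0; first by rewrite mul0r padic_abs0 mul0r.
have [->|r0] := eqVneq r 0; first by rewrite mulr0 padic_abs0 mulr0.
rewrite -[q]divq_num_den -[r]divq_num_den mulf_div -!intrM.
rewrite !padic_abs_frac ?mulf_neq0 ?numq_eq0 ?denq_eq0 //.
by rewrite !abszM !lognM ?absz_gt0 ?numq_eq0 ?denq_eq0 // !exprD mulf_div.
Qed.

Lemma padic_abs1 : absp 1 = 1.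
Proof. by rewrite -[1]/(1%:~R) -[X in absp X]divr1 (@padic_abs_frac 1 1) //= logn1 expr0 divr1. Qed.

Lemma padic_absN q : absp (- q) = absp q.
Proof. by rewrite /padic_abs oppr_eq0 denqN numqN abszN. Qed.

Lemma padic_absB q r : absp (q - r) = absp (r - q).
Proof. by rewrite -padic_absN opprB. Qed.

Lemma padic_absV q : absp (q^-1) = (absp q)^-1.
Proof.
have [->|q0] := eqVneq q 0; first by rewrite !(padic_abs0, invr0).
have h : absp q != 0 by rewrite padic_abs_eq0.
by apply: (mulfI h); rewrite -padic_absM !divff ?padic_abs1.
Qed.

Lemma padic_abs_int (a : int) : absp (a%:~R) <= 1.
Proof.
have [->|a0] := eqVneq a 0; first by rewrite padic_abs0.
rewrite -[a%:~R]divr1 (@padic_abs_frac a 1) //= logn1 expr0 mul1r.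
by rewrite invf_le1 ?exprn_gt0 // exprn_ege1 // ler1n prime_gt0.
Qed.

Lemma padic_abs_le1 q : (absp q <= 1) = ~~ (p %| `|denq q|)%N.
Proof.
have [->|q0] := eqVneq q 0; first by rewrite padic_abs0 Euclid_dvd1.
have n0 : (0 < `|numq q|)%N by rewrite absz_gt0 numq_eq0.
have d0 : (0 < `|denq q|)%N by rewrite absz_gt0 denq_eq0.
rewrite /padic_abs (negbTE q0) ler_pdivrMr ?exprn_gt0 // mul1r.
rewrite ler_eXn2l ?ltr1n ?prime_gt1 //.
have /orP[pd|nd] := orbN (p %| `|denq q|)%N.
  rewrite pd; apply/negbTE; rewrite -ltnNge.
  suff /eqP-> : logn p `|numq q|%N == 0%N by rewrite logn_gt0 mem_primes p_pr d0.
  rewrite -leqn0 leqNgt logn_gt0 mem_primes p_pr n0 /=; apply/negP => pn.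
  have : (p %| gcdn `|numq q| `|denq q|)%N by rewrite dvdn_gcd pn pd.
  by move: (coprime_num_den q); rewrite /coprime => /eqP->; rewrite Euclid_dvd1.
rewrite nd; suff /eqP-> : logn p `|denq q|%N == 0%N by [].
by rewrite -leqn0 leqNgt logn_gt0 mem_primes p_pr d0.
Qed.

Lemma padic_abs_le1D q : absp q <= 1 -> absp (1 + q) <= 1.
Proof.
rewrite padic_abs_le1 => nd.
have d0 : denq q != 0 by rewrite denq_eq0.
have dQ : (denq q)%:~R != 0 :> rat by rewrite intr_eq0.
have -> : 1 + q = (denq q + numq q)%:~R / (denq q)%:~R.
  by rewrite intrD mulrDl divff // divq_num_den.
rewrite padic_absM padic_absV -[leRHS]mulr1 ler_pM ?invr_ge0 ?padic_abs_ge0 //.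
  exact: padic_abs_int.
rewrite -[(denq q)%:~R]divr1 (@padic_abs_frac _ 1) //= logn1 expr0 div1r invrK.
suff /eqP-> : logn p `|denq q|%N == 0%N by [].
by rewrite -leqn0 leqNgt logn_gt0 mem_primes p_pr (negbTE nd) !andbF.
Qed.

Lemma padic_abs_ultra q r : absp (q + r) <= Num.max (absp q) (absp r).
Proof.
wlog le_rq : q r / absp r <= absp q.
  move=> H; have /orP[] := le_total (absp r) (absp q); first exact: H.
  by rewrite addrC maxC; exact: H.
rewrite (max_idPl le_rq).
have [q0|q0] := eqVneq q 0.
  by move: le_rq; rewrite q0 add0r.
have qa : 0 < absp q by rewrite lt_def padic_abs_eq0 q0 padic_abs_ge0.
have -> : q + r = q * (1 + r / q) by rewrite mulrDr mulr1 mulrC divfK.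
rewrite padic_absM ger_pMr // padic_abs_le1D // padic_absM padic_absV.
by rewrite ler_pdivrMr // mul1r.
Qed.

Lemma padic_abs_ultra_lt q r e : absp q < e -> absp r < e -> absp (q + r) < e.
Proof.
by move=> qe re; apply: le_lt_trans (padic_abs_ultra _ _) _; rewrite gt_max qe.
Qed.

Lemma padic_abs_near q r : absp (q - r) < absp r -> absp q = absp r.
Proof.
move=> h; apply/eqP; rewrite eq_le; apply/andP; split.
  rewrite -[q](subrK r); apply: le_trans (padic_abs_ultra _ _) _.
  by rewrite (max_idPr (ltW h)).
rewrite leNgt; apply/negP => h'.
have : absp r < absp r.
  rewrite -{1}[r](subKr q); apply: padic_abs_ultra_lt => //.
  by rewrite padic_absN.
by rewrite ltxx.
Qed.

End PadicAbsTheory.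

Definition padic_cauchy (p : nat) (u : nat -> rat) : Prop :=
  forall e : rat, 0 < e -> exists N : nat,
    forall i j : nat, (N <= i)%N -> (N <= j)%N -> padic_abs p (u i - u j) < e.

Definition padic_null (p : nat) (u : nat -> rat) : Prop :=
  forall e : rat, 0 < e -> exists N : nat,
    forall i : nat, (N <= i)%N -> padic_abs p (u i) < e.

Section CauchySequences.
Variables (p : nat) (p_pr : prime p).

(* The proof of [prime p] is an argument so that the closure and ring instances
   below, which need it, can be attached to the terms it indexes. *)
Definition cauchy_pred of prime p : {pred nat -> rat} :=
  fun u => `[< padic_cauchy p u >].

Lemma cauchy_bounded u : padic_cauchy p u ->
  exists2 M : rat, 0 < M & forall i, padic_abs p (u i) <= M.
Proof.
move=> /(_ 1 ltr01)[N uN].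
pose M := \sum_(i < N.+1) padic_abs p (u i) + 1.
have S0 k : 0 <= \sum_(i < k) padic_abs p (u i).
  by apply: sumr_ge0 => i _; exact: padic_abs_ge0.
exists M => [|i]; first by rewrite ltr_wpDl.
have small k : (k <= N)%N -> padic_abs p (u k) <= M.
  move=> kN; rewrite /M (bigD1 (Ordinal (kN : k < N.+1)%N)) //= -addrA lerDl.
  by rewrite addr_ge0 // sumr_ge0 // => j _; exact: padic_abs_ge0.
have [/small//|/ltnW Ni] := leqP i N.
rewrite -[u i](subrK (u N)); apply: le_trans (padic_abs_ultra p_pr _ _) _.
rewrite ge_max small // andbT; apply/ltW/(lt_le_trans (uN _ _ Ni (leqnn N))).
by rewrite /M lerDr.
Qed.

Lemma cauchy_subring_closed : subring_closed (cauchy_pred p_pr).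
Proof.
split=> [|u v /asboolP cu /asboolP cv|u v /asboolP cu /asboolP cv]; apply/asboolP.
- by move=> e e0; exists 0%N => i j _ _ /=; rewrite subrr padic_abs0.
- move=> e e0; have [N uN] := cu e e0; have [M vM] := cv e e0.
  exists (maxn N M) => i j; rewrite !geq_max => /andP[Ni Mi] /andP[Nj Mj].
  rewrite [X in padic_abs _ X](_ : _ = (u i - u j) + (v j - v i)).
    apply: (padic_abs_ultra_lt p_pr); first exact: uN.
    exact: vM.
  by rewrite !fctE opprD opprK addrACA; congr (_ + _); rewrite addrC.
- move=> e e0; have [A A0 uA] := cauchy_bounded cu.
  have [B B0 vB] := cauchy_bounded cv.
  have [N uN] := cu (e / B) (divr_gt0 e0 B0).
  have [M vM] := cv (e / A) (divr_gt0 e0 A0).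
  exists (maxn N M) => i j; rewrite !geq_max => /andP[Ni Mi] /andP[Nj Mj].
  rewrite [X in padic_abs _ X](_ : _ = (u i - u j) * v i + u j * (v i - v j)); last first.
    by rewrite !fctE mulrBl mulrBr addrA subrK.
  apply: (padic_abs_ultra_lt p_pr); rewrite padic_absM //.
    have := uN i j Ni Nj; rewrite ltr_pdivlMr //; apply: le_lt_trans.
    by rewrite ler_wpM2l ?padic_abs_ge0.
  have := vM i j Mi Mj; rewrite ltr_pdivlMr // mulrC; apply: le_lt_trans.
  by rewrite ler_wpM2r ?padic_abs_ge0.
Qed.

HB.instance Definition _ := GRing.isSubringClosed.Build (nat -> rat)
  (cauchy_pred p_pr) cauchy_subring_closed.

Record cauchy_seq := CauchySeq {
  cauchy_val :> nat -> rat ;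
  _ : cauchy_val \in cauchy_pred p_pr }.

HB.instance Definition _ := [isSub for cauchy_val].
HB.instance Definition _ := [Choice of cauchy_seq by <:].
HB.instance Definition _ := [SubChoice_isSubComNzRing of cauchy_seq by <:].

Lemma cauchy_seqP (u : cauchy_seq) : padic_cauchy p u.
Proof. by apply/asboolP; have := valP u. Qed.

Definition null_pred : {pred cauchy_seq} := fun u => `[< padic_null p u >].

Lemma null_idealr_closed : idealr_closed null_pred.
Proof.
split=> [||a u v /asboolP nu /asboolP nv].
- by apply/asboolP => e e0; exists 0%N => i _ /=; rewrite padic_abs0.
- apply/asboolP => /(_ 1 ltr01)[N /(_ N (leqnn N))].
  by rewrite /= padic_abs1 // ltxx.
- apply/asboolP => e e0; have [A A0 aA] := cauchy_bounded (cauchy_seqP a).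
  have [N uN] := nu (e / A) (divr_gt0 e0 A0); have [M vM] := nv e e0.
  exists (maxn N M) => i; rewrite geq_max => /andP[Ni Mi].
  rewrite [X in padic_abs _ X](_ : _ = a i * u i + v i) //.
  apply: (padic_abs_ultra_lt p_pr); last exact: vM.
  rewrite padic_absM //; have := uN i Ni; rewrite ltr_pdivlMr // mulrC.
  by apply: le_lt_trans; rewrite ler_wpM2r ?padic_abs_ge0.
Qed.

HB.instance Definition _ := isIdealr.Build cauchy_seq null_pred
  null_idealr_closed.

Lemma cauchy_abs_stable (u : cauchy_seq) : u \notin null_pred ->
  exists N c, c != 0 /\ forall i, (N <= i)%N -> padic_abs p (u i) = c.
Proof.
move=> /negP nu; have [e e0 He] : exists2 e : rat, 0 < e &
    forall N, exists2 i, (N <= i)%N & e <= padic_abs p (u i).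
  apply: contrapT => h; apply: nu; apply/asboolP => e e0.
  apply: contrapT => h'; apply: h; exists e => // N.
  apply: contrapT => h''; apply: h'; exists N => i Ni.
  by rewrite ltNge; apply/negP => h3; apply: h''; exists i.
have [N uN] := cauchy_seqP u e0; have [k Nk ek] := He N.
exists N, (padic_abs p (u k)); split.
  by rewrite gt_eqF // (lt_le_trans e0).
move=> i Ni; apply: (padic_abs_near p_pr).
exact: lt_le_trans (uN i k Ni Nk) ek.
Qed.

Lemma cauchy_inv_subproof (u : cauchy_seq) : u \notin null_pred ->
  (fun i => (u i)^-1) \in cauchy_pred p_pr.
Proof.
move=> /cauchy_abs_stable[N [c [c0 uc]]]; apply/asboolP => e e0.
have cp : 0 < c.
  by rewrite lt_def c0 -(uc N) // padic_abs_ge0.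
have [M uM] := cauchy_seqP u (mulr_gt0 e0 (mulr_gt0 cp cp)).
exists (maxn N M) => i j; rewrite !geq_max => /andP[Ni Mi] /andP[Nj Mj].
have ui : u i != 0 by rewrite -(padic_abs_eq0 p_pr) uc.
have uj : u j != 0 by rewrite -(padic_abs_eq0 p_pr) uc.
have -> : (u i)^-1 - (u j)^-1 = (u j - u i) / (u i * u j).
  by rewrite mulrBl invfM mulrCA divff // mulr1 mulrA divff // mul1r.
by rewrite padic_absM // padic_absV // padic_absM // !uc // ltr_pdivrMr ?mulr_gt0 // uM.
Qed.

(* The field Q_p: Cauchy sequences of rationals for |.|_p modulo null ones. *)
Definition padic := {ideal_quot null_pred}.

HB.instance Definition _ := NzRingQuotient.on padic.
HB.instance Definition _ := GRing.ComNzRing.on padic.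

Lemma padic_invertible (x : padic) : x != 0 -> exists y, y * x = 1.
Proof.
rewrite -[x]reprK; set u := repr x => x0.
have nu : u \notin null_pred.
  apply: contra x0; rewrite -{1}[u]subr0 Quotient.idealrBE => /eqP ->.
  by rewrite rmorph0.
pose v := CauchySeq (cauchy_inv_subproof nu).
exists (\pi_padic v); apply/eqP; rewrite -rmorphM -(rmorph1 (\pi_padic)).
rewrite -Quotient.idealrBE; apply/asboolP => e e0.
have [N [c [c0 uc]]] := cauchy_abs_stable nu.
exists N => i Ni; rewrite [X in padic_abs _ X](_ : _ = (u i)^-1 * u i - 1) //.
have ui : u i != 0 by rewrite -(padic_abs_eq0 p_pr) uc.
by rewrite mulVf // subrr padic_abs0.
Qed.

Definition padic_inv (x : padic) : padic :=
  if x == 0 then 0 else xget 0 [set y | y * x = 1].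


Lemma padic_mulVf (x : padic) : x != 0 -> padic_inv x * x = 1.
Proof.
move=> x0; rewrite /padic_inv (negbTE x0).
exact: (xgetPex 0 (padic_invertible x0)).
Qed.

Lemma padic_inv0 : padic_inv 0 = 0.
Proof. by rewrite /padic_inv eqxx. Qed.

HB.instance Definition _ := GRing.ComNzRing_isField.Build padic
  padic_mulVf padic_inv0.

(* The limit is taken in rat: a Cauchy sequence that is not null has an
   eventually constant absolute value. *)
Definition padic_norm (x : padic) : rat :=
  lim ((padic_abs p (repr x i) : rat^o) @[i --> \oo]).

Lemma null_abs_cvg (u : nat -> rat) : padic_null p u ->
  (padic_abs p (u i) : rat^o) @[i --> \oo] --> (0 : rat^o).
Proof.
move=> nu; apply/cvgrPdist_lt => e e0; have [N uN] := nu e e0.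
exists N => // i /= Ni; rewrite sub0r normrN ger0_norm ?padic_abs_ge0 //.
exact: uN.
Qed.

Lemma padic_norm_pi (u : cauchy_seq) :
  (padic_abs p (u i) : rat^o) @[i --> \oo] --> (padic_norm (\pi_padic u) : rat^o).
Proof.
rewrite /padic_norm; set r := repr _.
have ru : u - r \in null_pred by rewrite Quotient.idealrBE reprK.
have [nu|nu] := boolP (u \in null_pred).
  have nr : r \in null_pred.
    by rewrite -[r](subKr u) rpredB.
  move/asboolP: nu => /null_abs_cvg cu; move/asboolP: nr => /null_abs_cvg cr.
  by rewrite (cvg_lim (@norm_hausdorff _ _) cr).
have [N [c [c0 uc]]] := cauchy_abs_stable nu.
have cp : 0 < c by rewrite lt_def c0 -(uc N) // padic_abs_ge0.
move/asboolP: ru => /(_ c cp)[M urM].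
have cr : (padic_abs p (r i) : rat^o) @[i --> \oo] --> (c : rat^o).
  apply: cvg_near_cst; exists (maxn N M) => // i /=.
  rewrite geq_max => /andP[Ni Mi]; rewrite -(uc i Ni).
  apply: (padic_abs_near p_pr); rewrite uc // padic_absB.
  exact: urM.
rewrite (cvg_lim (@norm_hausdorff _ _) cr).
by apply: cvg_near_cst; exists N.
Qed.

Lemma padic_norm_ge0 x : 0 <= padic_norm x.
Proof.
rewrite -[x]reprK; apply: (cvgr_to_ge (@padic_norm_pi (repr x))).
by near=> i; exact: padic_abs_ge0.
Unshelve. all: by end_near. Qed.

Lemma padic_norm0 : padic_norm 0 = 0.
Proof.
rewrite -(rmorph0 \pi_padic).
apply: (cvg_unique (@norm_hausdorff _ _) (@padic_norm_pi _)).
by apply: cvg_near_cst; exists 0%N => // i _ /=; rewrite padic_abs0.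
Qed.

Lemma padic_norm_eq0 x : padic_norm x = 0 -> x = 0.
Proof.
rewrite -[x]reprK; set u := repr x => ux.
apply/eqP; rewrite -(rmorph0 \pi_padic) -Quotient.idealrBE subr0.
apply: contraT => /cauchy_abs_stable[N [c [c0 uc]]].
suff cE : c = 0 by rewrite cE eqxx in c0.
rewrite -ux; apply: (cvg_unique (@norm_hausdorff _ _) _ (@padic_norm_pi _)).
by apply: cvg_near_cst; exists N.
Qed.

Lemma padic_norm1 : padic_norm 1 = 1.
Proof.
rewrite -(rmorph1 \pi_padic).
apply: (cvg_unique (@norm_hausdorff _ _) (@padic_norm_pi _)).
by apply: cvg_near_cst; exists 0%N => // i _ /=; rewrite padic_abs1.
Qed.

Lemma padic_normM x y : padic_norm (x * y) = padic_norm x * padic_norm y.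
Proof.
rewrite -[x]reprK -[y]reprK -rmorphM.
apply: (cvg_unique (@norm_hausdorff _ _) (@padic_norm_pi _)).
have xy := cvgM (@padic_norm_pi (repr x)) (@padic_norm_pi (repr y)).
suff -> : (fun i => padic_abs p ((repr x * repr y : cauchy_seq) i) : rat^o) =
  (fun i => padic_abs p (repr x i) : rat^o) \*
  (fun i => padic_abs p (repr y i) : rat^o) by exact: xy.
by apply/funext => i /=; rewrite -padic_absM.
Qed.

Lemma padic_normN x : padic_norm (- x) = padic_norm x.
Proof.
rewrite -[x]reprK -rmorphN.
apply: (cvg_unique (@norm_hausdorff _ _) (@padic_norm_pi _)).
suff -> : (fun i => padic_abs p ((- repr x : cauchy_seq) i) : rat^o) =
  (fun i => padic_abs p (repr x i) : rat^o) by exact: padic_norm_pi.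
by apply/funext => i; exact: padic_absN.
Qed.

Lemma padic_norm_ultra x y :
  padic_norm (x + y) <= Num.max (padic_norm x) (padic_norm y).
Proof.
apply/ler_addgt0Pr => e e0; rewrite -[x]reprK -[y]reprK -rmorphD.
set m := Num.max _ _.
have me a : a <= m -> a < m + e by move=> am; rewrite ltr_pwDr.
have hx := cvgr_lt _ (@padic_norm_pi (repr x)) (m + e).
have hy := cvgr_lt _ (@padic_norm_pi (repr y)) (m + e).
apply: (cvgr_to_le (@padic_norm_pi (repr x + repr y))).
near=> i; apply/ltW/(padic_abs_ultra_lt p_pr).
  by near: i; apply: hx; apply: me; rewrite le_max lexx.
by near: i; apply: hy; apply: me; rewrite le_max lexx orbT.
Unshelve. all: by end_near. Qed.

Lemma padic_norm_triangle x y :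
  padic_norm (x + y) <= padic_norm x + padic_norm y.
Proof.
apply: le_trans (padic_norm_ultra x y) _.
by rewrite ge_max lerDl lerDr !padic_norm_ge0.
Qed.

Definition padic_dist (x y : padic) : rat := padic_norm (x - y).

Lemma padic_distxx x : padic_dist x x = 0.
Proof. by rewrite /padic_dist subrr padic_norm0. Qed.

Lemma padic_dist_eq0 x y : padic_dist x y = 0 -> x = y.
Proof. by move=> /padic_norm_eq0/eqP; rewrite subr_eq0 => /eqP. Qed.

Lemma padic_dist_sym x y : padic_dist x y = padic_dist y x.
Proof. by rewrite /padic_dist -padic_normN opprB. Qed.

Lemma padic_dist_triangle y x z :
  padic_dist x z <= padic_dist x y + padic_dist y z.
Proof. by rewrite /padic_dist -(subrKA y) padic_norm_triangle. Qed.

HB.instance Definition _ := isMetric.Build rat padic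
  padic_distxx padic_dist_eq0 padic_dist_sym padic_dist_triangle.

Lemma padic_ratrE (q : rat) : exists2 u : cauchy_seq,
  forall i, u i = q & ratr q = \pi_padic u.
Proof.
have cP (r : rat) : (fun=> r) \in cauchy_pred p_pr.
  by apply/asboolP => e e0; exists 0%N => i j _ _; rewrite subrr padic_abs0.
pose c r := \pi_padic (CauchySeq (cP r)).
have cB : zmod_morphism c.
  move=> r s; rewrite /c -rmorphB; congr (\pi_padic _); exact: val_inj.
have cM : monoid_morphism c.
  split=> [|r s]; first by rewrite -(rmorph1 \pi_padic); congr (\pi_padic _); exact: val_inj.
  by rewrite /c -rmorphM; congr (\pi_padic _); exact: val_inj.
pose cA := GRing.isZmodMorphism.Build _ _ c cB.
pose cR := GRing.isMonoidMorphism.Build _ _ c cM.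
pose c' : {rmorphism rat -> padic} := HB.pack c cA cR.
exists (CauchySeq (cP q)) => //.
by rewrite -[RHS]/(c' q) -(fmorph_eq_rat c').
Qed.

Lemma padic_ratrB (q r : rat) : ratr (q - r) = ratr q - ratr r :> padic.
Proof.
have [u uE ->] := padic_ratrE (q - r).
have [v vE ->] := padic_ratrE q; have [w wE ->] := padic_ratrE r.
rewrite -rmorphB; congr (\pi_padic _); apply/val_inj/funext => i /=.
by rewrite uE -(vE i) -(wE i).
Qed.

(* [padic_norm] extends the p-adic absolute value of rat. *)
Lemma padic_norm_ratr (q : rat) : padic_norm (ratr q) = padic_abs p q.
Proof.
have [u uE ->] := padic_ratrE q.
apply: (cvg_unique (@norm_hausdorff _ _) (@padic_norm_pi _)).
by apply: cvg_near_cst; exists 0%N => // i _ /=; rewrite uE.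
Qed.

Lemma padic_rat_approx (u : cauchy_seq) (e : rat) : 0 < e ->
  exists N, forall i, (N <= i)%N -> padic_norm (\pi_padic u - ratr (u i)) < e.
Proof.
move=> e0; have e20 : 0 < e / 2 by rewrite divr_gt0.
have [N uN] := cauchy_seqP u e20; exists N => i Ni.
have [v vE ->] := padic_ratrE (u i); rewrite -rmorphB.
apply: (@le_lt_trans _ _ (e / 2)); last by rewrite ltr_pdivrMr // ltr_pMr // ltr1n.
apply: (cvgr_to_le (@padic_norm_pi (u - v))); exists N => // j /= Nj.
rewrite [X in padic_abs _ X](_ : _ = u j - u i); last by rewrite -(vE j).
by apply/ltW/uN.
Qed.

Lemma padic_rat_dense (x : padic) (e : rat) : 0 < e ->
  exists q : rat, padic_norm (x - ratr q) < e.
Proof.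
rewrite -[x]reprK => /(padic_rat_approx (repr x))[N xN].
by exists (repr x N); exact: xN.
Qed.

Lemma padic_complete (x : nat -> padic) :
  (forall e : rat, 0 < e -> exists N, forall i j, (N <= i)%N -> (N <= j)%N ->
     padic_norm (x i - x j) < e) ->
  exists y, forall e : rat, 0 < e -> exists N, forall i, (N <= i)%N ->
     padic_norm (x i - y) < e.
Proof.
move=> cx.
have lt3 a b c e : padic_norm a < e -> padic_norm b < e -> padic_norm c < e ->
    padic_norm (a + b + c) < e.
  move=> ae be ce; apply: le_lt_trans (padic_norm_ultra _ _) _.
  rewrite gt_max ce andbT; apply: le_lt_trans (padic_norm_ultra _ _) _.
  by rewrite gt_max ae.
have inv_small (e : rat) : 0 < e -> exists N, forall i, (N <= i)%N -> i.+1%:R^-1 < e.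
  move=> e0; exists (Num.truncn e^-1) => i Ni.
  rewrite invf_plt ?posrE // ?ltr0n //.
  apply: lt_le_trans (Num.Theory.truncnS_gt _) _.
  by rewrite ler_nat ltnS.
have /choice[q qE] i : exists q : rat, padic_norm (x i - ratr q) < i.+1%:R^-1.
  by apply: padic_rat_dense; rewrite invr_gt0 ltr0n.
have qC : q \in cauchy_pred p_pr.
  apply/asboolP => e e0; have [N xN] := cx e e0; have [M MN] := inv_small e e0.
  exists (maxn N M) => i j; rewrite !geq_max => /andP[Ni Mi] /andP[Nj Mj].
  rewrite -padic_norm_ratr padic_ratrB.
  rewrite [X in padic_norm X](_ : _ =
    (ratr (q i) - x i) + (x i - x j) + (x j - ratr (q j))); last first.
    by rewrite !(addrA, subrK).
  apply: lt3; last 2 first.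
  - exact: xN.
  - exact: lt_trans (qE j) (MN _ Mj).
  - by rewrite -padic_normN opprB; exact: lt_trans (qE i) (MN _ Mi).
exists (\pi_padic (CauchySeq qC)) => e e0.
have [N qN] := padic_rat_approx (CauchySeq qC) e0; have [M MN] := inv_small e e0.
exists (maxn N M) => i; rewrite geq_max => /andP[Ni Mi].
rewrite [X in padic_norm X](_ : _ =
  (x i - ratr (q i)) + (ratr (q i) - \pi_padic (CauchySeq qC)) + 0); last first.
  by rewrite addr0 !(addrA, subrK).
apply: lt3; first exact: lt_trans (qE i) (MN _ Mi).
- by rewrite -padic_normN opprB; exact: qN.
- by rewrite padic_norm0.
Qed.

End CauchySequences.

(* No compatibility between the two structures is required: only the instances
   [R : realType] and [padic p_pr] are used below. *)
#[short(type="topFieldType")]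
HB.structure Definition TopologicalField :=
  {K of GRing.Field K & Topological K}.

#[non_forgetful_inheritance, warnings="-redundant-canonical-projection"]
HB.instance Definition _ (R : realType) := Topological.on R.
#[warnings="-redundant-canonical-projection"]
HB.instance Definition _ (p : nat) (p_pr : prime p) :=
  Topological.on (padic p_pr).

(* The canonical topology of a finite-dimensional vector space: the one making
   the coordinates in a basis, with values in the product space
   ['rV[K]_(\dim {:V})], a homeomorphism (the choice of the basis is
   immaterial). *)
Definition vtop (K : topFieldType) (V : vectType K) : Type :=
  initial_topology (passmx.rVof (vbasis {:V}) : V -> 'rV[K]_(\dim {:V})).

HB.instance Definition _ (K : topFieldType) (V : vectType K) :=
  Topological.on (vtop V).
HB.instance Definition _ (K : topFieldType) (V : vectType K) :=
  isPointed.Build (vtop V) (0 : V).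

Definition borel (K : topFieldType) (V : vectType K) : Type :=
  g_sigma_algebraType (@open (vtop V)).

HB.instance Definition _ (K : topFieldType) (V : vectType K) :=
  Measurable.on (borel V).

Section MeasuresOnVectorSpaces.
Variables (R : realType) (K : topFieldType) (V : vectType K).
Implicit Types (mu nu : set (borel V) -> \bar R) (T : V -> V).

Definition continuous_automorphism T : Prop :=
  [/\ zmod_morphism T, continuous (T : vtop V -> vtop V) &
      exists S : V -> V,
        [/\ cancel T S, cancel S T & continuous (S : vtop V -> vtop V)]].

(* Defined on set functions so that it can be iterated. *)
Definition convolution mu nu : set (borel V) -> \bar R :=
  pushforward (mu \x nu)%E
    (fun z : borel V * borel V => (z.1 : V) + (z.2 : V) : borel V).

Definition convolution_power mu (n : nat) : set (borel V) -> \bar R :=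
  iter n (convolution mu) \d_((0 : V) : borel V).

Definition semistable T (n : nat) mu : Prop :=
  forall B : set (borel V), measurable B ->
    pushforward (convolution_power mu n) (T : borel V -> borel V) B = mu B.

(* Vector subspaces are closed, so a probability measure is supported on a
   coset [a + W] exactly when it gives it mass 1. *)
Definition full (mu : probability (borel V) R) : Prop :=
  forall (W : {vspace V}) (a : V),
    mu [set x : borel V | (x : V) - a \in W] = 1%E -> W = fullv.

(* [vtop V] is second countable and locally compact in the cases considered, so
   that finiteness on compact sets entails regularity. *)
Definition haar_measure (lambda : {measure set (borel V) -> \bar R}) : Prop :=
  [/\ lambda [set: borel V] != 0%E,
      forall C : set (vtop V), compact C -> (lambda C < +oo)%E &
      forall (a : V) (B : set (borel V)), measurable B ->
        lambda [set x : borel V | B ((x : V) + a)] = lambda B].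

End MeasuresOnVectorSpaces.

(* Main.v *)
From HB Require Import structures.
From mathcomp Require Import all_boot all_order all_algebra.
From mathcomp Require Import all_classical all_reals all_analysis.
From mathcomp Require Import measurable_realfun.
From mathcomp Require Import ring lra.
Require Import Defs.

Set Implicit Arguments.
Unset Strict Implicit.
Unset Printing Implicit Defensive.

Import Order.TTheory GRing.Theory Num.Theory.
Import numFieldNormedType.Exports.

Local Open Scope classical_set_scope.
Local Open Scope ring_scope.

(** Let [mu] be a full probability on [V] with [mu = T (mu^n)], and let [u] be
    the squared modulus of its Fourier transform (identifying [V] with its dual
    by the pairing [dot]).  If [A] is the adjoint of [T] then
    [u (A x) ^+ n = u x]: moving along an orbit of [A] replaces [u] by its [n]-th
    root, hence drives it to [1] where it is not zero.

    The first half of the proof exploits this equation ([superlevel_bounded]).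
    Near [0] one has [u > 1/2], so high iterates of [A] send a small ball into
    points [x] with [u >= c] on the whole unit ball of the line [K x], for [c]
    close to [1].  Fullness says that [u] is not identically [1] on any line
    ([full_fsqr]), so by compactness such points form a bounded set: forward
    orbits are bounded.  On the other hand [{u = 1}] is a closed subgroup stable
    under [A], and is bounded as well.  A point of a superlevel set lying far
    away would have its whole orbit outside of a large ball, since it cannot
    cross an annulus on which [u] is small; on a bounded set outside of that
    ball [u] is bounded away from [1], which contradicts the convergence of [u]
    to [1] along the orbit.  So a superlevel set [{u >= c}] is bounded and has
    finite Haar measure.

    The sets [{u >= c^(n^k)}] are its iterated images by the inverse of [A], of
    geometrically growing volume, whereas [u^q] is much smaller outside of
    them: hence some power [u^q] is integrable ([integrable_power]).

    The second half turns integrability into densities.  For [N = n^j] large,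
    the Fourier transform of [mu^N] has an integrable modulus, and Parseval's
    formula against uniform laws on balls bounds the mass of every small ball by
    a constant times its volume ([small_ball_le]); averaging over centers and
    using regularity, [mu^N <= C lambda] ([dominated]).  Since [mu^(n^k)] is the
    image of [mu^(n^(k+1))] under [T], which multiplies [lambda] by a constant,
    the domination descends to [mu] itself.  Finally [mu] is the convolution of
    [T mu] and [T (mu^(n-1))].  Both are dominated by [lambda], so the first has
    a bounded density [g] ([bounded_density]), and integrating the translates of
    [g] against the second gives a density of [mu] that is bounded and, because
    the second is dominated, continuous ([smoothed_cont]).

    The argument is the same over the reals and over the [p]-adic numbers.  It
    uses the properties collected in [local_field]: an absolute value giving the
    topology, with compact balls and dense rationals, and a nontrivial additive
    character.  The only step with two cases is the boundedness of the subgroup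
    [{u = 1}], where the integers are either unbounded or dense in the unit
    ball. *)

(** * Local fields and their additive characters *)

(** [ch] and [sh] are the real and imaginary parts of a nontrivial additive
    character, kept apart so that all integrals are real.  The two cases of
    [abv_int] are the archimedean one and the one where the integers are dense
    in the unit ball. *)
Record local_field (R : realType) (K : topFieldType) (abv ch sh : K -> R) :
    Prop := LocalField {
  abv_ge0 : forall x, 0 <= abv x ;
  abv_eq0 : forall x, abv x = 0 -> x = 0 ;
  abvM : forall x y, abv (x * y) = abv x * abv y ;
  abvD : forall x y, abv (x + y) <= abv x + abv y ;
  abv_nbhs : forall (x : K) (A : set K),
    nbhs x A <-> exists2 e : R, 0 < e & forall y, abv (y - x) < e -> A y ;
  abv_compact : forall r : R, compact [set x : K | abv x <= r] ;
  abv_small : exists2 x, 0 < abv x & abv x < 1 ;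
  abv_rat : forall x (e : R), 0 < e -> exists (a : int) (b : nat),
    b%:R != 0 :> K /\ abv (x - a%:~R / b%:R) < e ;
  abv_int : ((forall a, exists m : int, abv (a - m%:~R) <= 1) /\
             (forall M : R, exists m : nat, M <= abv m%:R)) \/
    (forall a (e : R), abv a <= 1 -> 0 < e -> exists m : int, abv (a - m%:~R) < e) ;
  ch2sh2 : forall x, ch x ^+ 2 + sh x ^+ 2 = 1 ;
  chD : forall x y, ch (x + y) = ch x * ch y - sh x * sh y ;
  shD : forall x y, sh (x + y) = sh x * ch y + ch x * sh y ;
  ch_cont0 : forall e : R, 0 < e ->
    exists2 r : R, 0 < r & forall x, abv x < r -> 1 - ch x < e ;
  ch_neq1 : exists x, ch x != 1 }.

Section LocalFieldTheory.
Variables (R : realType) (K : topFieldType) (abv ch sh : K -> R).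
Hypothesis LF : local_field abv ch sh.

Lemma abv0 : abv 0 = 0.
Proof.
have [e e0 e1] := abv_small LF.
have : abv 0 * abv e = abv 0 * 1 by rewrite -(abvM LF) mul0r mulr1.
have [//|z /(mulfI z) E] := eqVneq (abv 0) 0.
by rewrite E ltxx in e1.
Qed.

Lemma abv1 : abv 1 = 1.
Proof.
have [e e0 _] := abv_small LF.
have h : abv e * abv 1 = abv e * 1 by rewrite -(abvM LF) !mulr1.
by apply: mulfI h; rewrite gt_eqF.
Qed.

Lemma abvN x : abv (- x) = abv x.
Proof.
have h : abv (-1) = 1.
  have := abvM LF (-1) (-1); rewrite mulN1r opprK abv1 => /esym/eqP.
  rewrite -expr2 sqrf_eq1 => /orP[/eqP//|/eqP E].
  by have := abv_ge0 LF (-1); rewrite E oppr_ge0 ler10.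
by rewrite -mulN1r (abvM LF) h mul1r.
Qed.

Lemma abv_gt0 x : x != 0 -> 0 < abv x.
Proof.
move=> x0; rewrite lt_def (abv_ge0 LF) andbT; apply/eqP => /(abv_eq0 LF) E.
by rewrite E eqxx in x0.
Qed.

Lemma abvV x : abv x^-1 = (abv x)^-1.
Proof.
have [->|x0] := eqVneq x 0; first by rewrite invr0 abv0 invr0.
have a0 := abv_gt0 x0.
by apply: (mulfI (lt0r_neq0 a0)); rewrite -(abvM LF) !divff ?abv1 ?gt_eqF.
Qed.

Lemma abvX x n : abv (x ^+ n) = abv x ^+ n.
Proof.
by elim: n => [|n IH]; rewrite ?expr0 ?abv1 // !exprS (abvM LF) IH.
Qed.

Lemma abvB x y : abv (x - y) <= abv x + abv y.
Proof. by rewrite -(abvN y) (abvD LF). Qed.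

Lemma ch0 : ch 0 = 1.
Proof.
have := chD LF 0 0; have := shD LF 0 0; have := ch2sh2 LF 0.
rewrite addr0 => h1 h2 h3.
have s0 : sh 0 = 0.
  have : sh 0 * (1 - 2 * ch 0) = 0 by nra.
  move/eqP; rewrite mulf_eq0 => /orP[/eqP//|/eqP c]; nra.
nra.
Qed.

Lemma ch_le1 x : ch x <= 1. Proof. have := ch2sh2 LF x; nra. Qed.
Lemma ch_geN1 x : -1 <= ch x. Proof. have := ch2sh2 LF x; nra. Qed.
Lemma sh_le1 x : sh x <= 1. Proof. have := ch2sh2 LF x; nra. Qed.
Lemma sh_geN1 x : -1 <= sh x. Proof. have := ch2sh2 LF x; nra. Qed.

Lemma sh0 : sh 0 = 0.
Proof.
have := ch2sh2 LF 0; rewrite ch0 => h.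
by apply/eqP; rewrite -sqrf_eq0; apply/eqP; lra.
Qed.

Lemma chN x : ch (- x) = ch x /\ sh (- x) = - sh x.
Proof.
have := chD LF x (- x); have := shD LF x (- x); rewrite subrr ch0 sh0.
have := ch2sh2 LF x; have := ch2sh2 LF (- x).
set a := ch x; set b := sh x; set c := ch (- x); set d := sh (- x).
move=> _ h2 h3 h4; split.
  have : c * (a ^+ 2 + b ^+ 2) = a * (a * c - b * d) + b * (b * c + a * d) by ring.
  by rewrite h2 -h4 -h3 !mulr1 mulr0 addr0.
have : d * (a ^+ 2 + b ^+ 2) = a * (b * c + a * d) - b * (a * c - b * d) by ring.
by rewrite h2 -h4 -h3 !mulr1 mulr0 add0r.
Qed.

Lemma chB x y : ch (x - y) = ch x * ch y + sh x * sh y.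
Proof. by rewrite (chD LF) !(chN y).1 !(chN y).2 mulrN opprK. Qed.

(** The squared distance of two values of the character is [2 (1 - ch (x - y))],
    so continuity at [0] gives uniform continuity. *)
Lemma ch_unif (e : R) : 0 < e -> exists2 r, 0 < r &
  forall x y, abv (x - y) < r -> `|ch x - ch y| < e /\ `|sh x - sh y| < e.
Proof.
move=> e0; have [r r0 rP] := ch_cont0 LF (divr_gt0 (exprn_gt0 2 e0) (ltr0Sn R 1)).
exists r => // x y /rP; rewrite chB => h.
have h1 := ch2sh2 LF x; have h2 := ch2sh2 LF y.
have : (ch x - ch y) ^+ 2 + (sh x - sh y) ^+ 2 < e ^+ 2 by nra.
have sq (z : R) : z ^+ 2 < e ^+ 2 -> `|z| < e.
  by move=> ze; rewrite -(@ltr_pXn2r _ 2) ?nnegrE ?(ltW e0) // real_normK ?num_real.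
by move=> h3; split; apply: sq; have := sqr_ge0 (ch x - ch y);
  have := sqr_ge0 (sh x - sh y); lra.
Qed.

(** The powers of a small element are a geometric sequence of absolute values,
    so every positive real is one up to a bounded factor. *)
Lemma abv_approx : exists2 rho : R, 1 <= rho & forall r : R, 0 < r ->
  exists a, r <= abv a /\ abv a <= rho * r.
Proof.
have [e e0 e1] := abv_small LF.
pose q := (abv e)^-1; have q1 : 1 < q by rewrite invf_gt1.
have q0 : 0 < q by rewrite (lt_trans _ q1).
have big (r : R) : exists n, r <= q ^+ n.
  have q10 : 0 < q - 1 by rewrite subr_gt0.
  have := ltW (Num.Theory.truncnS_gt (r / (q - 1))).
  set n := (Num.truncn _).+1 => hn; exists n.
  rewrite ler_pdivrMr // in hn; apply: (le_trans hn).
  elim: (n) => [|m IH]; first by rewrite mul0r exprn_ge0 // ltW.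
  rewrite exprS -natr1 mulrDl mul1r.
  have : 1 <= q ^+ m by rewrite exprn_ege1 // ltW.
  nra.
have pos (r : R) : 1 <= r -> exists a, r <= abv a /\ abv a <= q * r.
  move=> r1; case: (ex_minnP (big r)) => -[|n] rn min.
    exists 1; rewrite abv1; split; first by rewrite expr0 in rn.
    by nra.
  exists (e^-1 ^+ n.+1); rewrite abvX abvV -/q; split => //.
  rewrite exprS ler_pM2l // leNgt; apply/negP => /ltW/min.
  by rewrite ltnn.
exists q => [|r r0]; first exact: ltW.
have [/pos//|r1] := lerP 1 r.
have [|a [ra ar]] := pos (q / r).
  by rewrite ler_pdivlMr // mul1r; nra.
have a0 : 0 < abv a by apply: lt_le_trans ra; rewrite divr_gt0.
have qa : q <= r * abv a by rewrite mulrC -ler_pdivrMr.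
have aq : r * abv a <= q * q by rewrite mulrC -ler_pdivlMr // -mulrA.
exists (e^-1 * e^-1 / a); rewrite !(abvM LF) !abvV -/q; split.
  by rewrite ler_pdivlMr.
by rewrite ler_pdivrMr // -mulrA ler_pM2l.
Qed.

End LocalFieldTheory.

(** * Finite-dimensional normed spaces *)

Lemma linear_combination (F : pzRingType) (U W : lmodType F) (f : U -> W)
  (I : Type) (s : seq I) (a : I -> F) (u : I -> U) : linear f ->
  f (\sum_(i <- s) a i *: u i) = \sum_(i <- s) a i *: f (u i).
Proof.
move=> lf; elim: s => [|i s IH]; last by rewrite !big_cons lf IH.
by rewrite !big_nil; have := lf (-1) 0 0; rewrite !scaleN1r !addNr.
Qed.

Section NormedSpace.
Variables (R : realType) (K : topFieldType) (abv ch sh : K -> R).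
Hypothesis LF : local_field abv ch sh.
Variable V : vectType K.

Definition coords (v : V) : 'rV[K]_(\dim {:V}) := passmx.rVof (vbasis {:V}) v.
Definition of_coords (x : 'rV[K]_(\dim {:V})) : V :=
  passmx.vecof (vbasis {:V}) x.

Definition nrm (v : V) : R := \sum_i abv (coords v 0 i).

Definition dot (x y : V) : K := \sum_i coords x 0 i * coords y 0 i.

Lemma coordsK : cancel coords of_coords.
Proof. exact: passmx.rVofK (vbasisP _). Qed.

Lemma of_coordsK : cancel of_coords coords.
Proof. exact: passmx.vecofK (vbasisP _). Qed.

Lemma coords_linear : linear coords.
Proof. exact: passmx.rVof_linear. Qed.

Lemma of_coords_linear : linear of_coords.
Proof. exact: passmx.vecof_linear. Qed.

HB.instance Definition _ :=
  GRing.isLinear.Build K V 'rV[K]_(\dim {:V}) *:%R coords coords_linear.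
HB.instance Definition _ :=
  GRing.isLinear.Build K 'rV[K]_(\dim {:V}) V *:%R of_coords of_coords_linear.

Lemma coordsD x y : coords (x + y) = coords x + coords y.
Proof. exact: linearD. Qed.

Lemma coordsZ a x : coords (a *: x) = a *: coords x.
Proof. exact: linearZ. Qed.

Lemma coordDE x y i : coords (x + y) 0 i = coords x 0 i + coords y 0 i.
Proof. by rewrite coordsD [LHS]mxE. Qed.

Lemma coordBE x y i : coords (x - y) 0 i = coords x 0 i - coords y 0 i.
Proof. by rewrite /= linearB [LHS]mxE [X in _ + X]mxE. Qed.

Lemma coordZE a x i : coords (a *: x) 0 i = a * coords x 0 i.
Proof. by rewrite coordsZ [LHS]mxE. Qed.

Lemma nrm_ge0 x : 0 <= nrm x.
Proof. by apply: sumr_ge0 => i _; exact: (abv_ge0 LF). Qed.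

Lemma coord_le_nrm x i : abv (coords x 0 i) <= nrm x.
Proof.
rewrite /nrm (bigD1 i) //= lerDl; apply: sumr_ge0 => j _; exact: (abv_ge0 LF).
Qed.

Lemma nrmD x y : nrm (x + y) <= nrm x + nrm y.
Proof.
rewrite /nrm -big_split; apply: ler_sum => i _ /=.
by rewrite coordDE (abvD LF).
Qed.

Lemma nrmZ a x : nrm (a *: x) = abv a * nrm x.
Proof.
by rewrite /nrm mulr_sumr; apply: eq_bigr => i _; rewrite coordZE (abvM LF).
Qed.

Lemma nrmN x : nrm (- x) = nrm x.
Proof. by rewrite -scaleN1r nrmZ (abvN LF) (abv1 LF) mul1r. Qed.

Lemma nrmB x y : nrm (x - y) <= nrm x + nrm y.
Proof. by rewrite -(nrmN y) nrmD. Qed.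

Lemma nrmC x y : nrm (x - y) = nrm (y - x).
Proof. by rewrite -nrmN opprB. Qed.

Lemma nrm0 : nrm 0 = 0.
Proof. by rewrite -(scale0r 0) nrmZ (abv0 LF) mul0r. Qed.

Lemma nrm_triangle y x z : nrm (x - z) <= nrm (x - y) + nrm (y - z).
Proof. by rewrite -(subrKA y) nrmD. Qed.

Lemma nrm_eq0 x : nrm x = 0 -> x = 0.
Proof.
move=> x0; rewrite -[x]coordsK (_ : coords x = 0) ?linear0 //.
apply/rowP => i; rewrite [RHS]mxE; apply/(abv_eq0 LF)/eqP; rewrite eq_le (abv_ge0 LF) andbT.
by rewrite -x0 coord_le_nrm.
Qed.

Lemma nrm_gt0 x : x != 0 -> 0 < nrm x.
Proof.
move=> x0; rewrite lt_def nrm_ge0 andbT; apply/eqP => /nrm_eq0 E.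
by rewrite E eqxx in x0.
Qed.

Lemma nrm_sum (I : Type) (s : seq I) (F : I -> V) :
  nrm (\sum_(i <- s) F i) <= \sum_(i <- s) nrm (F i).
Proof.
elim/big_rec2: _ => [|i a b _ h]; first by rewrite nrm0.
by apply: le_trans (nrmD _ _) _; rewrite lerD2l.
Qed.

Lemma coords_sum x : x = \sum_i coords x 0 i *: of_coords (delta_mx 0 i).
Proof.
rewrite -{1}[x]coordsK {1}[coords x]row_sum_delta.
exact: (linear_combination _ _ _ of_coords_linear).
Qed.

Lemma linear_bounded (f : V -> V) : linear f ->
  exists2 L, 0 < L & forall x, nrm (f x) <= L * nrm x.
Proof.
move=> lf; exists (1 + \sum_i nrm (f (of_coords (delta_mx 0 i)))) => [|x].
  by rewrite ltr_pwDl // sumr_ge0 // => i _; exact: nrm_ge0.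
have -> : f x = \sum_i coords x 0 i *: f (of_coords (delta_mx 0 i)).
  by rewrite {1}[x]coords_sum linear_combination.
apply: le_trans (nrm_sum _ _) _; rewrite mulrDl mul1r.
apply: (@le_trans _ _ (\sum_i nrm (f (of_coords (delta_mx 0 i))) * nrm x)); last first.
  by rewrite -mulr_suml lerDr nrm_ge0.
apply: ler_sum => i _; rewrite nrmZ mulrC ler_wpM2l ?nrm_ge0 //.
exact: coord_le_nrm.
Qed.

(** ** Bilinear pairing *)

Lemma dotC x y : dot x y = dot y x.
Proof. by apply: eq_bigr => i _; rewrite mulrC. Qed.

Lemma dotDr x y z : dot x (y + z) = dot x y + dot x z.
Proof.
by rewrite /dot -big_split; apply: eq_bigr => i _; rewrite coordDE mulrDr.
Qed.

Lemma dotZr a x y : dot x (a *: y) = a * dot x y.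
Proof.
by rewrite /dot mulr_sumr; apply: eq_bigr => i _; rewrite coordZE mulrCA.
Qed.

Lemma dotNr x y : dot x (- y) = - dot x y.
Proof. by rewrite -scaleN1r dotZr mulN1r. Qed.

Lemma dotBr x y z : dot x (y - z) = dot x y - dot x z.
Proof. by rewrite dotDr dotNr. Qed.

Lemma dotDl x y z : dot (x + y) z = dot x z + dot y z.
Proof. by rewrite !(dotC _ z) dotDr. Qed.

Lemma dotBl x y z : dot (x - y) z = dot x z - dot y z.
Proof. by rewrite !(dotC _ z) dotBr. Qed.

Lemma dotZl a x y : dot (a *: x) y = a * dot x y.
Proof. by rewrite !(dotC _ y) dotZr. Qed.

Lemma dot0 x : (forall y, dot x y = 0) -> x = 0.
Proof.
move=> h; rewrite -[x]coordsK (_ : coords x = 0) ?linear0 //.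
apply/rowP => i; rewrite [RHS]mxE -(h (of_coords (delta_mx 0 i))) /dot of_coordsK.
rewrite (bigD1 i) //= [X in _ * X + _]mxE !eqxx mulr1 big1 ?addr0 // => j ji.
by rewrite [X in _ * X]mxE (negbTE ji) andbF mulr0.
Qed.

Lemma abv_dot x y : abv (dot x y) <= nrm x * nrm y.
Proof.
have abv_sum (s : seq 'I_(\dim {:V})) (F : 'I_(\dim {:V}) -> K) :
    abv (\sum_(i <- s) F i) <= \sum_(i <- s) abv (F i).
  elim/big_rec2: _ => [|i a b _ h]; first by rewrite (abv0 LF).
  by apply: le_trans (abvD LF _ _) _; rewrite lerD2l.
apply: le_trans (abv_sum _ _) _; rewrite /nrm mulr_suml.
apply: ler_sum => i _; rewrite (abvM LF) ler_wpM2l ?(abv_ge0 LF) //.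
exact: coord_le_nrm.
Qed.

(** The adjoint is what makes a relation between measures on [V], involving a
    linear map, into a relation between Fourier transforms. *)
Lemma adjointP (f : V -> V) : linear f ->
  exists2 g : V -> V, linear g & forall x y, dot (g x) y = dot x (f y).
Proof.
move=> lf; pose g x := of_coords (\row_i dot x (f (of_coords (delta_mx 0 i)))).
exists g => [a x y|x y].
  rewrite /g -of_coords_linear; congr of_coords; apply/rowP => i.
  by rewrite !mxE dotDl dotZl.
rewrite {1}/dot /g of_coordsK.
have dot_linear : linear (dot x : V -> K^o).
  by move=> a u v; rewrite dotDr dotZr.
rewrite {2}[y]coords_sum linear_combination // [RHS](linear_combination _ _ _ dot_linear).
by apply: eq_bigr => i _; rewrite mxE /GRing.scale /= mulrC.
Qed.

(** Every direction can be rescaled into a fixed shell; over a discretely valued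
    field the norm of a multiple cannot be prescribed exactly. *)
Lemma nrm_scale : exists2 rho : R, 1 <= rho & forall r x, 0 < r -> x != 0 ->
  exists a, a != 0 /\ r <= nrm (a *: x) <= rho * r.
Proof.
have [rho rho1 rhoP] := abv_approx LF; exists rho => // r x r0 x0.
have nx := nrm_gt0 x0.
have [a [ra ar]] := rhoP (r / nrm x) (divr_gt0 r0 nx).
have a0 : a != 0.
  apply: contraTneq ra => ->; rewrite (abv0 LF) -ltNge divr_gt0 //.
exists a; split => //; rewrite nrmZ -ler_pdivrMr // ra /=.
by rewrite -ler_pdivlMr // -mulrA.
Qed.

(** ** Topology *)

Lemma fin_min (I : finType) (P : I -> R -> Prop) :
  (forall i, exists2 e, 0 < e & forall e', e' <= e -> P i e') ->
  exists2 e, 0 < e & forall i, P i e.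
Proof.
move=> h; have /choice[e eP] i : exists e, 0 < e /\ forall e', e' <= e -> P i e'.
  by have [e] := h i; exists e.
exists (\big[Num.min/1]_i e i) => [|i].
  by elim/big_rec: _ => // i a _ a0; rewrite lt_min (eP i).1.
by apply: (eP i).2; exact: bigmin_le_cond.
Qed.

Lemma open_nrmP (U : set V) : @open (vtop V) U <->
  forall x, U x -> exists2 e, 0 < e & forall y, nrm (y - x) < e -> U y.
Proof.
split=> [[W oW <-] x Wx|h].
  have /= : nbhs (coords x) W by apply: open_nbhs_nbhs.
  move=> [P nP PW].
  have [i|e e0 eP] := @fin_min _ (fun j e => forall y, abv (y - coords x 0 j) < e -> P 0 j y).
    have /(abv_nbhs LF)[e e0 eP] := nP 0 i; exists e => // e' ee' y ye'.
    by apply: eP; exact: lt_le_trans ye' ee'.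
  exists e => // y yxe; apply: PW => i j; rewrite ord1; apply: eP.
  apply: le_lt_trans yxe; rewrite (_ : _ - _ = coords (y - x) 0 j).
    exact: coord_le_nrm.
  by rewrite coordBE.
exists (of_coords @^-1` U); last first.
  by apply/seteqP; split=> x /=; rewrite -[passmx.rVof _ x]/(coords x) coordsK.
rewrite openE => M /= UM; have [e e0 eP] := h _ UM.
pose d := e / (\dim {:V}).+1%:R; have d0 : 0 < d by rewrite divr_gt0.
exists (fun i j y => abv (y - M i j) < d).
  by move=> i j; apply/(abv_nbhs LF); exists d.
move=> N MN; apply: eP; rewrite /nrm.
apply: (@le_lt_trans _ _ (\sum_(i < \dim {:V}) d)).
  apply: ler_sum => i _; rewrite coordBE !of_coordsK.
  by apply/ltW; exact: MN.
rewrite sumr_const card_ord -mulr_natr /d -mulrA gtr_pMr // mulrC.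
by rewrite ltr_pdivrMr // mul1r ltr_nat.
Qed.

Lemma nbhs_nrmP (x : V) (A : set V) : nbhs (x : vtop V) A <->
  exists2 e, 0 < e & forall y, nrm (y - x) < e -> A y.
Proof.
rewrite nbhsE; split=> [[U [/open_nrmP oU Ux] UA]|[e e0 eA]].
  by have [e e0 eU] := oU x Ux; exists e => // y /eU/UA.
exists [set y | nrm (y - x) < e] => //; split; last first.
  by rewrite /= subrr nrm0.
apply/open_nrmP => y /= ye; exists (e - nrm (y - x)); first by rewrite subr_gt0.
move=> z; rewrite ltrBrDr => h; apply: le_lt_trans h.
exact: nrm_triangle.
Qed.

Lemma continuous_nrmP (f : V -> V) : continuous (f : vtop V -> vtop V) <->
  forall x e, 0 < e -> exists2 d, 0 < d &
    forall y, nrm (y - x) < d -> nrm (f y - f x) < e.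
Proof.
split=> [cf x e e0|h x A /nbhs_nrmP[e e0 eA]].
  have /cf/nbhs_nrmP[d d0 dP] : nbhs (f x : vtop V) [set y | nrm (y - f x) < e].
    by apply/nbhs_nrmP; exists e.
  by exists d.
apply/nbhs_nrmP; have [d d0 dP] := h x e e0; exists d => // y /dP.
exact: eA.
Qed.

(** The image of a product of balls of [K], to which Tychonoff's theorem applies.
    That it is closed is stated by means of the norm, so as to yield
    measurability. *)
Lemma bounded_in_compact (r : R) :
  exists2 C : set (vtop V), compact C /\
    (forall x, ~ C x -> exists2 e, 0 < e & forall y, nrm (y - x) < e -> ~ C y) &
    forall x, nrm x <= r -> C x.
Proof.
pose T' : ptopologicalType := HB.pack K (isPointed.Build K 0).
have cC : compact [set v : 'rV[T']_(\dim {:V}) | forall i, abv (v ord0 i) <= r].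
  by apply: (@rV_compact T' _ (fun=> [set x | abv x <= r])) => i; exact: (abv_compact LF).
exists (of_coords @` [set v : 'rV[K]_(\dim {:V}) | forall i, abv (v 0 i) <= r]).
  split; last first.
    move=> x nCx; have /existsNP[i /negP] : ~ forall i, abv (coords x 0 i) <= r.
      by move=> h; apply: nCx; exists (coords x); [exact: h|exact: coordsK].
    rewrite -ltNge => rx; exists (abv (coords x 0 i) - r); first by rewrite subr_gt0.
    move=> y yx [z /(_ i) zr zy]; have := abvB LF (coords y 0 i) (coords (y - x) 0 i).
    rewrite coordBE opprB addrC subrK -coordBE.
    have := coord_le_nrm (y - x) i; rewrite -{3}zy of_coordsK; lra.
  apply: (@continuous_compact _ (vtop V) of_coords) => //.
  apply: continuous_subspaceT; apply/continuousP => A [B oB <-].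
  rewrite (_ : _ @^-1` _ = B) //; apply/seteqP; split=> x /=;
    by rewrite -[passmx.rVof _ _]/(coords _) of_coordsK.
move=> x xr; exists (coords x); last exact: coordsK.
by move=> i; apply: le_trans (coord_le_nrm _ _) xr.
Qed.

(** Compactness of balls in the form of a uniformity principle: a property that
    holds locally for all large parameters holds for one parameter on the
    whole ball. *)
Lemma ball_unif (P : nat -> V -> Prop) (r : R) :
  (forall x, exists k, exists2 e, 0 < e &
     forall y j, (k <= j)%N -> nrm (y - x) < e -> P j y) ->
  exists k, forall x, nrm x <= r -> P k x.
Proof.
move=> h; have [C [cC _] rC] := bounded_in_compact r.
have [k _ kP] : \forall k \near \oo, C `<=` P k.
  apply: (proj1 (compact_near_coveringP C) cC nat (nbhs \oo)) => x _.
  have [k [e e0 eP]] := h x.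
  exists ([set y | nrm (y - x) < e], [set j | (k <= j)%N]).
    by split; [apply/nbhs_nrmP; exists e|exists k].
  by move=> [y j] [/= ye kj]; exact: eP.
by exists k => x xr; apply: (kP k) => //=; exact: rC.
Qed.

(** Rational coordinates: [V] is second countable. *)
Lemma dense_seq : exists q : nat -> V, forall x e, 0 < e ->
  exists k, nrm (x - q k) < e.
Proof.
pose F (f : {ffun 'I_(\dim {:V}) -> int * nat}) : V :=
  of_coords (\row_i ((f i).1%:~R / (f i).2%:R)).
exists (fun k => if unpickle k is Some f then F f else 0) => x e e0.
pose d := e / (\dim {:V}).+1%:R; have d0 : 0 < d by rewrite divr_gt0.
have /choice[g gP] (i : 'I_(\dim {:V})) : exists ab : int * nat,
    abv (coords x 0 i - ab.1%:~R / ab.2%:R) < d.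
  by have [a [b [_ ab]]] := abv_rat LF (coords x 0 i) d0; exists (a, b).
exists (pickle (finfun g)); rewrite pickleK /nrm.
apply: (@le_lt_trans _ _ (\sum_(i < \dim {:V}) d)).
  apply: ler_sum => i _; rewrite coordBE /F of_coordsK [X in _ - X]mxE ffunE.
  exact/ltW/gP.
rewrite sumr_const card_ord -mulr_natr /d -mulrA gtr_pMr // mulrC.
by rewrite ltr_pdivrMr // mul1r ltr_nat.
Qed.

(** Additive maps are rational-linear, and rationals are dense in [K]. *)
Lemma additive_continuous_linear (f : V -> V) :
  zmod_morphism f -> continuous (f : vtop V -> vtop V) -> linear f.
Proof.
move=> af cf; pose f' : {additive V -> V} := HB.pack f
  (GRing.isZmodMorphism.Build V V f af).
have fE x : f x = f' x by [].
have fint (m : int) x : f (m%:~R *: x) = m%:~R *: f x.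
  by rewrite !scaler_int fE raddfMz.
have frat (a : int) (b : nat) x : b%:R != 0 :> K ->
    f ((a%:~R / b%:R) *: x) = (a%:~R / b%:R) *: f x.
  move=> b0; apply: (scalerI b0); rewrite scalerA [_ * (_ / _)]mulrC divfK //.
  by rewrite -[b%:R]/(b%:Z%:~R) -!fint scalerA [_ * (_ / _)]mulrC divfK.
have fZ a x : f (a *: x) = a *: f x.
  apply/eqP; rewrite -subr_eq0; apply/eqP/nrm_eq0/eqP; rewrite eq_le nrm_ge0 andbT.
  apply/ler_addgt0Pr => e e0; rewrite add0r.
  have e20 : 0 < e / 2 by rewrite divr_gt0.
  have /continuous_nrmP/(_ 0 _ e20)[d d0 dP] := cf.
  pose m := Num.min (d / (1 + nrm x)) (e / 2 / (1 + nrm (f x))).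
  have n1 y : 0 < 1 + nrm y by rewrite ltr_pwDl // nrm_ge0.
  have m0 : 0 < m by rewrite lt_min !divr_gt0.
  have [p [q [q0 apq]]] := abv_rat LF a m0.
  have lt_scale y c : abv (a - p%:~R / q%:R) < c / (1 + nrm y) ->
      nrm ((a - p%:~R / q%:R) *: y) < c.
    rewrite ltr_pdivlMr // nrmZ; apply: le_lt_trans.
    by rewrite ler_wpM2l ?(abv_ge0 LF) // lerDr.
  have h1 : nrm ((a - p%:~R / q%:R) *: x) < d.
    by apply: lt_scale; apply: lt_le_trans apq _; rewrite ge_min lexx.
  have h2 : nrm ((a - p%:~R / q%:R) *: f x) < e / 2.
    by apply: lt_scale; apply: lt_le_trans apq _; rewrite ge_min lexx orbT.
  have := dP ((a - p%:~R / q%:R) *: x); rewrite subr0 => /(_ h1).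
  rewrite [f 0]fE raddf0 subr0 => h3.
  rewrite (_ : _ - _ = f ((a - p%:~R / q%:R) *: x) - (a - p%:~R / q%:R) *: f x).
    by apply: le_trans (nrmB _ _) _; lra.
  rewrite !scalerBl [X in _ = X - _]fE raddfB -!fE frat //.
  by rewrite opprB addrA subrK.
by move=> a x y; rewrite fE raddfD -!fE fZ.
Qed.

End NormedSpace.

(** * The Borel sigma-algebra of a normed space *)

Lemma tonelli_set d1 d2 (T1 : measurableType d1) (T2 : measurableType d2)
    (R : realType) (m1 : {sigma_finite_measure set T1 -> \bar R})
    (m2 : {sigma_finite_measure set T2 -> \bar R}) (W : set (T1 * T2)) :
  measurable W ->
  (\int[m1]_x m2 [set y | W (x, y)] = \int[m2]_y m1 [set x | W (x, y)])%E.
Proof.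
move=> mW; have := @indic_fubini_tonelli _ _ _ _ _ m1 m2 W mW.
rewrite indic_fubini_tonelli_FE // indic_fubini_tonelli_GE // => E.
transitivity (\int[m1]_x (m2 \o xsection W) x)%E.
  by apply: eq_integral => x _; rewrite /= xsectionE.
by rewrite E; apply: eq_integral => y _; rewrite /= ysectionE.
Qed.

Section BorelSpace.
Variables (R : realType) (K : topFieldType) (abv ch sh : K -> R).
Hypothesis LF : local_field abv ch sh.
Variable V : vectType K.
Local Notation nrm := (@nrm R K abv V).
Local Notation nrm_triangle := (nrm_triangle LF).

Definition nrm_open (U : set V) :=
  forall x, U x -> exists2 e : R, 0 < e & forall y, nrm (y - x) < e -> U y.

Lemma nrm_open_measurable (U : set V) : nrm_open U ->
  measurable (U : set (borel V)).
Proof. by move=> /(open_nrmP LF) oU; apply: sub_gen_smallest. Qed.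

Lemma ball_nrm_open x (e : R) : nrm_open [set y | nrm (y - x) < e].
Proof.
move=> y /= ye; exists (e - nrm (y - x)); first by rewrite subr_gt0.
move=> z; rewrite ltrBrDr => h; apply: le_lt_trans h; exact: nrm_triangle.
Qed.

Lemma measurable_ball x (e : R) :
  measurable ([set y | nrm (y - x) < e] : set (borel V)).
Proof. by apply: nrm_open_measurable; exact: ball_nrm_open. Qed.

Lemma measurable_ball0 (e : R) : measurable ([set y | nrm y < e] : set (borel V)).
Proof.
rewrite (_ : [set y | _] = [set y | nrm (y - 0) < e]); first exact: measurable_ball.
by apply/seteqP; split=> y /=; rewrite subr0.
Qed.

(** The product of two second countable spaces: an open set of pairs is a
    countable union of rectangles of balls. *)
Lemma nrm_open2_measurable (W : V -> V -> Prop) :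
  (forall x y, W x y -> exists2 e : R, 0 < e & forall x' y',
     nrm (x' - x) < e -> nrm (y' - y) < e -> W x' y') ->
  measurable ([set z | W z.1 z.2] : set (borel V * borel V)).
Proof.
move=> oW; have [q qP] := dense_seq LF V.
pose rd (j : nat) : R := j.+1%:R^-1.
have rd0 j : 0 < rd j by rewrite invr_gt0.
pose B (k j : nat) : set (borel V) := [set y | nrm (y - q k) < rd j].
pose G (n : nat) : set (borel V * borel V) :=
  if unpickle n is Some (k, l, j) then
    if `[< forall x y, B k j x -> B l j y -> W x y >] then B k j `*` B l j else set0
  else set0.
rewrite (_ : [set z | W z.1 z.2] = \bigcup_n G n).
  apply: bigcupT_measurable => n; rewrite /G; case: unpickle => [[[k l] j]|] //.
  by case: asboolP => // _; apply: measurableX; exact: measurable_ball.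
apply/seteqP; split=> [[x y] /= /oW[e e0 eW]|[x y] [n _]]; last first.
  rewrite /G; case: unpickle => [[[k l] j]|] //.
  by case: asboolP => // h [/= Bx By]; exact: h.
have e20 : 0 < e / 2 by rewrite divr_gt0.
have [j je] : exists j, rd j < e / 2.
  exists (Num.truncn (e / 2)^-1); rewrite invf_plt ?posrE //.
  exact: Num.Theory.truncnS_gt.
have [k xk] := qP x _ (rd0 j); have [l yl] := qP y _ (rd0 j).
exists (pickle (k, l, j)) => //; rewrite /G pickleK; case: asboolP => [_ //|[]].
move=> x' y'; rewrite /B /= => xk' yl'; apply: eW.
  by have := nrm_triangle (q k) x' x; rewrite (nrmC LF (q k) x); lra.
by have := nrm_triangle (q l) y' y; rewrite (nrmC LF (q l) y); lra.
Qed.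

Lemma measurable_fun_nrm (f : V -> V) :
  (forall x e, 0 < e -> exists2 d : R, 0 < d &
    forall y, nrm (y - x) < d -> nrm (f y - f x) < e) ->
  measurable_fun setT (f : borel V -> borel V).
Proof.
move=> cf; pose G : set (set (borel V)) := @open (vtop V).
apply: (measurability G) => //.
move=> _ [B /(open_nrmP LF) oB <-]; rewrite setTI.
apply: nrm_open_measurable => x /oB[e e0 eB]; have [d d0 dP] := cf x e e0.
by exists d => // y /dP; exact: eB.
Qed.

Lemma measurable_fun_nrm2 (f : V -> V -> V) :
  (forall x y e, 0 < e -> exists2 d : R, 0 < d &
    forall x' y', nrm (x' - x) < d -> nrm (y' - y) < d ->
      nrm (f x' y' - f x y) < e) ->
  measurable_fun setT (fun z : borel V * borel V => f z.1 z.2 : borel V).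
Proof.
move=> cf; pose G : set (set (borel V)) := @open (vtop V).
apply: (measurability G) => //.
move=> _ [B /(open_nrmP LF) oB <-]; rewrite setTI.
apply: (nrm_open2_measurable (W := fun x y => B (f x y))) => x y /oB[e e0 eB].
have [d d0 dP] := cf x y e e0.
by exists d => // x' y' xx yy; apply: eB; exact: dP.
Qed.

Lemma measurable_fun_nrmR (f : V -> R) :
  (forall x e, 0 < e -> exists2 d : R, 0 < d &
    forall y, nrm (y - x) < d -> `|f y - f x| < e) ->
  measurable_fun setT (f : borel V -> R).
Proof.
move=> cf; apply: (measurability _ (measurable_realfun.RGenOInfty.measurableE R)) => //.
move=> _ [_ [a ->] <-]; rewrite setTI.
apply: nrm_open_measurable => x /=; rewrite in_itv /= andbT => ax.
have [|d d0 dP] := cf x (f x - a); first by rewrite subr_gt0.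
exists d => // y /dP; rewrite in_itv /= andbT ltr_norml => /andP[h _]; lra.
Qed.

Lemma measurable_fun_nrm2R (f : V -> V -> R) :
  (forall x y e, 0 < e -> exists2 d : R, 0 < d &
    forall x' y', nrm (x' - x) < d -> nrm (y' - y) < d ->
      `|f x' y' - f x y| < e) ->
  measurable_fun setT (fun z : borel V * borel V => f z.1 z.2).
Proof.
move=> cf; apply: (measurability _ (measurable_realfun.RGenOInfty.measurableE R)) => //.
move=> _ [_ [a ->] <-]; rewrite setTI.
apply: (nrm_open2_measurable (W := fun x y => f x y \in `]a, +oo[)).
move=> x y /=; rewrite in_itv /= andbT => ax.
have [|d d0 dP] := cf x y (f x y - a); first by rewrite subr_gt0.
exists d => // x' y' xx yy; have := dP x' y' xx yy.
by rewrite in_itv /= andbT ltr_norml => /andP[h _]; lra.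
Qed.

Lemma linear_continuous (f : V -> V) : linear f -> forall x e, 0 < e ->
  exists2 d : R, 0 < d & forall y, nrm (y - x) < d -> nrm (f y - f x) < e.
Proof.
move=> lf x e e0; have [L L0 LP] := linear_bounded LF lf.
exists (e / L); first by rewrite divr_gt0.
move=> y; rewrite ltr_pdivlMr // mulrC; apply: le_lt_trans.
rewrite (_ : f y - f x = f (y - x)) //.
by rewrite addrC -scaleN1r -lf scaleN1r addrC.
Qed.

Lemma measurable_linear (f : V -> V) : linear f ->
  measurable_fun setT (f : borel V -> borel V).
Proof. by move=> lf; apply: measurable_fun_nrm; exact: linear_continuous. Qed.

Lemma measurable_add :
  measurable_fun setT (fun z : borel V * borel V => (z.1 : V) + (z.2 : V) : borel V).
Proof.
apply: (measurable_fun_nrm2 (f := fun x y => x + y)) => x y e e0.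
exists (e / 2); first by rewrite divr_gt0.
move=> x' y' xx yy; rewrite opprD addrACA.
by apply: le_lt_trans (nrmD LF _ _) _; lra.
Qed.

Lemma measurable_sub :
  measurable_fun setT (fun z : borel V * borel V => (z.1 : V) - (z.2 : V) : borel V).
Proof.
apply: (measurable_fun_nrm2 (f := fun x y => x - y)) => x y e e0.
exists (e / 2); first by rewrite divr_gt0.
move=> x' y' xx yy; rewrite opprD addrACA -opprD.
by apply: le_lt_trans (nrmB LF _ _) _; lra.
Qed.

Lemma measurable_translate (a : V) :
  measurable_fun setT (fun x : borel V => (x : V) + a : borel V).
Proof.
apply: (measurable_fun_nrm (f := fun x => x + a)) => x e e0.
by exists e => // y ye; rewrite opprD addrACA subrr addr0.
Qed.

Lemma measurable_reflect (a : V) :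
  measurable_fun setT (fun x : borel V => a - (x : V) : borel V).
Proof.
apply: (measurable_fun_nrm (f := fun x => a - x)) => x e e0.
by exists e => // y ye; rewrite opprB addrC addrA subrK (nrmC LF).
Qed.

Lemma measurable_preim (f : borel V -> borel V) (A : set (borel V)) :
  measurable_fun setT f -> measurable A -> measurable [set x | A (f x)].
Proof. by move=> mf mA; rewrite -[X in measurable X]setTI; exact: mf. Qed.

Lemma measurable_preim2 (f : borel V * borel V -> borel V) (A : set (borel V)) :
  measurable_fun setT f -> measurable A -> measurable [set z | A (f z)].
Proof. by move=> mf mA; rewrite -[X in measurable X]setTI; exact: mf. Qed.

End BorelSpace.

(** * Haar measures and their modulus *)

Definition push_measure d d' (T1 : measurableType d) (T2 : measurableType d')
    (R : realType) (m : {measure set T1 -> \bar R}) (f : T1 -> T2)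
    (mf : measurable_fun setT f) : {measure set T2 -> \bar R} :=
  measure_function_pushforward__canonical__measure_function_Measure m mf.

(** Tonelli's theorem asks for a bundled sigma-finite measure, while for a Haar
    measure sigma-finiteness is a consequence of the axioms. *)
Definition sigma_finite_pack d (T : measurableType d) (R : realType)
    (m : {measure set T -> \bar R}) (sf : sigma_finite setT m) :
    {sigma_finite_measure set T -> \bar R} :=
  let H1 := isSFinite.Build _ _ _ _ (sfinite_measure_sigma_finite sf) in
  let H2 := isSigmaFinite.Build _ _ _ _ sf in
  HB.pack_for (SigmaFiniteMeasure.type T R) (Measure.sort m) H1 H2.

Section Haar.
Variables (R : realType) (K : topFieldType) (abv ch sh : K -> R).
Hypothesis LF : local_field abv ch sh.
Variable V : vectType K.
Local Notation nrm := (@nrm R K abv V).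
Local Notation nball r := ([set y : borel V | (nrm y < r)%R]).

Definition invariant (m : set (borel V) -> \bar R) := forall (a : V) (B : set (borel V)),
  measurable B -> m [set x : borel V | B ((x : V) + a)] = m B.

Lemma haar_ball_fin (lam : {measure set (borel V) -> \bar R}) (r : R) :
  haar_measure lam -> (lam (nball r) < +oo)%E.
Proof.
move=> [_ fin _]; have [C [cC oC] rC] := bounded_in_compact LF V r.
apply: le_lt_trans (fin C cC); apply: le_measure; rewrite ?inE.
- exact: (measurable_ball0 LF).
- rewrite -[C]setCK; apply: measurableC; exact: (nrm_open_measurable LF).
- by move=> x /= /ltW/rC.
Qed.

Lemma haar_sigma_finite (lam : {measure set (borel V) -> \bar R}) :
  haar_measure lam -> sigma_finite setT lam.
Proof.
move=> hl; exists (fun n => (nball n%:R)) => [|n]; last first.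
  by split; [exact: (measurable_ball0 LF)|exact: haar_ball_fin].
apply/seteqP; split=> // x _.
by exists (Num.truncn (nrm x)).+1 => //=; exact: Num.Theory.truncnS_gt.
Qed.

(** Countably many translates of a ball cover the space, so that a null ball
    would make the measure zero. *)
Lemma haar_ball_gt0 (lam : {measure set (borel V) -> \bar R}) (r : R) :
  haar_measure lam -> 0 < r -> (0 < lam (nball r))%E.
Proof.
move=> [l0 _ inv] r0; rewrite lt0e measure_ge0 andbT; apply: contra l0 => /eqP h.
have [q qP] := dense_seq LF V.
have -> : [set: borel V] = \bigcup_k [set y : borel V | nrm ((y : V) - q k) < r].
  by apply/seteqP; split=> // x _; have [k xk] := qP x r r0; exists k.
have mB k : measurable [set y : borel V | nrm ((y : V) - q k) < r].
  exact: (measurable_ball LF).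
rewrite -measure_le0; apply: le_trans (measure_sigma_subadditive _ _ _ _) _.
- exact: mB.
- by apply: bigcupT_measurable => k; exact: mB.
- exact: subset_refl.
rewrite eseries0 // => k _ _.
have := inv (- q k) _ (measurable_ball0 LF (V:=V) r).
by rewrite h.
Qed.

Lemma integral_restrict_cst (m : {measure set (borel V) -> \bar R})
    (A : set (borel V)) (c : \bar R) : measurable A ->
  (\int[m]_x (if x \in A then c else 0) = c * m A)%E.
Proof. by move=> mA; rewrite -(integral_cst m mA c) integral_mkcond. Qed.

(** The core of the uniqueness of Haar measure: substituting in two ways in the
    double integral of the indicator of [A x /\ B (x + y)].  With [A] a ball it
    shows that two invariant measures are proportional. *)
Lemma invariant_exchange (m1 m2 : {sigma_finite_measure set (borel V) -> \bar R})
    (A B : set (borel V)) :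
  invariant m1 -> invariant m2 -> measurable A -> measurable B ->
  (m1 A * m2 B = m2 [set x | A (- (x : V))%R] * m1 B)%E.
Proof.
move=> i1 i2 mA mB.
have mNA : measurable [set x : borel V | A (- (x : V))].
  rewrite (_ : [set x | _] = [set x : borel V | A (0 - (x : V))]).
    by apply: measurable_preim => //; exact: (measurable_reflect LF).
  by apply/seteqP; split=> x /=; rewrite sub0r.
pose W := [set z : borel V * borel V | A z.1 /\ B ((z.1 : V) + (z.2 : V))].
have mW : measurable W.
  apply: measurableI; last exact: (measurable_preim2 (measurable_add LF (V:=V)) mB).
  by rewrite -[X in measurable X]setTI; apply: measurable_fst.
pose W' := [set z : borel V * borel V | A ((z.1 : V) - (z.2 : V)) /\ B z.1].
have mW' : measurable W'.
  apply: measurableI; first exact: (measurable_preim2 (measurable_sub LF (V:=V)) mA).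
  by rewrite -[X in measurable X]setTI; apply: measurable_fst.
have E1 := tonelli_set m1 m2 mW; have E2 := tonelli_set m1 m2 mW'.
transitivity (\int[m1]_x m2 [set y | W (x, y)])%E.
  rewrite muleC -integral_restrict_cst //; apply: eq_integral => x _.
  case: ifPn => [/set_mem Ax|/negP nAx].
    rewrite -(i2 x B mB); congr (m2 _); apply/seteqP; split=> y /=.
      by rewrite addrC.
    by rewrite addrC => -[].
  rewrite (_ : [set y | _] = set0) ?measure0 //.
  by apply/seteqP; split=> y //= -[Ax _]; apply: nAx; rewrite inE.
rewrite E1; transitivity (\int[m2]_y m1 [set x | W' (x, y)])%E.
  apply: eq_integral => y _.
  have mWy : measurable [set x | W' (x, y)].
    have -> : [set x | W' (x, y)] = ysection W' y by rewrite ysectionE.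
    exact: measurable_ysection.
  rewrite -(i1 y _ mWy); congr (m1 _); apply/seteqP; split=> x /=.
    by move=> [Ax Bx]; rewrite /W' /= addrK.
  by rewrite /W' /= addrK => -[].
rewrite -E2 -integral_restrict_cst //; apply: eq_integral => x _.
case: ifPn => [/set_mem Bx|/negP nBx]; last first.
  rewrite (_ : [set y | _] = set0) ?measure0 //.
  by apply/seteqP; split=> y //= -[_ Bx]; apply: nBx; rewrite inE.
rewrite -(i2 (- x) _ mNA); congr (m2 _); apply/seteqP; split=> y /=.
  by move=> [h _]; rewrite opprB.
by rewrite opprB.
Qed.

Lemma ball_sym (r : R) :
  [set x : borel V | (nball r) (- (x : V))] = (nball r).
Proof. by apply/seteqP; split=> x /=; rewrite (nrmN LF). Qed.

Lemma pushforward_sigma_finite (lam : {measure set (borel V) -> \bar R})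
    (f : V -> V) : linear f -> (exists2 L : R, 0 < L & forall x, nrm x <= L * nrm (f x)) ->
  haar_measure lam -> sigma_finite setT (pushforward lam (f : borel V -> borel V)).
Proof.
move=> lf [L L0 LP] hl; exists (fun n => (nball n%:R)) => [|n]; last first.
  split; first exact: (measurable_ball0 LF).
  apply: le_lt_trans (haar_ball_fin (L * n%:R) hl).
  rewrite /pushforward; apply: le_measure; rewrite ?inE.
  - apply: (measurable_preim (f := f) (A := (nball n%:R))).
      exact: (measurable_linear LF).
    exact: (measurable_ball0 LF).
  - exact: (measurable_ball0 LF).
  - by move=> x /= h; apply: le_lt_trans (LP x) _; rewrite ltr_pM2l.
apply/seteqP; split=> // x _.
by exists (Num.truncn (nrm x)).+1 => //=; exact: Num.Theory.truncnS_gt.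
Qed.

(** The image of [lam] by an automorphism is again invariant, hence proportional
    to [lam]: compare both by means of the unit ball, which is symmetric. *)
Lemma haar_modulus (lam : {measure set (borel V) -> \bar R}) (f g : V -> V) :
  haar_measure lam -> linear f -> linear g -> cancel f g -> cancel g f ->
  exists2 delta : R, 0 < delta & forall B : set (borel V), measurable B ->
    lam [set x : borel V | B (f x)] = (delta%:E * lam B)%E.
Proof.
move=> hl lf lg fg gf.
have [L L0 LP] := linear_bounded LF lg.
have [L' L'0 LP'] := linear_bounded LF lf.
have mf := measurable_linear LF lf.
pose pf := push_measure lam mf.
have sf2 : sigma_finite setT pf.
  by apply: pushforward_sigma_finite => //; exists L => // x; rewrite -{1}(fg x).
pose m1 := sigma_finite_pack (haar_sigma_finite hl).
pose m2 := sigma_finite_pack sf2.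
have i1 : invariant m1 by case: (hl).
have i2 : invariant m2.
  move=> a B mB; have [_ _ inv] := hl.
  have mfB : measurable [set x : borel V | B (f x)] by exact: measurable_preim.
  rewrite -[RHS]/(lam _) -(inv (g a) _ mfB) -[LHS]/(lam _); congr (lam _).
  have fD x : f (x + g a) = f x + a.
    by rewrite addrC -[g a]scale1r lf scale1r gf addrC.
  by apply/seteqP; split=> x /=; rewrite fD.
have B0 := measurable_ball0 LF (V:=V) 1.
have E (B : set (borel V)) (mB : measurable B) := invariant_exchange i1 i2 B0 mB.
have l0 := haar_ball_gt0 hl (@ltr01 R); have lfin := haar_ball_fin 1 hl.
have pfin : (lam [set x : borel V | (nball 1%R) (f x)] < +oo)%E.
  apply: le_lt_trans (haar_ball_fin L hl); apply: le_measure; rewrite ?inE.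
  - exact: measurable_preim.
  - exact: (measurable_ball0 LF).
  - by move=> x /= h; rewrite -(fg x); apply: le_lt_trans (LP _) _; rewrite gtr_pMr.
have pos : (0 < lam [set x : borel V | (nball 1%R) (f x)])%E.
  apply: lt_le_trans (haar_ball_gt0 hl (_ : 0 < L'^-1)) _; rewrite ?invr_gt0 //.
  apply: le_measure; rewrite ?inE.
  - exact: (measurable_ball0 LF).
  - exact: measurable_preim.
  - move=> x /= h; apply: le_lt_trans (LP' _) _.
    by rewrite mulrC -ltr_pdivlMr // div1r.
pose a := fine (lam (nball 1%R)).
pose b := fine (lam [set x : borel V | (nball 1%R) (f x)]).
have aE : lam (nball 1%R) = a%:E by rewrite fineK // ge0_fin_numE.
have bE : lam [set x : borel V | (nball 1%R) (f x)] = b%:E by rewrite fineK // ge0_fin_numE.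
have a0 : 0 < a by rewrite -lte_fin -aE.
have b0 : 0 < b by rewrite -lte_fin -bE.
exists (b / a) => [|B mB]; first exact: divr_gt0.
have := E B mB; rewrite ball_sym.
rewrite -[m2 B]/(lam [set x : borel V | B (f x)]) -[m2 _]/(lam [set x : borel V | (nball 1%R) (f x)]).
rewrite -[m1 B]/(lam B) -[m1 _]/(lam (nball 1%R)) aE bE => Eq.
rewrite EFinM muleC muleA [(lam B * _)%E]muleC -Eq muleC muleA -EFinM.
by rewrite mulVf ?gt_eqF // mul1e.
Qed.

End Haar.

(** * Bounded expectations and convolutions *)

Definition pack_mfun d d' (T1 : measurableType d) (T2 : measurableType d')
    (f : T1 -> T2) (mf : measurable_fun setT f) : {mfun T1 >-> T2} :=
  HB.pack f (isMeasurableFun.Build _ _ _ _ f mf).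

Definition push_prob d d' (T1 : measurableType d) (T2 : measurableType d')
    (R : realType) (P : probability T1 R) (f : T1 -> T2)
    (mf : measurable_fun setT f) : probability T2 R :=
  distribution P (pack_mfun mf).

Section BoundedExpectation.
Context d (T : measurableType d) (R : realType).

Definition bmeas (f : T -> R) :=
  measurable_fun setT f /\ exists M, forall x, `|f x| <= M.

Lemma bmeas_int (P : probability T R) (f : T -> R) : bmeas f ->
  P.-integrable setT (EFin \o f).
Proof.
move=> [mf [M fM]]; have fin : (P setT < +oo)%E by rewrite probability_setT ltry.
apply: (measurable_bounded_integrable measurableT fin mf).
by exists M; split; [exact: num_real|move=> y My x _; exact: le_trans (fM x) (ltW My)].
Qed.

Lemma bmeas_cst c : bmeas (fun=> c).
Proof. by split; [exact: measurable_cst|exists `|c|]. Qed.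

Lemma bmeasD f g : bmeas f -> bmeas g -> bmeas (fun x => f x + g x).
Proof.
move=> [mf [M fM]] [mg [N gN]]; split; first exact: measurable_funD.
by exists (M + N) => x; apply: le_trans (ler_normD _ _) _; exact: lerD.
Qed.

Lemma bmeasM f g : bmeas f -> bmeas g -> bmeas (fun x => f x * g x).
Proof.
move=> [mf [M fM]] [mg [N gN]]; split; first exact: measurable_funM.
by exists (M * N) => x; rewrite normrM; apply: ler_pM.
Qed.

Lemma bmeasZ c f : bmeas f -> bmeas (fun x => c * f x).
Proof. by move=> bf; apply: bmeasM => //; exact: bmeas_cst. Qed.

Lemma bmeasB f g : bmeas f -> bmeas g -> bmeas (fun x => f x - g x).
Proof.
move=> bf bg; have := bmeasD bf (bmeasZ (-1) bg).
by congr bmeas; apply/funext => x; rewrite mulN1r.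
Qed.

Lemma bmeas_sqr f : bmeas f -> bmeas (fun x => f x ^+ 2).
Proof. by move=> bf; have := bmeasM bf bf. Qed.

Lemma bmeas_norm f : bmeas f -> bmeas (fun x => `|f x|).
Proof.
move=> [mf [M fM]]; split; first exact: measurableT_comp.
by exists M => x; rewrite normr_id.
Qed.

Lemma bmeas_indic (A : set T) : measurable A -> bmeas (\1_A : T -> R).
Proof.
move=> mA; split; first exact: measurable_indic.
by exists 1 => x; rewrite indicE; case: (x \in A); rewrite ?normr1 ?normr0.
Qed.

Variable P : probability T R.

Definition mean (f : T -> R) : R := \int[P]_x f x.

Lemma meanD f g : bmeas f -> bmeas g ->
  mean (fun x => f x + g x) = mean f + mean g.
Proof. by move=> bf bg; apply: RintegralD => //; exact: bmeas_int. Qed.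

Lemma meanB f g : bmeas f -> bmeas g ->
  mean (fun x => f x - g x) = mean f - mean g.
Proof. by move=> bf bg; apply: RintegralB => //; exact: bmeas_int. Qed.

Lemma meanZ c f : bmeas f -> mean (fun x => c * f x) = c * mean f.
Proof. by move=> bf; apply: RintegralZl => //; exact: bmeas_int. Qed.

Lemma mean_lin2 a b f g : bmeas f -> bmeas g ->
  mean (fun x => a * f x + b * g x) = a * mean f + b * mean g.
Proof.
by move=> bf bg; rewrite (meanD (bmeasZ a bf) (bmeasZ b bg)) (meanZ a bf) (meanZ b bg).
Qed.

Lemma mean_cst c : mean (fun=> c) = c.
Proof.
transitivity (c * fine (P setT)); first exact: Rintegral_cst.
by rewrite probability_setT mulr1.
Qed.

Lemma mean_le f g : bmeas f -> bmeas g -> (forall x, f x <= g x) ->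
  mean f <= mean g.
Proof. by move=> bf bg fg; apply: le_Rintegral => //; exact: bmeas_int. Qed.

Lemma mean_ge0 f : (forall x, 0 <= f x) -> 0 <= mean f.
Proof. by move=> f0; apply: Rintegral_ge0. Qed.

Lemma mean_norm f : bmeas f -> `|mean f| <= mean (fun x => `|f x|).
Proof. by move=> bf; apply: le_normr_Rintegral => //; exact: bmeas_int. Qed.

Lemma mean_indic (A : set T) : measurable A -> mean \1_A = fine (P A).
Proof. by move=> mA; rewrite /mean /Rintegral integral_indic // setIT. Qed.

Lemma EFin_mean f : bmeas f -> (mean f)%:E = (\int[P]_x (f x)%:E)%E.
Proof.
move=> bf; rewrite /mean /Rintegral fineK //.
by apply: integrable_fin_num => //; exact: bmeas_int.
Qed.

Lemma mean0_ae f : bmeas f -> (forall x, 0 <= f x) -> mean f = 0 ->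
  P [set x | f x = 0] = 1%E.
Proof.
move=> bf f0 m0; have [mf _] := bf.
have mZ : measurable [set x | f x = 0].
  by rewrite -[X in measurable X]setTI; exact: (mf measurableT [set 0]).
have : ae_eq P setT (EFin \o f) (cst 0%E).
  apply/ae_eq_integral_abs => //; first exact/measurable_EFinP.
  under eq_integral do rewrite /= ger0_norm //.
  by rewrite -EFin_mean // m0.
move=> [N [mN N0 sN]].
apply/eqP; rewrite eq_le probability_le1 //= -(@probability_setT _ _ _ P).
rewrite -(setUv [set x | f x = 0]); apply: le_trans (measureU2 P mZ (measurableC mZ)) _.
rewrite -[leRHS]adde0 leeD // -N0.
apply: le_measure; rewrite ?inE //; first exact: measurableC.
by move=> x /= fx; apply: sN => /= h; apply: fx; have [] := h I.
Qed.

End BoundedExpectation.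

Section Convolution.
Variables (R : realType) (K : topFieldType) (abv ch sh : K -> R).
Hypothesis LF : local_field abv ch sh.
Variable V : vectType K.

Definition conv (P Q : probability (borel V) R) : probability (borel V) R :=
  push_prob (P \x Q)%E (measurable_add LF (V := V)).

Lemma convE P Q : conv P Q = convolution P Q :> (set (borel V) -> \bar R).
Proof. by []. Qed.

Definition conv_pow (P : probability (borel V) R) (n : nat) :=
  iter n (conv P) \d_((0 : V) : borel V).

Lemma conv_powE P n :
  conv_pow P n = convolution_power P n :> (set (borel V) -> \bar R).
Proof. by elim: n => // n IH; rewrite /conv_pow iterS convE IH. Qed.

Lemma conv_set P Q (B : set (borel V)) : measurable B ->
  (conv P Q B = \int[Q]_y P [set x | B ((x : V) + (y : V))%R])%E.
Proof.
move=> mB; have mW := measurable_preim2 (measurable_add LF (V := V)) mB.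
rewrite -(tonelli_set P Q mW) -[LHS]/(\int[P]_x _)%E.
by apply: eq_integral => x _; rewrite /= xsectionE.
Qed.

Lemma bmeas_translate (f : borel V -> R) (x : V) : bmeas f ->
  bmeas (fun y : borel V => f (x + (y : V))).
Proof.
move=> [mf [M fM]]; split; last by exists M.
apply: (measurableT_comp mf).
have := measurable_translate LF (V := V) x; congr measurable_fun.
by apply/funext => y; rewrite addrC.
Qed.

Lemma mean_conv_pow0 P (g : borel V -> R) : bmeas g ->
  mean (conv_pow P 0) g = g (0 : V).
Proof.
move=> bg; apply: EFin_inj; rewrite EFin_mean //.
rewrite [LHS](@integral_dirac _ _ (0 : borel V) R) ?diracE ?in_setT ?mul1e //.
by apply/measurable_EFinP; case: bg.
Qed.

Lemma mean_conv P Q (f : borel V -> R) : bmeas f ->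
  mean (conv P Q) f = mean P (fun x => mean Q (fun y => f ((x : V) + (y : V)))).
Proof.
move=> bf; have [mf [M fM]] := bf.
have bg : bmeas (fun z : borel V * borel V => f ((z.1 : V) + (z.2 : V))).
  split; last by exists M.
  exact: measurableT_comp mf (measurable_add LF (V := V)).
rewrite {1 2}/mean /Rintegral; congr fine.
rewrite (_ : (\int[conv P Q]_x (f x)%:E)%E =
   \int[(P \x Q)%E]_z (f ((z.1 : V) + (z.2 : V)))%:E)%E; last first.
  apply: (integral_pushforward (measurable_add LF (V := V))) => //.
    exact/measurable_EFinP.
  exact: bmeas_int bg.
have := @integral12_prod_meas1 _ _ _ _ _ P Q _ (bmeas_int (P \x Q)%E bg).
move=> <-; apply: eq_integral => x _.
by rewrite EFin_mean //; exact: bmeas_translate.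
Qed.

End Convolution.

(** * The Fourier transform of a probability *)

(** In complex notation, [|z z' - Z Z'|^2 <= 2 |z - Z|^2 + 2 |z' - Z'|^2] when
    [|z| = 1] and [|Z'| <= 1]: the left-hand side is the squared modulus
    of [z (z' - Z') + Z' (z - Z)]; conclude with the parallelogram identity. *)
Lemma telescope_sq (R : realType) (c s c' s' C S C' S' : R) :
  c ^+ 2 + s ^+ 2 = 1 -> C' ^+ 2 + S' ^+ 2 <= 1 ->
  (c * c' - s * s' - (C * C' - S * S')) ^+ 2 +
  (s * c' + c * s' - (S * C' + C * S')) ^+ 2 <=
  2 * ((c - C) ^+ 2 + (s - S) ^+ 2) + 2 * ((c' - C') ^+ 2 + (s' - S') ^+ 2).
Proof.
move=> h1 hu.
have -> : (c * c' - s * s' - (C * C' - S * S')) ^+ 2 + (s * c' + c * s' - (S * C' + C * S')) ^+ 2 =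
  2 * ((c ^+ 2 + s ^+ 2) * ((c' - C') ^+ 2 + (s' - S') ^+ 2)) +
  2 * ((C' ^+ 2 + S' ^+ 2) * ((c - C) ^+ 2 + (s - S) ^+ 2)) -
  ((c * (c' - C') - s * (s' - S') - (C' * (c - C) - S' * (s - S))) ^+ 2 +
   (s * (c' - C') + c * (s' - S') - (C' * (s - S) + S' * (c - C))) ^+ 2) by ring.
rewrite h1 mul1r.
have h2 : (C' ^+ 2 + S' ^+ 2) * ((c - C) ^+ 2 + (s - S) ^+ 2) <= (c - C) ^+ 2 + (s - S) ^+ 2.
  by rewrite ler_piMl // addr_ge0 ?sqr_ge0.
have drop (p q r : R) : 0 <= q -> p <= r -> p - q <= r by lra.
by apply: drop; [rewrite addr_ge0 ?sqr_ge0|lra].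
Qed.

Section Fourier.
Variables (R : realType) (K : topFieldType) (abv ch sh : K -> R).
Hypothesis LF : local_field abv ch sh.
Variable V : vectType K.
Local Notation nrm := (@nrm R K abv V).
Implicit Types P Q : probability (borel V) R.

Definition chv (xi : V) (x : borel V) : R := ch (dot xi (x : V)).
Definition shv (xi : V) (x : borel V) : R := sh (dot xi (x : V)).

Lemma chv2shv2 xi x : chv xi x ^+ 2 + shv xi x ^+ 2 = 1.
Proof. exact: (ch2sh2 LF). Qed.

Lemma chv_unif (e M : R) : 0 < e -> 0 < M -> exists2 d, 0 < d &
  forall xi zeta x, nrm (xi - zeta) < d -> nrm x < M ->
    `|chv xi x - chv zeta x| < e /\ `|shv xi x - shv zeta x| < e.
Proof.
move=> e0 M0; have [r r0 rP] := ch_unif LF e0.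
exists (r / M) => [|xi zeta x xz xM]; first exact: divr_gt0.
apply: rP; rewrite -dotBl; apply: le_lt_trans (abv_dot LF _ _) _.
move: xz; rewrite ltr_pdivlMr //; apply: le_lt_trans.
by rewrite ler_wpM2l ?(nrm_ge0 LF) // ltW.
Qed.

Lemma dot_sym_cont (f : K -> R) : (forall e : R, 0 < e -> exists2 r : R, 0 < r &
    forall x y, abv (x - y) < r -> `|f x - f y| < e) ->
  forall (x y : V) e, 0 < e -> exists2 d : R, 0 < d &
    forall x' y', nrm (x' - x) < d -> nrm (y' - y) < d ->
      `|f (dot x' y') - f (dot x y)| < e.
Proof.
move=> uf x y e e0; have [r r0 rP] := uf e e0.
pose m := 1 + nrm x + nrm y.
have m1 : 1 <= m by rewrite /m -addrA lerDl addr_ge0 ?(nrm_ge0 LF).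
have m0 : 0 < m by rewrite (lt_le_trans _ m1).
exists (Num.min 1 (r / (2 * m))); first by rewrite lt_min ltr01 divr_gt0 ?mulr_gt0.
move=> x' y'; rewrite !lt_min => /andP[x1 xx] /andP[y1 yy]; apply: rP.
rewrite (_ : _ - _ = dot x' (y' - y) + dot (x' - x) y); last first.
  by rewrite dotBr dotBl addrA subrK.
apply: le_lt_trans (abvD LF _ _) _.
have h1 := abv_dot LF x' (y' - y); have h2 := abv_dot LF (x' - x) y.
have nx' : nrm x' <= m.
  have := nrmD LF (x' - x) x; rewrite subrK /m; have := nrm_ge0 LF y; lra.
have ny : nrm y <= m by rewrite /m; have := nrm_ge0 LF x; lra.
have n1 := nrm_ge0 LF (y' - y); have n2 := nrm_ge0 LF (x' - x).
have h3 : nrm x' * nrm (y' - y) <= m * nrm (y' - y) by rewrite ler_wpM2r.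
have h4 : nrm (x' - x) * nrm y <= nrm (x' - x) * m by rewrite ler_wpM2l.
move: xx yy; rewrite !ltr_pdivlMr ?mulr_gt0 //; lra.
Qed.

Lemma chv_meas2 : measurable_fun setT (fun z : borel V * borel V => chv z.1 z.2).
Proof.
apply: (measurable_fun_nrm2R LF (f := fun x y => ch (dot x y))).
apply: dot_sym_cont => e /(ch_unif LF)[r r0 rP]; exists r => // x y /rP[//].
Qed.

Lemma shv_meas2 : measurable_fun setT (fun z : borel V * borel V => shv z.1 z.2).
Proof.
apply: (measurable_fun_nrm2R LF (f := fun x y => sh (dot x y))).
apply: dot_sym_cont => e /(ch_unif LF)[r r0 rP]; exists r => // x y /rP[//].
Qed.

Lemma chv_bmeas xi : bmeas (chv xi).
Proof.
split.
  have := measurableT_comp chv_meas2 (pair1_measurable (xi : borel V)).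
  by [].
exists 1 => x; rewrite ler_norml (ch_le1 LF) andbT; exact: (ch_geN1 LF).
Qed.

Lemma shv_bmeas xi : bmeas (shv xi).
Proof.
split.
  have := measurableT_comp shv_meas2 (pair1_measurable (xi : borel V)).
  by [].
exists 1 => x; rewrite ler_norml (sh_le1 LF) andbT; exact: (sh_geN1 LF).
Qed.

Local Ltac bm := lazymatch goal with
  | |- bmeas (chv _) => exact: chv_bmeas
  | |- bmeas (shv _) => exact: shv_bmeas
  | |- bmeas (fun x => chv _ x) => exact: chv_bmeas
  | |- bmeas (fun x => shv _ x) => exact: shv_bmeas
  | |- bmeas (fun _ => ?c) => exact: bmeas_cst
  | |- bmeas (fun x => @?f x + - @?g x) => apply: (@bmeasB _ _ _ f g); bm
  | |- bmeas (fun x => @?f x + @?g x) => apply: (@bmeasD _ _ _ f g); bm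
  | |- bmeas (fun x => @?f x ^+ 2) => apply: (@bmeas_sqr _ _ _ f); bm
  | |- bmeas (fun x => @?f x * @?g x) => apply: (@bmeasM _ _ _ f g); bm
  end.

(** Real and imaginary parts of the Fourier transform. *)
Definition fcos P (xi : V) : R := mean P (chv xi).
Definition fsin P (xi : V) : R := mean P (shv xi).

(** The squared modulus of the Fourier transform. *)
Definition fsqr P (xi : V) : R := fcos P xi ^+ 2 + fsin P xi ^+ 2.

Definition var_at P (xi : V) (a b : R) : R :=
  mean P (fun x => (chv xi x - a) ^+ 2 + (shv xi x - b) ^+ 2).

Lemma bmeas_var xi a b : bmeas (fun x => (chv xi x - a) ^+ 2 + (shv xi x - b) ^+ 2).
Proof.
by bm.
Qed.

(** The Fourier transform is the mean of the character, hence the constant that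
    is closest to it in mean square, at squared distance [1 - fsqr]. *)
Lemma var_atE P xi a b :
  var_at P xi a b = 1 - fsqr P xi + (fcos P xi - a) ^+ 2 + (fsin P xi - b) ^+ 2.
Proof.
have bc := chv_bmeas xi; have bs := shv_bmeas xi.
transitivity (mean P (fun x => (1 + a ^+ 2 + b ^+ 2) -
    ((2 * a) * chv xi x + (2 * b) * shv xi x))).
  congr mean; apply/funext => x; have := chv2shv2 xi x; lra.
rewrite meanB ?meanD ?meanZ ?mean_cst //; try by bm.
by rewrite -/(fcos P xi) -/(fsin P xi) /fsqr; ring.
Qed.

Lemma fsqr_var P xi : 1 - fsqr P xi = var_at P xi (fcos P xi) (fsin P xi).
Proof. by rewrite var_atE !subrr expr0n /= !addr0. Qed.

Lemma fsqr_var_le P xi a b : 1 - fsqr P xi <= var_at P xi a b.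
Proof.
rewrite var_atE -addrA lerDl addr_ge0 ?sqr_ge0 //.
Qed.

Lemma fsqr_ge0 P xi : 0 <= fsqr P xi.
Proof. by rewrite addr_ge0 ?sqr_ge0. Qed.

Lemma fsqr_le1 P xi : fsqr P xi <= 1.
Proof.
rewrite -subr_ge0 fsqr_var; apply: mean_ge0 => x.
by rewrite addr_ge0 ?sqr_ge0.
Qed.

Lemma fsqr0 P : fsqr P 0 = 1.
Proof.
have d0 x : dot 0 x = 0 :> K by rewrite -(scale0r 0) dotZl mul0r.
have c0 : fcos P 0 = 1.
  transitivity (mean P (fun=> 1)); last exact: mean_cst.
  by congr mean; apply/funext => x; rewrite /chv d0 (ch0 LF).
have s0 : fsin P 0 = 0.
  transitivity (mean P (fun=> 0)); last exact: mean_cst.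
  by congr mean; apply/funext => x; rewrite /shv d0 (sh0 LF).
by rewrite /fsqr c0 s0 expr1n expr0n addr0.
Qed.

Lemma fsqrN P xi : fsqr P (- xi) = fsqr P xi.
Proof.
have dN x : dot (- xi) x = - dot xi x by rewrite dotC dotNr dotC.
have cN : fcos P (- xi) = fcos P xi.
  by congr mean; apply/funext => x; rewrite /chv dN (chN LF _).1.
have sN : fsin P (- xi) = -1 * fsin P xi.
  rewrite -meanZ; last exact: shv_bmeas.
  by congr mean; apply/funext => x; rewrite /shv dN (chN LF _).2 mulN1r.
by rewrite /fsqr cN sN mulN1r sqrrN.
Qed.

(** Quasi-triangle inequality: write the product of two characters minus the
    product of their means as a telescoping sum and use that [1 - fsqr] is the
    least mean square distance to a constant. *)
Lemma fsqrD P xi zeta :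
  1 - fsqr P (xi + zeta) <= 2 * (1 - fsqr P xi) + 2 * (1 - fsqr P zeta).
Proof.
set C := fcos P xi; set S := fsin P xi; set C' := fcos P zeta; set S' := fsin P zeta.
apply: le_trans (fsqr_var_le P (xi + zeta) (C * C' - S * S') (S * C' + C * S')) _.
rewrite !fsqr_var -/C -/S -/C' -/S' /var_at.
have b1 := bmeas_var xi C S; have b2 := bmeas_var zeta C' S'.
have E := mean_lin2 P 2 2 b1 b2; apply: le_trans; last by rewrite le_eqVlt; apply/orP; left; apply/eqP; exact: E.
apply: mean_le; [exact: bmeas_var|by apply: bmeasD; exact: bmeasZ|].
move=> x; rewrite /chv /shv dotDl (chD LF) (shD LF).
apply: telescope_sq; [exact: chv2shv2|exact: (fsqr_le1 P zeta)].
Qed.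

Lemma tail P (e : R) : 0 < e -> exists2 M : R, 0 < M &
  fine (P [set x : borel V | M <= nrm x]) < e.
Proof.
move=> e0; pose F n : set (borel V) := [set x | nrm x < n.+1%:R].
have mF n : measurable (F n) by exact: (measurable_ball0 LF).
have UF : \bigcup_n F n = setT.
  apply/seteqP; split=> // x _.
  by exists (Num.truncn (nrm x)) => //; exact: Num.Theory.truncnS_gt.
have := @nondecreasing_cvg_mu _ _ _ P F mF.
rewrite UF => /(_ measurableT) h.
have {}h : P \o F @ \oo --> 1%E.
  rewrite -(@probability_setT _ _ _ P); apply: h => i j ij; apply/subsetPset => x /= h; apply: (lt_le_trans h).
  by rewrite ler_nat ltnS.
have /fine_cvgP[_ /cvgrPdist_lt/(_ e e0)[n _ /(_ n (leqnn n)) /=]] := h.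
move=> hn; exists n.+1%:R => //.
have -> : [set x : borel V | n.+1%:R <= nrm x] = ~` F n.
  by apply/seteqP; split=> x /=; rewrite /F /= leNgt => /negP.
rewrite probability_setC // fineB ?fin_num_measure //=.
by apply: le_lt_trans hn; exact: ler_norm.
Qed.

(** Characters are equicontinuous on balls, and [P] has little mass far away. *)
Lemma fcos_fsin_cont P (e : R) : 0 < e -> exists2 d, 0 < d & forall xi zeta,
  nrm (xi - zeta) < d -> `|fcos P xi - fcos P zeta| < e /\ `|fsin P xi - fsin P zeta| < e.
Proof.
move=> e0; have e20 : 0 < e / 2 by rewrite divr_gt0.
have e80 : 0 < e / 8 by rewrite divr_gt0.
have [M M0 MP] := tail P e80; have [d d0 dP] := chv_unif e20 M0.
exists d => // xi zeta xz.
pose T := [set x : borel V | M <= nrm x].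
have mT : measurable T.
  rewrite (_ : T = ~` [set x : borel V | nrm x < M]).
    apply: measurableC; exact: (measurable_ball0 LF).
  by apply/seteqP; split=> x /=; rewrite /T /= leNgt => /negP.
have key (f g : borel V -> R) : bmeas f -> bmeas g ->
    (forall x, -1 <= f x <= 1) -> (forall x, -1 <= g x <= 1) ->
    (forall x, nrm x < M -> `|f x - g x| < e / 2) -> `|mean P f - mean P g| < e.
  move=> bf bg f1 g1 fg; rewrite -meanB //.
  apply: le_lt_trans (mean_norm P (bmeasB bf bg)) _.
  have bT : bmeas (\1_T : borel V -> R) by exact: bmeas_indic.
  apply: (@le_lt_trans _ _ (mean P (fun x => e / 2 + 2 * \1_T x))).
    apply: mean_le; first by apply: bmeas_norm; exact: bmeasB.
      by apply: bmeasD; [exact: bmeas_cst|exact: bmeasZ].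
    move=> x; rewrite indicE; have [xT|xT] := boolP (x \in T).
      have /andP[? ?] := f1 x; have /andP[? ?] := g1 x.
      by rewrite mulr1 ler_norml; apply/andP; split; lra.
    rewrite mulr0 addr0; apply/ltW/fg.
    by move: xT; rewrite notin_setE /T /= => /negP; rewrite -ltNge.
  rewrite meanD; [|exact: bmeas_cst|exact: bmeasZ].
  rewrite mean_cst meanZ // mean_indic //; move: MP; rewrite -/T; lra.
have c1 y x : -1 <= chv y x <= 1 by rewrite (ch_geN1 LF) (ch_le1 LF).
have s1 y x : -1 <= shv y x <= 1 by rewrite (sh_geN1 LF) (sh_le1 LF).
split; apply: key => //; try exact: chv_bmeas; try exact: shv_bmeas.
  by move=> x xM; have [] := dP _ _ _ xz xM.
by move=> x xM; have [] := dP _ _ _ xz xM.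
Qed.

Lemma fcos_norm P xi : `|fcos P xi| <= 1.
Proof.
rewrite -(@ler_pXn2r _ 2) ?nnegrE // real_normK ?num_real // expr1n.
by apply: le_trans (fsqr_le1 P xi); rewrite lerDl sqr_ge0.
Qed.

Lemma fsin_norm P xi : `|fsin P xi| <= 1.
Proof.
rewrite -(@ler_pXn2r _ 2) ?nnegrE // real_normK ?num_real // expr1n.
by apply: le_trans (fsqr_le1 P xi); rewrite lerDr sqr_ge0.
Qed.

Lemma fsqr_cont P (e : R) : 0 < e -> exists2 d, 0 < d & forall xi zeta,
  nrm (xi - zeta) < d -> `|fsqr P xi - fsqr P zeta| < e.
Proof.
move=> e0; have e40 : 0 < e / 4 by rewrite divr_gt0.
have [d d0 dP] := fcos_fsin_cont P e40; exists d => // xi zeta /dP[].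
have := fcos_norm P xi; have := fcos_norm P zeta.
have := fsin_norm P xi; have := fsin_norm P zeta; rewrite /fsqr.
move: (fcos P xi) (fcos P zeta) (fsin P xi) (fsin P zeta) => a b c d' h1 h2 h3 h4 h5 h6.
have sq (x y : R) : `|x| <= 1 -> `|y| <= 1 -> `|x - y| < e / 4 ->
    `|x ^+ 2 - y ^+ 2| < e / 2.
  move=> x1 y1 xy; rewrite subr_sqr normrM.
  have h : `|x + y| <= 2 by apply: le_trans (ler_normD _ _) _; lra.
  have := normr_ge0 (x - y); have : `|x - y| * `|x + y| <= `|x - y| * 2 by rewrite ler_wpM2l.
  lra.
rewrite (_ : _ - _ = (a ^+ 2 - b ^+ 2) + (c ^+ 2 - d' ^+ 2)); last by ring.
apply: le_lt_trans (ler_normD _ _) _.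
have := sq _ _ h4 h3 h5; have := sq _ _ h2 h1 h6; lra.
Qed.

Lemma fsqr_meas P : measurable_fun setT (fsqr P : borel V -> R).
Proof.
apply: (measurable_fun_nrmR LF) => x e /(fsqr_cont P)[d d0 dP].
by exists d => // y; exact: dP.
Qed.

Lemma mean_comb P xi a b :
  mean P (fun x => a * chv xi x + b * shv xi x) = a * fcos P xi + b * fsin P xi.
Proof.
exact: (mean_lin2 P a b (chv_bmeas xi) (shv_bmeas xi)).
Qed.

Lemma fsqr_conv P Q xi : fsqr (conv LF P Q) xi = fsqr P xi * fsqr Q xi.
Proof.
have hc : fcos (conv LF P Q) xi = fcos P xi * fcos Q xi - fsin P xi * fsin Q xi.
  transitivity (mean P (fun x => fcos Q xi * chv xi x + (- fsin Q xi) * shv xi x)).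
    rewrite [LHS](mean_conv LF P Q (chv_bmeas xi)).
    congr mean; apply/funext => x.
    transitivity (mean Q (fun y => chv xi x * chv xi y + (- shv xi x) * shv xi y)).
      by congr mean; apply/funext => y; rewrite /chv /shv dotDr (chD LF) mulNr.
    by rewrite mean_comb; ring.
  by rewrite mean_comb; ring.
have hs : fsin (conv LF P Q) xi = fsin P xi * fcos Q xi + fcos P xi * fsin Q xi.
  transitivity (mean P (fun x => fsin Q xi * chv xi x + fcos Q xi * shv xi x)).
    rewrite [LHS](mean_conv LF P Q (shv_bmeas xi)).
    congr mean; apply/funext => x.
    transitivity (mean Q (fun y => shv xi x * chv xi y + chv xi x * shv xi y)).
      by congr mean; apply/funext => y; rewrite /chv /shv dotDr (shD LF).
    by rewrite mean_comb; ring.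
  by rewrite mean_comb; ring.
by rewrite /fsqr hc hs; ring.
Qed.

Lemma fsqr_conv_pow P n xi : fsqr (conv_pow LF P n) xi = fsqr P xi ^+ n.
Proof.
elim: n => [|n IH]; last by rewrite /conv_pow iterS fsqr_conv IH exprS.
rewrite /fsqr /fcos /fsin !mean_conv_pow0; try exact: chv_bmeas; try exact: shv_bmeas.
exact: chv2shv2.
Qed.

Lemma mean_push P (f : borel V -> borel V) (mf : measurable_fun setT f) (g : borel V -> R) :
  bmeas g -> mean (push_prob P mf) g = mean P (g \o f).
Proof.
move=> bg; have [mg [M gM]] := bg; rewrite /mean /Rintegral; congr fine.
apply: (integral_pushforward mf) => //; first exact/measurable_EFinP.
apply: bmeas_int; split; first exact: measurableT_comp.
by exists M => x; exact: gM.
Qed.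

Lemma fsqr_push P (f g : V -> V) (mf : measurable_fun setT (f : borel V -> borel V)) xi :
  (forall x y, dot (g x) y = dot x (f y)) ->
  fsqr (push_prob P mf) xi = fsqr P (g xi).
Proof.
move=> fg; have hc : fcos (push_prob P mf) xi = fcos P (g xi).
  rewrite [LHS](mean_push P mf (chv_bmeas xi)).
  by congr mean; apply/funext => x; rewrite /chv /= fg.
have hs : fsin (push_prob P mf) xi = fsin P (g xi).
  rewrite [LHS](mean_push P mf (shv_bmeas xi)).
  by congr mean; apply/funext => x; rewrite /shv /= fg.
by rewrite /fsqr hc hs.
Qed.

End Fourier.

(** * Dynamics of the equation [u (A x) ^+ n = u x] *)

Section Dynamics.
Variables (R : realType) (K : topFieldType) (abv ch sh : K -> R).
Hypothesis LF : local_field abv ch sh.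
Variable V : vectType K.
Local Notation nrm := (@nrm R K abv V).

Variables (u : V -> R) (A B : V -> V) (n : nat).
Hypothesis u_ge0 : forall x, 0 <= u x.
Hypothesis u_le1 : forall x, u x <= 1.
Hypothesis u0 : u 0 = 1.
Hypothesis uN : forall x, u (- x) = u x.
Hypothesis uD : forall x y, 1 - u (x + y) <= 2 * (1 - u x) + 2 * (1 - u y).
Hypothesis u_cont : forall e : R, 0 < e -> exists2 d, 0 < d & forall x y,
  nrm (x - y) < d -> `|u x - u y| < e.
Hypothesis u_full : forall x, x != 0 -> exists a : K, u (a *: x) < 1.
Hypotheses (lA : linear A) (lB : linear B) (AB : cancel A B).
Hypothesis n2 : (2 <= n)%N.
Hypothesis uA : forall x, u (A x) ^+ n = u x.

Variable rho : R.
Hypothesis rho1 : 1 <= rho.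
Hypothesis rhoP : forall r (x : V), 0 < r -> x != 0 ->
  exists a : K, a != 0 /\ r <= nrm (a *: x) <= rho * r.

Let rho0 : 0 < rho. Proof. by rewrite (lt_le_trans _ rho1). Qed.

Let ltr_exp0 (c e : R) : 0 <= c -> c < 1 -> 0 < e -> exists k, forall j, (k <= j)%N ->
  c ^+ (n ^ j) < e.
Proof.
move=> c0 c1 e0; have /cvgrPdist_lt/(_ e e0)[k _ kP] : c ^+ m @[m --> \oo] --> (0 : R).
  by apply: cvg_expr; rewrite ger0_norm.
exists k => j kj; have := kP j kj; rewrite /= sub0r normrN ger0_norm ?exprn_ge0 //.
apply: le_lt_trans; apply: ler_wiXn2l => //; first exact: ltW.
exact/ltnW/ltn_expl.
Qed.

Let frac_lt1 k : 1 - k.+1%:R^-1 < 1 :> R.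
Proof. by rewrite gtrBl invr_gt0. Qed.

Let frac_ge0 k : 0 <= 1 - k.+1%:R^-1 :> R.
Proof. by rewrite subr_ge0 invf_le1 // ler1n. Qed.

Let frac_homo k j : (k <= j)%N -> 1 - k.+1%:R^-1 <= 1 - j.+1%:R^-1 :> R.
Proof. by move=> kj; rewrite lerD2l lerN2 lef_pV2 ?posrE // ler_nat ltnS. Qed.

Let frac_near (c : R) : c < 1 -> exists k, c < 1 - k.+1%:R^-1.
Proof.
move=> c1; exists (Num.truncn (1 - c)^-1).
rewrite ltrBrDr addrC -ltrBrDr invf_plt ?posrE ?subr_gt0 //.
exact: Num.Theory.truncnS_gt.
Qed.

Lemma uA_iter k x : u (iter k A x) ^+ (n ^ k) = u x.
Proof.
elim: k => [|k IH]; first by rewrite expr1.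
by rewrite iterS expnS exprM uA.
Qed.

Lemma linear_iter k (f : V -> V) : linear f -> linear (iter k f).
Proof. by move=> lf; elim: k => [//|k IH] a x y; rewrite !iterS IH lf. Qed.

Lemma linear_scale (f : V -> V) a x : linear f -> f (a *: x) = a *: f x.
Proof.
move=> lf; have f0 : f 0 = 0.
  by have := lf (-1) 0 0; rewrite !scaleN1r !addNr.
by rewrite -[a *: x]addr0 lf f0 addr0.
Qed.

Lemma uD1 x y : u x = 1 -> 1 - u (x + y) <= 2 * (1 - u y).
Proof. by move=> ux; have := uD x y; rewrite ux subrr mulr0 add0r. Qed.

(** With [uN] and [uD], the set [{u = 1}] is a subgroup of [V]. *)
Lemma u_nat (m : nat) x : u x = 1 -> u (m%:R *: x) = 1.
Proof.
move=> ux; elim: m => [|m IH]; first by rewrite scale0r.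
rewrite -natr1 scalerDl scale1r; apply/eqP; rewrite eq_le u_le1 /=.
by have := uD1 x IH; rewrite ux; lra.
Qed.

Lemma u_int (m : int) x : u x = 1 -> u (m%:~R *: x) = 1.
Proof.
move=> ux; case: m => m; first exact: u_nat.
by rewrite NegzE mulrNz scaleNr uN; exact: (u_nat m.+1).
Qed.

Definition star (c : R) (x : V) := forall a, abv a <= 1 -> c <= u (a *: x).

(** By compactness of the shell [1 <= nrm x <= rho], one [k] and one level below
    [1] serve all directions.  A point farther than [rho * eta k] rescales into
    the shell by a factor at most [rho / nrm x], so that a point of its unit
    star falls below this level. *)
Lemma star_bounded (eta : nat -> R) : (forall k, 0 < eta k) ->
  {homo eta : k j / (k <= j)%N >-> k <= j} ->
  (forall x, x != 0 -> exists k a, abv a <= eta k /\ u (a *: x) < 1) ->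
  exists k c, [/\ 0 <= c, c < 1 & forall x, star c x -> nrm x <= rho * eta k].
Proof.
move=> eta0 eta_homo h.
have [|k kP] := @ball_unif _ _ _ _ _ LF V (fun k y => 1 <= nrm y ->
    exists a, abv a <= eta k /\ u (a *: y) < 1 - k.+1%:R^-1) rho.
  move=> x; have [x1|x1] := ltP (nrm x) 1.
    exists 0%N, (1 - nrm x) => [|y j _]; first by rewrite subr_gt0.
    rewrite ltrBrDr => h1 y1; have := nrmD LF (y - x) x; rewrite subrK; lra.
  have x0 : x != 0 by apply: contraTneq x1 => ->; rewrite (nrm0 LF) -ltNge.
  have [k [a [ak ax]]] := h x x0; have [k' k'P] := frac_near ax.
  have [d d0 dP] : exists2 d, 0 < d & forall y, nrm (y - x) < d ->
      u (a *: y) < 1 - k'.+1%:R^-1.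
    have gap : 0 < 1 - k'.+1%:R^-1 - u (a *: x) by rewrite subr_gt0.
    have [d d0 dP] := u_cont gap.
    have a1 : 0 < 1 + abv a by rewrite ltr_pwDl // (abv_ge0 LF).
    exists (d / (1 + abv a)) => [|y]; first exact: divr_gt0.
    rewrite ltr_pdivlMr // => yx.
    have /dP : nrm (a *: y - a *: x) < d.
      rewrite -scalerBr (nrmZ LF) mulrC; apply: le_lt_trans yx.
      by rewrite ler_wpM2l ?(nrm_ge0 LF) // lerDr.
    by rewrite ltr_norml => /andP[_]; rewrite ltrBlDr subrK.
  exists (maxn k k'), d => // y j; rewrite geq_max => /andP[kj k'j] yx _.
  exists a; split; first exact: le_trans ak (eta_homo _ _ kj).
  exact: lt_le_trans (dP y yx) (frac_homo k'j).
exists k, (1 - k.+1%:R^-1); split => // x sx; rewrite leNgt; apply/negP => xbig.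
have x0 : x != 0.
  apply: contraTneq xbig => ->; rewrite (nrm0 LF) -leNgt.
  by rewrite ltW // mulr_gt0.
have [b [b0 /andP[b1 brho]]] := rhoP (ltr01 : 0 < 1 :> R) x0.
rewrite mulr1 in brho.
have [a [ak]] := kP (b *: x) brho b1; rewrite ltNge => /negP; apply.
rewrite scalerA; apply: sx; rewrite (abvM LF).
have nx : 0 < nrm x by exact: (nrm_gt0 LF).
move: brho; rewrite (nrmZ LF) -ler_pdivlMr // => brho.
apply: (@le_trans _ _ (eta k * (rho / nrm x))).
  by apply: ler_pM; rewrite ?(abv_ge0 LF).
by rewrite mulrA ler_pdivrMr // mul1r mulrC ltW.
Qed.

Lemma star_bounded_ex : exists M c,
  [/\ 0 <= c, c < 1 & forall x, star c x -> nrm x <= M].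
Proof.
have eta0 k : 0 < k.+1%:R :> R by rewrite ltr0n.
have eta_homo : {homo (fun k => k.+1%:R : R) : k j / (k <= j)%N >-> k <= j}.
  by move=> k j kj; rewrite ler_nat ltnS.
have [|k [c cP]] := star_bounded eta0 eta_homo.
  move=> x /u_full[a a1]; exists (Num.truncn (abv a)), a; split => //.
  exact/ltW/Num.Theory.truncnS_gt.
by exists (rho * k.+1%:R), c.
Qed.

Lemma near0 (c : R) : c < 1 -> exists2 r, 0 < r & forall x, nrm x < r -> c < u x.
Proof.
move=> c1; have [|d d0 dP] := u_cont (_ : 0 < 1 - c); first by rewrite subr_gt0.
exists d => // x xd; have := dP x 0; rewrite subr0 u0 => /(_ xd).
by rewrite ltr_norml => /andP[h _]; lra.
Qed.

(** Fixing the choice of this radius lets the bounds on orbits that follow refer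
    to the same ball. *)
Definition base_radius : R := xget 0 [set r | 0 < r /\ forall x, nrm x < r -> 2^-1 < u x].

Lemma base_radiusP : 0 < base_radius /\ forall x, nrm x < base_radius -> 2^-1 < u x.
Proof.
have [|r r0 rP] := @near0 2^-1; first by rewrite invf_lt1 // ltr1n.
by rewrite /base_radius; apply: (@xgetPex _ 0
  [set r | 0 < r /\ forall x, nrm x < r -> 2^-1 < u x]); exists r.
Qed.

(** If [a] is in the unit ball and [x] in the base ball then [u (a *: x) > 1/2],
    and the [n ^ j]-th root of [1/2] exceeds [c] for large [j]: the whole star
    of [iter j A x] is above level [c]. *)
Lemma power_bounded (M c : R) : 0 <= c -> c < 1 ->
  (forall x, star c x -> nrm x <= M) ->
  exists k, forall j x, (k <= j)%N -> nrm x < base_radius -> nrm (iter j A x) <= M.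
Proof.
move=> c0 c1 cM; have [r0 rP] := base_radiusP.
have [|k kP] := ltr_exp0 c0 c1 (_ : 0 < 2^-1); first by rewrite invr_gt0.
exists k => j x kj xr; apply: cM => a a1; rewrite leNgt; apply/negP => lt_c.
have : nrm (a *: x) < base_radius.
  by rewrite (nrmZ LF); apply: le_lt_trans xr; rewrite ler_piMl ?(nrm_ge0 LF).
move=> /rP; rewrite -(uA_iter j) (linear_scale _ _ (linear_iter j lA)).
apply/negP; rewrite -leNgt; apply/ltW; apply: le_lt_trans (kP j kj).
by apply: lerXn2r; rewrite ?nnegrE // ltW.
Qed.

Lemma orbit_bounded (M c : R) x : 0 <= c -> c < 1 ->
  (forall x, star c x -> nrm x <= M) ->
  exists k B0, forall j, (k <= j)%N -> nrm (iter j A x) <= B0.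
Proof.
move=> c0 c1 cM; have [k kP] := power_bounded c0 c1 cM.
have [r0 _] := base_radiusP.
have [->|x0] := eqVneq x 0.
  exists k, M => j kj; apply: kP => //; by rewrite (nrm0 LF).
have rr : 0 < base_radius / (rho * 2) by rewrite divr_gt0 // mulr_gt0.
have [b [b0 /andP[_ br]]] := rhoP rr x0.
have ab := abv_gt0 LF b0.
exists k, (M / abv b) => j kj; rewrite ler_pdivlMr // mulrC -(nrmZ LF).
rewrite -(linear_scale _ _ (linear_iter j lA)); apply: kP => //.
apply: le_lt_trans br _.
have -> : rho * (base_radius / (rho * 2)) = base_radius / 2 by field; rewrite gt_eqF.
by rewrite ltr_pdivrMr // ltr_pMr // ltr1n.
Qed.

Lemma u_eq1_iter k x : u x = 1 -> u (iter k A x) = 1.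
Proof.
move=> ux; apply/eqP; have nk : (0 < n ^ k)%N by rewrite expn_gt0 (ltnW n2).
by rewrite -(pexpr_eq1 nk (u_ge0 _)) uA_iter ux.
Qed.

(** When the integers are dense in the unit ball, the closed subgroup [{u = 1}]
    is a module over that ball, so that [star] holds at its points.  In the
    archimedean case a nonzero point of it would have arbitrarily short images
    under the iterates of [A], since the bound on orbits can be taken arbitrarily
    small; the multiples of a short image are so dense on their line that [star]
    holds all along the line, which is impossible as the line is unbounded. *)
Lemma eq1_bounded : exists R0, forall x, u x = 1 -> nrm x <= R0.
Proof.
have [[int_near int_big]|int_dense] := abv_int LF; last first.
  have [M [c [_ c1 cM]]] := star_bounded_ex.
  exists M => x ux; apply: cM => a a1.
  apply/(le_trans (ltW c1))/ler_addgt0Pr => e e0.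
  have e20 : 0 < e / 2 by rewrite divr_gt0.
  have [|d d0 dP] := @near0 (1 - e / 2); first by rewrite gtrBl.
  have nx : 0 < 1 + nrm x by rewrite ltr_pwDl // (nrm_ge0 LF).
  have [m am] := int_dense a _ a1 (divr_gt0 d0 nx).
  have /dP : nrm ((a - m%:~R) *: x) < d.
    move: am; rewrite ltr_pdivlMr // (nrmZ LF); apply: le_lt_trans.
    by rewrite ler_wpM2l ?(abv_ge0 LF) // lerDr.
  have := uD1 ((a - m%:~R) *: x) (u_int m ux).
  by rewrite -scalerDl subrKC; lra.
(* Dividing a point of [{u < 1}] by a large integer gives one as short as
   desired on the same line, as [{u = 1}] is stable under integer multiples. *)
have arch (M : R) : 0 < M -> exists c, [/\ 0 <= c, c < 1 &
    forall x, star c x -> nrm x <= M].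
  move=> M0; have eta0 (k : nat) : 0 < M / rho by rewrite divr_gt0.
  have [//||k [c [c0 c1 cM]]] := star_bounded eta0.
    move=> x /u_full[a a1]; exists 0%N.
    have [m mP] := int_big (1 + abv a / (M / rho)).
    have Mr : 0 < M / rho by rewrite divr_gt0.
    have m0 : 0 < abv m%:R.
      by apply: lt_le_trans mP; rewrite ltr_pwDl // divr_ge0 ?(abv_ge0 LF) ?ltW.
    have mK : m%:R != 0 :> K.
      by apply: contraTneq m0 => ->; rewrite (abv0 LF) ltxx.
    exists (a / m%:R); split.
      rewrite (abvM LF) (abvV LF) ler_pdivrMr // mulrC -ler_pdivrMr //.
      by apply: le_trans mP; rewrite lerDr.
    rewrite lt_neqAle u_le1 andbT; apply: contraTneq a1 => /(u_nat m).
    by rewrite scalerA mulrC divfK // => ->; rewrite ltxx.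
  by exists c; split=> // x /cM; rewrite mulrC divfK // gt_eqF.
exists 0 => h uh; rewrite leNgt; apply/negP => h0.
have hn : h != 0 by apply: contraTneq h0 => ->; rewrite (nrm0 LF) ltxx.
have [c [c0 c1 cM]] := arch 1 ltr01.
have [|r2 r20 r2P] := @near0 ((1 + c) / 2) _; first by lra.
have [r0 _] := base_radiusP.
have rr : 0 < base_radius / (rho * 2) by rewrite divr_gt0 // mulr_gt0.
have [b [b0 /andP[_ br]]] := rhoP rr hn.
have ab := abv_gt0 LF b0.
have M'0 : 0 < abv b * (r2 / 2) by rewrite mulr_gt0 // divr_gt0.
have [c' [c'0 c'1 c'M]] := arch _ M'0.
have [k kP] := power_bounded c'0 c'1 c'M.
have /(kP k _ (leqnn k)) : nrm (b *: h) < base_radius.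
  apply: le_lt_trans br _.
  have -> : rho * (base_radius / (rho * 2)) = base_radius / 2 by field; rewrite gt_eqF.
  by rewrite ltr_pdivrMr // ltr_pMr // ltr1n.
rewrite (linear_scale _ _ (linear_iter k lA)) (nrmZ LF) ler_pM2l //.
set h' := iter k A h => h'r2.
have uh' : u h' = 1 by exact: u_eq1_iter.
have h'0 : h' != 0.
  apply: contraNneq hn => h'0.
  have AK x : iter k B (iter k A x) = x.
    by elim: (k) x => [//|j IH] x; rewrite iterSr iterS AB IH.
  apply/eqP; rewrite -(AK h) -/h' h'0.
  by have := linear_scale 0 0 (linear_iter k lB); rewrite !scale0r.
(* Every multiple of [h'] is within [nrm h'] of an integer multiple. *)
have st t : star c (t *: h').
  move=> a _; rewrite scalerA; move: (a * t) => s.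
  have [m sm] := int_near s.
  have : nrm ((s - m%:~R) *: h') < r2.
    rewrite (nrmZ LF); apply: (@le_lt_trans _ _ (nrm h')).
      by rewrite ler_piMl ?(nrm_ge0 LF).
    by apply: le_lt_trans h'r2 _; rewrite ltr_pdivrMr // ltr_pMr // ltr1n.
  move=> /r2P; have := uD1 ((s - m%:~R) *: h') (u_int m uh').
  by rewrite -scalerDl subrKC; lra.
have [t [_ /andP[t2 _]]] := rhoP (ltr0Sn R 1) h'0.
by have := cM _ (st t); lra.
Qed.

Lemma annulus (R0 R2 R3 : R) : (forall x, u x = 1 -> nrm x <= R0) -> R0 < R2 ->
  exists c, [/\ 0 <= c, c < 1 & forall x, R2 <= nrm x -> nrm x <= R3 -> u x < c].
Proof.
move=> H R02; have [|k kP] := @ball_unif _ _ _ _ _ LF V (fun k y => R2 <= nrm y ->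
    u y < 1 - k.+1%:R^-1) R3.
  move=> x; have [x1|x1] := ltP (nrm x) R2.
    exists 0%N, (R2 - nrm x) => [|y j _]; first by rewrite subr_gt0.
    rewrite ltrBrDr => h1 y1; have := nrmD LF (y - x) x; rewrite subrK; lra.
  have ux : u x < 1.
    by rewrite lt_neqAle u_le1 andbT; apply: contraTneq R02 => /H; rewrite -leNgt; exact: le_trans.
  have [k kP] := frac_near ux.
  have gap : 0 < 1 - k.+1%:R^-1 - u x by rewrite subr_gt0.
  have [d d0 dP] := u_cont gap; exists k, d => // y j kj /dP h _.
  apply: lt_le_trans (frac_homo kj).
  by move: h; rewrite ltr_norml => /andP[_]; rewrite ltrBlDr subrK.
by exists (1 - k.+1%:R^-1); split => // x x2 x3; exact: kP.
Qed.

(** A point of the superlevel set beyond a large annulus has its forward orbit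
    beyond the annulus, on which [u] is small; this orbit is bounded, so [u] is
    bounded away from [1] on it, against [u (iter k A x) -> 1]. *)
Lemma superlevel_bounded : exists c R0, [/\ 0 < c, c < 1 &
  forall x, c <= u x -> nrm x <= R0].
Proof.
have [R0 HR0] := eq1_bounded.
have [L L0 LP] := linear_bounded LF lB.
pose R2 := `|R0| + 1.
have R02 : R0 < R2 by rewrite /R2; have := ler_norm R0; lra.
have R20 : 0 < R2 by rewrite /R2; have := normr_ge0 R0; lra.
(* [B] maps the ball of radius [R2] into that of radius [R3], so that no step of
   an orbit jumps over the annulus. *)
pose R3 := Num.max (L * R2) R2.
have [c [c0 c1 cP]] := annulus R3 HR0 R02.
(* [2^-1] serves to make the level positive. *)
pose c' := Num.max c 2^-1.
exists c', R2; split.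
- by rewrite lt_max invr_gt0 ltr0n orbT.
- by rewrite gt_max c1 invf_lt1 // ltr1n.
move=> x cx; rewrite leNgt; apply/negP => xR2.
have uk k : c <= u (iter k A x).
  apply: (@le_trans _ _ (u x)); first by apply: le_trans cx; rewrite le_max lexx.
  rewrite -(uA_iter k x) ler_iXnr //.
  by rewrite expn_gt0 (ltnW n2).
have out k : R3 < nrm (iter k A x).
  elim: k => [|k IH].
    rewrite ltNge; apply/negP => x3; have := cP x (ltW xR2) x3.
    by rewrite ltNge (uk 0%N).
  rewrite ltNge; apply/negP => x3.
  have [x2|x2] := ltP (nrm (iter k.+1 A x)) R2; last first.
    by have := cP _ x2 x3; rewrite ltNge uk.
  have := LP (iter k.+1 A x); rewrite iterS AB => h.
  have : nrm (iter k A x) < L * R2 by apply: le_lt_trans h _; rewrite ltr_pM2l.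
  apply/negP; rewrite -leNgt; apply: le_trans (ltW IH); rewrite le_max lexx //.
have [M [d [d0 d1 dM]]] := star_bounded_ex.
have [k1 [B0 B0P]] := orbit_bounded x d0 d1 dM.
have R03 : R0 < R3 by rewrite lt_max R02 orbT.
have [e [e0 e1 eP]] := annulus B0 HR0 R03.
have c'0 : 0 < c' by rewrite lt_max invr_gt0 ltr0n orbT.
have [k2 k2P] := ltr_exp0 e0 e1 c'0.
pose j := maxn k1 k2.
have := k2P j (leq_maxr _ _); apply/negP; rewrite -leNgt; apply: (le_trans cx).
rewrite -(uA_iter j x); apply: lerXn2r; rewrite ?nnegrE //.
by apply/ltW/eP; [exact/ltW/out|exact/B0P/leq_maxl].
Qed.

End Dynamics.

(** * Full measures *)

Section FullMeasures.
Variables (R : realType) (K : topFieldType) (abv ch sh : K -> R).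
Hypothesis LF : local_field abv ch sh.
Variable V : vectType K.
Local Notation nrm := (@nrm R K abv V).
Implicit Types P Q : probability (borel V) R.

(** Density of the rationals upgrades triviality of a character on rational
    multiples of [s] to triviality on the whole line [K s]. *)
Lemma ch_line (s : K) :
  (forall (p : int) (q : nat), ch (p%:~R / q%:R * s) = 1) -> s = 0.
Proof.
move=> h; apply/eqP; apply: contraT => s0.
have [z /negP zP] := ch_neq1 LF; exfalso; apply: zP.
rewrite -subr_eq0 -normr_eq0 eq_le normr_ge0 andbT; apply/ler_addgt0Pr => e e0.
rewrite add0r; have [r r0 rP] := ch_unif LF e0.
have as0 := abv_gt0 LF s0.
have [p [q [_ pq]]] := abv_rat LF (z / s) (divr_gt0 r0 as0).
have [|h1 _] := rP z (p%:~R / q%:R * s); last by move: h1; rewrite h => /ltW.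
rewrite (_ : z - _ = (z / s - p%:~R / q%:R) * s); last by rewrite mulrBl divfK.
by rewrite (abvM LF) -ltr_pdivlMr.
Qed.

Lemma measurable_hyperplane (xi : V) (c : K) :
  measurable ([set x | dot xi x = c] : set (borel V)).
Proof.
rewrite -[X in measurable X]setCK; apply: measurableC.
apply: (nrm_open_measurable LF) => x /= /eqP; rewrite -subr_eq0 => xc.
have n1 : 0 < 1 + nrm xi by rewrite ltr_pwDl // (nrm_ge0 LF).
exists (abv (dot xi x - c) / (1 + nrm xi)) => [|y].
  by rewrite divr_gt0 // (abv_gt0 LF).
rewrite ltr_pdivlMr // => yx yc.
have : abv (dot xi x - c) <= nrm xi * nrm (y - x).
  by rewrite -yc -dotBr (nrmC LF y); exact: (abv_dot LF).
rewrite leNgt => /negP; apply; apply: le_lt_trans yx.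
by rewrite mulrC ler_wpM2l ?(nrm_ge0 LF) // lerDr.
Qed.

Lemma prob1_bigcap P (F : nat -> set (borel V)) : (forall k, measurable (F k)) ->
  (forall k, P (F k) = 1%E) -> P (\bigcap_k F k) = 1%E.
Proof.
move=> mF PF; have mI : measurable (\bigcap_k F k) by exact: bigcapT_measurable.
have h : P (~` (\bigcap_k F k)) = 0%E.
  apply/eqP; rewrite -measure_le0 setC_bigcap.
  apply: le_trans (measure_sigma_subadditive _ _ _ _) _.
  - by move=> k; exact: measurableC.
  - by apply: bigcupT_measurable => k; exact: measurableC.
  - exact: subset_refl.
  by rewrite eseries0 // => k _ _ /=; rewrite probability_setC // PF subee.
have := probability_setC P mI; rewrite h => /esym/eqP.
by rewrite sube_eq ?fin_num_measure // add0e => /eqP.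
Qed.

(** If [fsqr] is [1] on the line of [xi] then, for each rational [q], the
    character [ch (q <xi, x>)] is almost surely constant.  Countably many
    rationals being involved, almost all [x] give the same values as some [x0],
    for all [q]; then [x - x0] lies in the hyperplane orthogonal to [xi], and a
    coset of it has mass [1]. *)
Lemma full_fsqr P (xi : V) : full P -> xi != 0 -> exists a : K, fsqr ch sh P (a *: xi) < 1.
Proof.
move=> fP xi0; apply: contrapT => nex.
have u1 a : fsqr ch sh P (a *: xi) = 1.
  apply/eqP; rewrite eq_le (fsqr_le1 LF) /= leNgt; apply/negP => h.
  by apply: nex; exists a.
pose q k : K := if unpickle k is Some (a, b) then (a : int)%:~R / (b : nat)%:R else 0.
pose F k (x : borel V) : R := (chv ch (q k *: xi) x - fcos ch P (q k *: xi)) ^+ 2 +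
                   (shv sh (q k *: xi) x - fsin sh P (q k *: xi)) ^+ 2.
have bF k : bmeas (F k) by exact: (bmeas_var LF).
have mZ k : measurable [set x | F k x = 0].
  by rewrite -[X in measurable X]setTI; exact: ((bF k).1 measurableT [set 0]).
have PZ k : P [set x | F k x = 0] = 1%E.
  apply: mean0_ae => //; first by move=> x; rewrite addr_ge0 ?sqr_ge0.
  by have := fsqr_var LF P (q k *: xi); rewrite u1 subrr => /esym.
have PI := prob1_bigcap mZ PZ.
have [x0 x0P] : \bigcap_k [set x | F k x = 0] !=set0.
  apply/set0P; apply/eqP => E; move: PI; rewrite E measure0 => /eqP.
  by rewrite eqe eq_sym oner_eq0.
have key x : (\bigcap_k [set x | F k x = 0]) x -> dot xi (x - x0 : V) = 0.
  move=> xP; apply: ch_line => a b.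
  have /= hx := xP (pickle (a, b)) I; have /= hx0 := x0P (pickle (a, b)) I.
  have z2 (r s : R) : r ^+ 2 + s ^+ 2 = 0 -> r = 0 /\ s = 0.
    move=> /eqP; rewrite paddr_eq0 ?sqr_ge0 // !sqrf_eq0.
    by move=> /andP[/eqP -> /eqP ->].
  move: hx hx0; rewrite /F /q pickleK => /z2[/subr0_eq c1 /subr0_eq s1] /z2[/subr0_eq c2 /subr0_eq s2].
  rewrite -dotZl dotBr (chB LF); move: c1 s1; rewrite -c2 -s2 /chv /shv => -> ->.
  by rewrite -!expr2 (ch2sh2 LF).
have lf : linear (dot xi : V -> K^o) by move=> a x y; rewrite dotDr dotZr.
pose f : {linear V -> K^o} := HB.pack (dot xi : V -> K^o)
  (GRing.isLinear.Build _ _ _ _ _ lf).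
have memW x : (x \in lker (linfun f)) = (dot xi x == 0).
  by rewrite memv_ker lfunE.
have WE : [set x : borel V | (x : V) - x0 \in lker (linfun f)] =
    [set x : borel V | dot xi (x : V) = dot xi (x0 : V)].
  apply/seteqP; split=> x /=; rewrite memW dotBr subr_eq0; first by move/eqP.
  by move=> ->.
have W1 : lker (linfun f) = fullv.
  apply: (fP _ x0); rewrite WE; apply/eqP; rewrite eq_le probability_le1 /=; last first.
    exact: measurable_hyperplane.
  rewrite -PI; apply: le_measure; rewrite ?inE //.
  - exact: bigcapT_measurable.
  - exact: measurable_hyperplane.
  - by move=> x /key h /=; apply/eqP; rewrite -subr_eq0 -dotBr h.
suff : xi = 0 by apply/eqP.
apply: dot0 => x; apply/eqP; rewrite -memW W1; exact: memvf.
Qed.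

End FullMeasures.

(** * Integrability of a power *)

(** The sets [{u >= c^(n^k)}] are the successive preimages of the first one by
    [A], so their volumes grow like [delta^k], whereas [u^q] is at most
    [c^(q n^k)] outside of the [k]-th one. *)
Lemma integrable_power (R : realType) d (T : measurableType d)
    (lam : {measure set T -> \bar R}) (u : T -> R) (A : T -> T) (n : nat)
    (c delta : R) :
  measurable_fun setT u -> (forall x, 0 <= u x) -> (forall x, u x <= 1) ->
  (forall x, u (A x) ^+ n = u x) -> (2 <= n)%N -> 0 < c -> c < 1 -> 0 < delta ->
  (forall X : set T, measurable X -> lam [set x | X (A x)] = (delta%:E * lam X)%E) ->
  (lam [set x | (c <= u x)%R] < +oo)%E ->
  exists q, (0 < q)%N /\ (\int[lam]_x (u x ^+ q)%:E < +oo)%E.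
Proof.
move=> mu0 u0 u1 uA n2 c0 c1 d0 lamA finc.
pose F k := [set x | c ^+ (n ^ k) <= u x].
have n0 : (0 < n)%N by apply: ltnW.
have mF k : measurable (F k).
  rewrite (_ : F k = u @^-1` `[c ^+ (n ^ k), +oo[); last first.
    by apply/seteqP; split=> x /=; rewrite in_itv /= andbT.
  by rewrite -[X in measurable X]setTI; exact: mu0.
pose v := fine (lam (F 0%N)).
have F0E : F 0%N = [set x | (c <= u x)%R] by rewrite /F expn0 expr1.
have v0 : 0 <= v by exact: fine_ge0.
have lamF k : lam (F k) = (delta ^+ k * v)%:E.
  elim: k => [|k IH].
    by rewrite expr0 mul1r /v fineK // ge0_fin_numE // F0E.
  rewrite (_ : F k.+1 = [set x | F k (A x)]) ?lamA // ?IH -?EFinM ?mulrA -?exprS //.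
  apply/seteqP; split=> x; rewrite /F /= -(uA x) expnSr exprM.
    by rewrite ler_pXn2r ?nnegrE // exprn_ge0 // ltW.
  by rewrite ler_pXn2r ?nnegrE // exprn_ge0 // ltW.
(* [c ^+ q] beats the growth rate of the volumes. *)
have [q q0 qP] : exists2 q, (0 < q)%N & delta * c ^+ q <= 2^-1.
  have e0 : 0 < (2 * delta)^-1 by rewrite invr_gt0 mulr_gt0.
  have /cvgrPdist_lt/(_ _ e0)[k _ kP] : c ^+ m @[m --> \oo] --> (0 : R).
    by apply: cvg_expr; rewrite ger0_norm // ltW.
  exists k.+1 => //; have := kP k.+1 (leqnSn k).
  rewrite /= sub0r normrN ger0_norm ?exprn_ge0 ?(ltW c0) // => /ltW h.
  by rewrite -ler_pdivlMl // -invfM mulrC.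
exists q; split => //.
pose t k : R := if k is j.+1 then c ^+ (q * n ^ j) else 1.
pose g k (x : T) : \bar R := (t k * \1_(F k) x)%:E.
have t0 k : 0 <= t k by case: k => [|k] //=; rewrite exprn_ge0 // ltW.
have g0 k x : (0 <= g k x)%E by rewrite lee_fin mulr_ge0.
have mg k : measurable_fun setT (g k).
  by apply/measurable_EFinP; apply: measurable_funM => //; exact: measurable_indic.
apply: (@le_lt_trans _ _ (\int[lam]_x (\sum_(0 <= k <oo) g k x))%E).
  apply: ge0_le_integral => //.
  - by move=> x _; rewrite lee_fin exprn_ge0.
  - by apply/measurable_EFinP; exact: measurable_funX.
  - by apply: ge0_emeasurable_sum => // k x _; exact: g0.
  move=> x _.
  have gk k : (g k x <= \sum_(0 <= j <oo) g j x)%E.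
    apply: le_trans (nneseries_lim_ge k.+1 _) => //.
    rewrite big_nat_recr //= leeDr //; exact: sume_ge0.
  have [ux|ux] := eqVneq (u x) 0.
    by rewrite ux expr0n (gtn_eqF q0); apply: nneseries_ge0.
  have up : 0 < u x by rewrite lt_def ux u0.
  have exk : exists k, x \in F k.
    have /cvgrPdist_lt/(_ _ up)[k _ kP] : c ^+ m @[m --> \oo] --> (0 : R).
      by apply: cvg_expr; rewrite ger0_norm // ltW.
    exists k; rewrite inE /F /=; have := kP (n ^ k)%N (ltnW (ltn_expl k n2)).
    by rewrite /= sub0r normrN ger0_norm ?exprn_ge0 ?(ltW c0) // => /ltW.
  case: (ex_minnP exk) => -[|k] xk min.
    by apply: le_trans (gk 0%N); rewrite lee_fin /= indicE xk mulr1 exprn_ile1.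
  apply: le_trans (gk k.+1); rewrite lee_fin /= indicE xk mulr1 mulnC exprM.
  apply: lerXn2r; rewrite ?nnegrE ?exprn_ge0 ?(ltW c0) //.
  have : x \notin F k by apply/negP => /min; rewrite ltnn.
  by rewrite notin_setE /F /= => /negP; rewrite -ltNge => /ltW.
rewrite integral_nneseries //.
pose C := v + 2 * (delta * v).
have C0 : 0 <= C by rewrite /C; have := mulr_ge0 (ltW d0) v0; lra.
have intg k : (\int[lam]_x g k x = (t k * (delta ^+ k * v))%:E)%E.
  rewrite /g; under eq_integral do rewrite EFinM.
  have mI : measurable_fun setT (fun x => (\1_(F k) x : R)%:E).
    by apply/measurable_EFinP; exact: measurable_indic.
  rewrite ge0_integralZl ?lee_fin //.
  by rewrite integral_indic // setIT lamF EFinM.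
have bound k : t k * (delta ^+ k * v) <= C * 2^-1 ^+ k.
  have dv := mulr_ge0 (ltW d0) v0.
  case: k => [|k] /=; first by rewrite !expr0 !mul1r mulr1 /C; lra.
  apply: (@le_trans _ _ (delta * v * 2^-1 ^+ k)); last first.
    rewrite exprS mulrA ler_wpM2r ?exprn_ge0 ?invr_ge0 //.
    by rewrite /C; lra.
  apply: (@le_trans _ _ (delta * v * (delta * c ^+ q) ^+ k)); last first.
    apply: ler_wpM2l => //; apply: lerXn2r; rewrite ?nnegrE ?invr_ge0 //.
    by rewrite mulr_ge0 ?exprn_ge0 // ltW.
  rewrite exprMn -exprM exprS mulrC.
  have -> : delta * delta ^+ k * v * c ^+ (q * n ^ k) =
    delta * v * (delta ^+ k * c ^+ (q * n ^ k)) by ring.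
  apply: ler_wpM2l => //; apply: ler_wpM2l; first by rewrite exprn_ge0 // ltW.
  apply: ler_wiXn2l; [exact: ltW|exact: ltW|].
  by rewrite leq_mul2l (ltnW (ltn_expl k n2)) orbT.
apply: (@le_lt_trans _ _ (C * 2)%:E); last exact: ltry.
apply: lime_le.
  by apply: is_cvg_nneseries => k _ _; apply: integral_ge0 => x _; exact: g0.
near=> m; under eq_bigr do rewrite intg.
rewrite sumEFin lee_fin.
apply: (@le_trans _ _ (C * (2 - 2 * 2^-1 ^+ m))); last first.
  by rewrite ler_wpM2l // gerBl mulr_ge0 // exprn_ge0 // invr_ge0.
elim: (m) => [|j IH]; first by rewrite big_geq // expr0 mulr1 subrr mulr0.
rewrite big_nat_recr //=; apply: le_trans (lerD IH (bound j)) _.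
by rewrite -mulrDr ler_wpM2l // exprS; lra.
Unshelve. all: by end_near.
Qed.

(** * Parseval's formula *)

Section MeanFubini.
Context d1 d2 (T1 : measurableType d1) (T2 : measurableType d2) (R : realType).
Variables (P : probability T1 R) (Q : probability T2 R) (f : T1 * T2 -> R).
Hypothesis bf : bmeas f.

Lemma bmeas_sect1 x : bmeas (fun y => f (x, y)).
Proof.
have [mf [M fM]] := bf; split; last by exists M.
by have := measurableT_comp mf (pair1_measurable x).
Qed.

Lemma bmeas_sect2 y : bmeas (fun x => f (x, y)).
Proof.
have [mf [M fM]] := bf; split; last by exists M.
by have := measurableT_comp mf (pair2_measurable y).
Qed.

Lemma bmeas_mean : bmeas (fun y => mean P (fun x => f (x, y))).
Proof.
have [_ [M fM]] := bf; split.
  apply: measurableT_comp; first exact: fine_measurable.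
  exact: (measurable_fubini_G (bmeas_int (P \x Q)%E bf)).
exists M => y; apply: le_trans (mean_norm P (bmeas_sect2 y)) _.
rewrite -[leRHS](mean_cst P); apply: mean_le => //.
  by apply: bmeas_norm; exact: bmeas_sect2.
exact: bmeas_cst.
Qed.

Lemma mean_fubini : mean P (fun x => mean Q (fun y => f (x, y))) =
  mean Q (fun y => mean P (fun x => f (x, y))).
Proof.
have := @Fubini _ _ _ _ _ P Q _ (bmeas_int (P \x Q)%E bf).
move=> E; rewrite /mean {1}/Rintegral [RHS]/Rintegral; congr fine.
transitivity (\int[P]_x \int[Q]_y (f (x, y))%:E)%E.
  by apply: eq_integral => x _; rewrite -[X in X%:E]/(mean Q _) EFin_mean //; exact: bmeas_sect1.
rewrite [LHS]E; apply: eq_integral => y _.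
by rewrite -[X in _ = X%:E]/(mean P _) EFin_mean //; exact: bmeas_sect2.
Qed.

End MeanFubini.

Section Parseval.
Variables (R : realType) (K : topFieldType) (abv ch sh : K -> R).
Hypothesis LF : local_field abv ch sh.
Variable V : vectType K.
Local Notation chv := (@chv R K ch V).
Local Notation shv := (@shv R K sh V).
Local Notation fsqr := (@fsqr R K ch sh V).
Local Notation fcos := (@fcos R K ch V).
Local Notation fsin := (@fsin R K sh V).
Implicit Types P Q : probability (borel V) R.

Lemma fcos_meas P : measurable_fun setT (fcos P : borel V -> R).
Proof.
apply: (measurable_fun_nrmR LF) => x e /(fcos_fsin_cont LF P)[d d0 dP].
by exists d => // y /dP[].
Qed.

Lemma fsin_meas P : measurable_fun setT (fsin P : borel V -> R).
Proof.
apply: (measurable_fun_nrmR LF) => x e /(fcos_fsin_cont LF P)[d d0 dP].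
by exists d => // y /dP[].
Qed.

(** [fsqr Q] is the Fourier transform of the difference of two independent
    vectors of law [Q].  Integrating first with respect to [P] leaves, up to a
    phase, the Fourier transform of [P] at this difference, bounded by [h]. *)
Lemma parseval_le P Q (h : borel V -> R) (J : R) (x0 : V) :
  bmeas h -> (forall z, 0 <= h z) -> (forall z : V, fsqr P z <= h z ^+ 2) ->
  (forall xi : V, mean Q (fun eta => h (xi - (eta : V))) <= J) ->
  mean P (fun y => fsqr Q ((y : V) - x0)) <= J.
Proof.
move=> bh h0 fh hJ.
have msub : measurable_fun setT (fun y : borel V => (y : V) - x0 : borel V).
  exact: (measurable_translate LF).
pose G (z : borel V * borel V) : R :=
  mean Q (fun eta => chv ((z.2 : V) - (eta : V)) ((z.1 : V) - x0)).
have GE z : G z = fcos Q ((z.1 : V) - x0) * chv z.2 ((z.1 : V) - x0) +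
                  fsin Q ((z.1 : V) - x0) * shv z.2 ((z.1 : V) - x0).
  rewrite mulrC [X in _ = _ + X]mulrC -(mean_comb LF).
  congr mean; apply/funext => eta; rewrite /chv /shv !(dotC (_ - x0)).
  by rewrite dotBl (chB LF).
have bG : bmeas G.
  have mz : measurable_fun setT (fun z : borel V * borel V => (z.2, (z.1 : V) - x0 : borel V)).
    apply: measurable_fun_pair; first exact: measurable_snd.
    exact: measurableT_comp msub measurable_fst.
  have m1 : measurable_fun setT (fun z : borel V * borel V => (z.1 : V) - x0 : borel V).
    exact: measurableT_comp msub measurable_fst.
  split.
    have -> : G = fun z => fcos Q ((z.1 : V) - x0) * chv z.2 ((z.1 : V) - x0) +
                  fsin Q ((z.1 : V) - x0) * shv z.2 ((z.1 : V) - x0).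
      exact/funext/GE.
    apply: measurable_funD; apply: measurable_funM.
    - exact: measurableT_comp (fcos_meas Q) m1.
    - exact: measurableT_comp (chv_meas2 LF (V := V)) mz.
    - exact: measurableT_comp (fsin_meas Q) m1.
    - exact: measurableT_comp (shv_meas2 LF (V := V)) mz.
  exists 2 => z; rewrite GE; apply: le_trans (ler_normD _ _) _; rewrite !normrM.
  have c1 : `|chv z.2 ((z.1 : V) - x0)| <= 1.
    by rewrite ler_norml (ch_le1 LF) (ch_geN1 LF).
  have s1 : `|shv z.2 ((z.1 : V) - x0)| <= 1.
    by rewrite ler_norml (sh_le1 LF) (sh_geN1 LF).
  rewrite -[leRHS]/(1 + 1 : R).
  by apply: lerD; apply: mulr_ile1 => //; [exact: (fcos_norm LF)|exact: (fsin_norm LF)].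
have -> : mean P (fun y => fsqr Q ((y : V) - x0)) = mean P (fun y => mean Q (fun xi => G (y, xi))).
  congr mean; apply/funext => y.
  transitivity (mean Q (fun xi => fcos Q ((y : V) - x0) * chv ((y : V) - x0) xi +
     fsin Q ((y : V) - x0) * shv ((y : V) - x0) xi)).
    by rewrite (mean_comb LF) /fsqr !expr2.
  congr mean; apply/funext => xi; rewrite GE /=.
  by rewrite /chv /shv !(dotC _ xi).
rewrite (mean_fubini P Q bG).
have bGm := bmeas_mean P Q bG.
apply: (@le_trans _ _ (mean Q (fun=> J))); last by rewrite mean_cst.
apply: mean_le => //; first exact: bmeas_cst.
move=> xi; apply: le_trans (hJ xi).
pose H (z : borel V * borel V) : R := chv ((xi : V) - (z.2 : V)) ((z.1 : V) - x0).
have bH : bmeas H.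
  split; last by exists 1 => z; rewrite ler_norml (ch_le1 LF) (ch_geN1 LF).
  have mz : measurable_fun setT (fun z : borel V * borel V =>
      ((xi : V) - (z.2 : V) : borel V, (z.1 : V) - x0 : borel V)).
    apply: measurable_fun_pair.
      exact: measurableT_comp (measurable_reflect LF xi) measurable_snd.
    exact: measurableT_comp msub measurable_fst.
  exact: measurableT_comp (chv_meas2 LF (V := V)) mz.
rewrite [leLHS](mean_fubini P Q bH).
have bHm := bmeas_mean P Q bH.
have bhx : bmeas (fun eta : borel V => h ((xi : V) - (eta : V))).
  have [mh [M hM]] := bh; split; last by exists M.
  exact: measurableT_comp mh (measurable_reflect LF xi).
apply: mean_le => // eta.
set zeta : V := xi - eta.
have -> : mean P (fun y => H (y, eta)) = ch (dot zeta x0) * fcos P zeta + sh (dot zeta x0) * fsin P zeta.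
  rewrite -(mean_comb LF); congr mean; apply/funext => y.
  by rewrite /H /chv /shv /= -/zeta dotBr (chB LF) mulrC [sh _ * _]mulrC.
have := fh zeta; rewrite /fsqr; have := ch2sh2 LF (dot zeta x0); have := h0 zeta.
move: (ch _) (sh _) (fcos _ _) (fsin _ _) (h zeta) => c s C S hh hh0 cs CS.
rewrite leNgt; apply/negP => lt.
have : hh ^+ 2 < (c * C + s * S) ^+ 2 by rewrite ltr_pXn2r ?nnegrE // (le_trans hh0) // ltW.
have -> : (c * C + s * S) ^+ 2 = (c ^+ 2 + s ^+ 2) * (C ^+ 2 + S ^+ 2) - (c * S - s * C) ^+ 2 by ring.
by rewrite cs mul1r; have := sqr_ge0 (c * S - s * C); lra.
Qed.

End Parseval.

(** * The mass of small balls *)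

Lemma mnormalizeE d (T : measurableType d) (R : realType)
    (m : {measure set T -> \bar R}) (P : probability T R) (v : R) X : 0 < v ->
  m setT = v%:E -> mnormalize m P X = (m X * v^-1%:E)%E.
Proof. by move=> v0 mv; rewrite /mnormalize mv eqe gt_eqF. Qed.

Section SmallBalls.
Variables (R : realType) (K : topFieldType) (abv ch sh : K -> R).
Hypothesis LF : local_field abv ch sh.
Variable V : vectType K.
Local Notation nrm := (@nrm R K abv V).
Local Notation nball r := ([set y : borel V | (nrm y < r)%R]).
Local Notation fsqr := (@fsqr R K ch sh V).
Local Notation fcos := (@fcos R K ch V).
Implicit Types P Q : probability (borel V) R.
Variable lam : {measure set (borel V) -> \bar R}.
Hypothesis hl : haar_measure lam.

(** The uniform law on a ball.  The Dirac mass is the default value of the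
    normalization, for balls of zero or infinite volume. *)
Definition ball_law (rho : R) : probability (borel V) R :=
  mnormalize (mrestr lam (measurable_ball0 LF (V := V) rho)) \d_((0 : V) : borel V).

Lemma ball_volE (rho : R) : 0 < rho ->
  exists2 v : R, 0 < v & lam (nball rho) = v%:E.
Proof.
move=> rho0; have p := haar_ball_gt0 LF hl rho0; have f := haar_ball_fin LF rho hl.
exists (fine (lam (nball rho))); last by rewrite fineK // ge0_fin_numE.
by apply: fine_gt0; rewrite p f.
Qed.

Lemma ball_lawE (rho v : R) X : 0 < v -> lam (nball rho) = v%:E ->
  ball_law rho X = (lam (X `&` nball rho) * v^-1%:E)%E.
Proof.
move=> v0 vE; apply: mnormalizeE => //; by rewrite -vE -[RHS]/(lam _) -[X in _ = lam X]setTI.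
Qed.

Lemma ball_law_le (rho v : R) (h : borel V -> R) : 0 < v -> lam (nball rho) = v%:E ->
  bmeas h -> (forall x, 0 <= h x) ->
  ((mean (ball_law rho) h)%:E <= v^-1%:E * \int[lam]_x (h x)%:E)%E.
Proof.
move=> v0 vE bh h0; rewrite EFin_mean //.
have vi : 0 <= v^-1 by rewrite invr_ge0 ltW.
have mh : measurable_fun setT (EFin \o h) by apply/measurable_EFinP; case: bh.
rewrite -[v^-1]/((NngNum vi)%:num) -ge0_integral_mscale //; last by move=> x _; rewrite lee_fin.
have h0E x : (0 <= (h x)%:E)%E by rewrite lee_fin.
apply: ge0_le_measure_integral => // X mX.
rewrite [leLHS](ball_lawE X v0 vE) /mscale /= muleC.
apply: lee_wpmul2l; first by rewrite lee_fin.
apply: le_measure; rewrite ?inE //.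
by apply: measurableI => //; exact: (measurable_ball0 LF).
Qed.

(** On the polar of a ball the character is at least [1/2] throughout the ball,
    and so is its mean. *)
Lemma ball_law_fsqr (rho e : R) (z : V) : 0 < rho ->
  (forall x y : V, nrm x < rho -> nrm y < e -> 2^-1 <= ch (dot x y)) ->
  nrm z < e -> 4^-1 <= fsqr (ball_law rho) z.
Proof.
move=> rho0 che ze; have [v v0 vE] := ball_volE rho0.
have half : 2^-1 <= fcos (ball_law rho) z.
  pose A := nball rho; have mA : measurable A by exact: (measurable_ball0 LF).
  have bA : bmeas (\1_A : borel V -> R) by exact: bmeas_indic.
  have QA : mean (ball_law rho) \1_A = 1.
    rewrite mean_indic // (ball_lawE _ v0 vE) setIid vE -EFinM /= divff //.
    by rewrite gt_eqF.
  (* A lower bound of [chv z], equal to [1/2] on the ball and [-1] off it. *)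
  rewrite (_ : 2^-1 = mean (ball_law rho) (fun x => (3 / 2) * \1_A x + (-1) * 1)).
    apply: mean_le; last move=> x.
    - apply: bmeasD; apply: bmeasZ => //; exact: bmeas_cst.
    - exact: (chv_bmeas LF).
    rewrite indicE; have [/set_mem xA|xA] := boolP (x \in A).
      by rewrite !mulr1; apply: le_trans (_ : 2^-1 <= _); [lra|rewrite /chv dotC; exact: che].
    by rewrite mulr0 add0r mulN1r; exact: (ch_geN1 LF).
  rewrite mean_lin2 //; last exact: bmeas_cst.
  by rewrite QA mean_cst; lra.
rewrite /fsqr; have := sqr_ge0 (fsin sh (ball_law rho) z).
have : 4^-1 <= fcos (ball_law rho) z ^+ 2.
  rewrite (_ : 4^-1 = 2^-1 ^+ 2 :> R); last by field.
  by apply: lerXn2r; rewrite ?nnegrE ?invr_ge0 // (le_trans _ half) ?invr_ge0.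
lra.
Qed.

(** [invariant_exchange] with both measures equal shows that the opposite of a
    set has the same measure. *)
Lemma haar_reflect (X : set (borel V)) (xi : V) : measurable X ->
  lam [set x : borel V | X (xi - (x : V))] = lam X.
Proof.
move=> mX; pose m := sigma_finite_pack (haar_sigma_finite LF hl).
have im : invariant m by case: (hl).
have mB := measurable_ball0 LF (V := V) 1.
have [v v0 vE] := ball_volE (@ltr01 R).
have mNX : measurable [set x : borel V | X (- (x : V))].
  rewrite (_ : [set x | _] = [set x : borel V | X (0 - (x : V))]).
    by apply: measurable_preim => //; exact: (measurable_reflect LF).
  by apply/seteqP; split=> x /=; rewrite sub0r.
have := invariant_exchange LF im im mX mB.
rewrite -![m _]/(lam _) vE => /(congr1 (fun z => z * v^-1%:E)%E).
rewrite -!muleA -!EFinM divff ?gt_eqF // !mule1 => ->.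
transitivity (m [set x : borel V | X (- ((x : V) + - xi))]); last exact: (im (- xi) _ mNX).
rewrite -[LHS]/(lam _) -[RHS]/(lam _); congr (lam _).
by apply/seteqP; split=> x /=; rewrite opprB.
Qed.

Lemma integral_reflect (h : borel V -> R) (xi : V) : measurable_fun setT h ->
  (forall x, 0 <= h x) ->
  (\int[lam]_x (h (xi - (x : V)))%:E = \int[lam]_x (h x)%:E)%E.
Proof.
move=> mh h0; have mr := measurable_reflect LF xi.
have mhE : measurable_fun setT (fun x => (h x)%:E) by exact/measurable_EFinP.
have := @ge0_integral_pushforward _ _ _ _ _ _ mr lam setT _ measurableT mhE.
rewrite preimage_setT => <-; last by move=> x _; rewrite lee_fin.
by apply: eq_measure_integral => X mX _; exact: haar_reflect.
Qed.

(** Parseval's formula for the uniform law on the ball of radius [rho], the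
    transform of which has squared modulus at least [1/4] on the ball of radius
    [e]. *)
Lemma small_ball P (h : borel V -> R) (J rho e : R) (x0 : V) : 0 < rho ->
  (forall x y : V, nrm x < rho -> nrm y < e -> 2^-1 <= ch (dot x y)) ->
  bmeas h -> (forall z, 0 <= h z) -> (forall z : V, fsqr P z <= h z ^+ 2) ->
  (\int[lam]_x (h x)%:E <= J%:E)%E ->
  (P [set y : borel V | (nrm ((y : V) - x0) < e)%R] * lam (nball rho) <= (4 * J)%:E)%E.
Proof.
move=> rho0 che bh h0 fh hJ; have [v v0 vE] := ball_volE rho0.
have [mh [M hM]] := bh.
have brx (xi : V) : bmeas (fun x : borel V => h (xi - (x : V))).
  split; last by exists M.
  exact: measurableT_comp mh (measurable_reflect LF xi).
have key : mean P (fun y => fsqr (ball_law rho) ((y : V) - x0)) <= v^-1 * J.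
  apply: (parseval_le LF (h := h)) => // xi; rewrite -lee_fin.
  apply: le_trans (ball_law_le v0 vE (brx xi) _) _ => //.
  rewrite integral_reflect // EFinM lee_pmul2l //.
  by rewrite lte_fin invr_gt0.
pose E := [set y : borel V | nrm ((y : V) - x0) < e].
have mE : measurable E by exact: (measurable_ball LF).
have bE : bmeas (\1_E : borel V -> R) by exact: bmeas_indic.
have bfu : bmeas (fun y : borel V => fsqr (ball_law rho) ((y : V) - x0)).
  split.
    exact: measurableT_comp (fsqr_meas LF (ball_law rho)) (measurable_translate LF (- x0)).
  by exists 1 => y; rewrite ger0_norm ?fsqr_ge0 ?(fsqr_le1 LF).
have : mean P (fun y => 4^-1 * \1_E y) <= v^-1 * J.
  apply: le_trans key; apply: mean_le => //; first exact: bmeasZ.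
  move=> y; rewrite indicE; have [/set_mem yE|yE] := boolP (y \in E).
    by rewrite mulr1; apply: ball_law_fsqr che _.
  by rewrite mulr0; exact: fsqr_ge0.
rewrite meanZ // mean_indic // -/E vE => h1.
have PE : P E = (fine (P E))%:E by rewrite fineK // fin_num_measure.
rewrite PE -EFinM lee_fin.
have : 4^-1 * fine (P E) * v <= v^-1 * J * v by rewrite ler_wpM2r // ltW.
rewrite [v^-1 * J]mulrC divfK ?gt_eqF //; lra.
Qed.

(** A homothety of ratio [w ^+ j] shrinks a ball and expands its polar, by
    reciprocal factors on volumes: the product of the volumes does not depend on
    [j], so [small_ball] bounds the mass by the volume. *)
Lemma small_ball_le P (h : borel V -> R) (J : R) :
  bmeas h -> (forall z, 0 <= h z) -> (forall z : V, fsqr P z <= h z ^+ 2) ->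
  (\int[lam]_x (h x)%:E <= J%:E)%E ->
  exists2 C : R, 0 <= C & forall eps : R, 0 < eps -> exists2 e, 0 < e < eps &
    forall x0 : V, (P [set y : borel V | (nrm ((y : V) - x0) < e)%R] <=
      C%:E * lam (nball e))%E.
Proof.
move=> bh h0 fh hJ; have [w w0 w1] := abv_small LF.
have wK : w != 0 by apply: contraTneq w0 => ->; rewrite (abv0 LF) ltxx.
have J0 : 0 <= J.
  by rewrite -lee_fin; apply: le_trans hJ; apply: integral_ge0 => x _; rewrite lee_fin.
have half0 : 0 < 2^-1 :> R by rewrite invr_gt0.
have [r r0 rP] := ch_cont0 LF half0.
have lw : linear (fun x : V => w *: x) by move=> a x y; rewrite scalerDr !scalerA mulrC.
have lw' : linear (fun x : V => w^-1 *: x) by move=> a x y; rewrite scalerDr !scalerA mulrC.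
have [delta d0 dP] := haar_modulus LF hl lw lw' (scalerK wK) (scalerKV wK).
have [v v0 vE] := ball_volE (@ltr01 R); have [v' v'0 v'E] := ball_volE r0.
have big j : lam (nball (abv w ^- j)) = (delta ^+ j * v)%:E.
  elim: j => [|j IH]; first by rewrite !expr0 invr1 mul1r.
  rewrite [delta ^+ _]exprS -mulrA EFinM -IH -dP; last exact: (measurable_ball0 LF).
  congr (lam _); apply/seteqP; split=> x /=;
    by rewrite (nrmZ LF) exprS invfM -ltr_pdivlMl.
have small j : lam (nball (r * abv w ^+ j)) = (delta ^- j * v')%:E.
  elim: j => [|j IH]; first by rewrite !expr0 invr1 mul1r mulr1.
  have := dP _ (measurable_ball0 LF (V := V) (r * abv w ^+ j.+1)).
  rewrite (_ : [set x | _] = nball (r * abv w ^+ j)); last first.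
    by apply/seteqP; split=> x /=; rewrite (nrmZ LF) exprS mulrCA ltr_pM2l.
  rewrite IH => /(congr1 (fun z => delta^-1%:E * z)%E).
  rewrite muleA -!EFinM mulVf ?gt_eqF // mul1e => <-.
  by rewrite mulrA -invfM -exprS.
exists (4 * J / (v * v')) => [|eps eps0].
  by rewrite divr_ge0 ?mulr_ge0 // ltW.
have [j jP] : exists j, r * abv w ^+ j < eps.
  have er : 0 < eps / r by rewrite divr_gt0.
  have /cvgrPdist_lt/(_ _ er)[k _ kP] : abv w ^+ m @[m --> \oo] --> (0 : R).
    by apply: cvg_expr; rewrite ger0_norm // ltW.
  exists k; have := kP k (leqnn k).
  rewrite /= sub0r normrN ger0_norm ?exprn_ge0 ?(ltW w0) //.
  by rewrite ltr_pdivlMr // mulrC.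
have wj : 0 < abv w ^+ j by rewrite exprn_gt0.
exists (r * abv w ^+ j); first by rewrite jP andbT mulr_gt0.
move=> x0; have := @small_ball P h J (abv w ^- j) (r * abv w ^+ j) x0.
rewrite invr_gt0 wj => /(_ isT) /(_ _ bh h0 fh hJ) h1.
have {h1} := h1 _.
have che (x y : V) : nrm x < abv w ^- j -> nrm y < r * abv w ^+ j -> 2^-1 <= ch (dot x y).
  move=> xl yl; have : abv (dot x y) < r.
    apply: le_lt_trans (abv_dot LF _ _) _.
    have [nx|nx] := eqVneq (nrm x) 0; first by rewrite nx mul0r.
    have nx0 : 0 < nrm x by rewrite lt_def nx (nrm_ge0 LF).
    apply: (@lt_trans _ _ (nrm x * (r * abv w ^+ j))); first by rewrite ltr_pM2l.
    rewrite mulrCA gtr_pMr // -ltr_pdivlMr //; rewrite div1r //.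
  by move=> /rP; lra.
move=> /(_ che); rewrite big small.
set p := P _; have pf : p \is a fin_num by rewrite fin_num_measure //; exact: (measurable_ball LF).
rewrite -(fineK pf) -!EFinM !lee_fin => h1.
have dj : 0 < delta ^+ j by rewrite exprn_gt0.
have -> : 4 * J / (v * v') * (delta ^- j * v') = 4 * J / (delta ^+ j * v).
  by field; rewrite !gt_eqF.
by rewrite ler_pdivlMr // mulr_gt0.
Qed.

End SmallBalls.

(** * Regularity and domination by the Haar measure *)

Section Domination.
Variables (R : realType) (K : topFieldType) (abv ch sh : K -> R).
Hypothesis LF : local_field abv ch sh.
Variable V : vectType K.
Local Notation nrm := (@nrm R K abv V).
Local Notation nball r := ([set y : borel V | (nrm y < r)%R]).
Local Notation nopen := (@nrm_open R K abv V).

Definition erosion (U : set V) (e : R) : set V :=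
  [set y | forall z, nrm (z - y) < e -> U z].

Lemma erosion_closed U e : nopen (~` erosion U e).
Proof.
move=> y /= /existsNP[z /not_implyP[zy Uz]].
exists (e - nrm (z - y)); first by rewrite subr_gt0.
move=> y' y'y /(_ z); apply/not_implyP; split => //.
have := nrm_triangle LF y z y'; rewrite (nrmC LF y y'); lra.
Qed.

Lemma measurable_erosion U e : measurable (erosion U e : set (borel V)).
Proof.
rewrite -[X in measurable X]setCK; apply: measurableC.
by apply: (nrm_open_measurable LF); exact: erosion_closed.
Qed.

Lemma erosion_sub U e : 0 < e -> erosion U e `<=` U.
Proof. by move=> e0 y; apply; rewrite subrr (nrm0 LF). Qed.

Lemma erosion_le U e e' : e <= e' -> erosion U e' `<=` erosion U e.
Proof. by move=> ee y h z zy; apply: h; exact: lt_le_trans ee. Qed.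

Lemma erosion_bigcup U : nopen U -> \bigcup_k erosion U k.+1%:R^-1 = U.
Proof.
move=> oU; apply/seteqP; split=> [y [k _]|y Uy].
  by apply: erosion_sub; rewrite invr_gt0.
have [e e0 eU] := oU y Uy; exists (Num.truncn e^-1) => // z zy; apply: eU.
apply: lt_trans zy _; rewrite invf_plt ?posrE //.
exact: Num.Theory.truncnS_gt.
Qed.

Lemma erosion_cvg (m : {measure set (borel V) -> \bar R}) U : nopen U ->
  m (erosion U k.+1%:R^-1) @[k --> \oo] --> m U.
Proof.
move=> oU; rewrite -[in m U](erosion_bigcup oU).
apply: (nondecreasing_cvg_mu (F := fun k => erosion U k.+1%:R^-1 : set (borel V))).
- by move=> k; exact: measurable_erosion.
- by rewrite erosion_bigcup //; exact: (nrm_open_measurable LF).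
- move=> i j ij; apply/subsetPset; apply: erosion_le.
  by rewrite lef_pV2 ?posrE // ler_nat ltnS.
Qed.

Lemma nrm_openI U W : nopen U -> nopen W -> nopen (U `&` W).
Proof.
move=> oU oW x [/oU[e e0 eU] /oW[d d0 dW]].
exists (Num.min e d) => [|y]; first by rewrite lt_min e0.
by rewrite lt_min => /andP[ye yd]; split; [exact: eU|exact: dW].
Qed.

Lemma nrm_open_bigcup (F : nat -> set V) : (forall k, nopen (F k)) ->
  nopen (\bigcup_k F k).
Proof.
move=> oF x [k _ Fx]; have [e e0 eF] := oF k x Fx.
by exists e => // y /eF Fy; exists k.
Qed.

(** Regularity of a finite measure: the class of sets squeezed between a closed
    and an open set of almost the same measure is a sigma-algebra. *)
Definition squeezed (m : {measure set (borel V) -> \bar R}) (X : set (borel V)) :=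
  forall e : R, 0 < e -> exists F U : set V, [/\ nopen (~` F), nopen U,
    F `<=` X, X `<=` U & (m (U `\` F) < e%:E)%E].

Lemma measureD_lt (m : {measure set (borel V) -> \bar R}) (X Y : set (borel V)) (e : R) :
  (m setT < +oo)%E -> measurable X -> measurable Y -> Y `<=` X ->
  `|fine (m X) - fine (m Y)| < e -> (m (X `\` Y) < e%:E)%E.
Proof.
move=> fm mX mY YX h.
have fin Z : measurable Z -> m Z \is a fin_num.
  move=> mZ; rewrite ge0_fin_numE //; apply: le_lt_trans fm.
  by apply: le_measure; rewrite ?inE.
have mD : measurable (X `\` Y) by exact: measurableD.
have /(congr1 fine) : m X = (m (X `\` Y) + m Y)%E.
  rewrite -measureU //; last by rewrite setDE -setIA setICl setI0.
  by congr (m _); rewrite setUC setDUK.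
rewrite fineD ?fin // => E.
rewrite -(fineK (fin _ mD)) lte_fin; apply: le_lt_trans h.
by rewrite E addrK ler_norm.
Qed.

Lemma erosion_approx (m : {measure set (borel V) -> \bar R}) (U : set V) (e : R) :
  (m setT < +oo)%E -> nopen U -> 0 < e ->
  exists k, `|fine (m U) - fine (m (erosion U k.+1%:R^-1))| < e.
Proof.
move=> fm oU e0; have mU := nrm_open_measurable LF oU.
have fU : m U \is a fin_num.
  rewrite ge0_fin_numE //; apply: le_lt_trans fm.
  by apply: le_measure; rewrite ?inE.
have := @erosion_cvg m U oU; rewrite -(fineK fU) => /fine_cvgP[_].
move=> /cvgrPdist_lt/(_ e e0)[k _ /(_ k (leqnn k)) /= h].
by exists k.
Qed.

Lemma squeezed_open (m : {measure set (borel V) -> \bar R}) (U : set V) :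
  (m setT < +oo)%E -> nopen U -> squeezed m U.
Proof.
move=> fm oU e e0; have [k h] := erosion_approx fm oU e0.
exists (erosion U k.+1%:R^-1), U; split => //.
- exact: erosion_closed.
- by apply: erosion_sub; rewrite invr_gt0.
apply: measureD_lt => //; first exact: (nrm_open_measurable LF).
  exact: measurable_erosion.
by apply: erosion_sub; rewrite invr_gt0.
Qed.

Lemma squeezedC m X : squeezed m X -> squeezed m (~` X).
Proof.
move=> sX e /sX[F [U [oF oU FX XU FU]]]; exists (~` U), (~` F).
split; rewrite ?setCK //; try exact: subsetC.
by rewrite setDE setCK setIC -setDE.
Qed.

Lemma squeezed_bigcup (m : {measure set (borel V) -> \bar R}) (X : nat -> set (borel V)) :
  (m setT < +oo)%E -> (forall k, squeezed m (X k)) -> squeezed m (\bigcup_k X k).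
Proof.
move=> fm sX e e0.
have e20 : 0 < e / 2 by rewrite divr_gt0.
have pos k : 0 < (e / 2 / (2 ^ k.+1)%:R) by rewrite divr_gt0 // ltr0n expn_gt0.
have /choice[FU FUP] k : exists FU : set V * set V,
    [/\ nopen (~` FU.1), nopen FU.2, FU.1 `<=` X k, X k `<=` FU.2 &
     (m (FU.2 `\` FU.1) < (e / 2 / (2 ^ k.+1)%:R)%:E)%E].
  by have [F [U h]] := sX k _ (pos k); exists (F, U).
have mF k : measurable ((FU k).1 : set (borel V)).
  rewrite -[X in measurable X]setCK; apply: measurableC.
  by apply: (nrm_open_measurable LF); case: (FUP k).
have mU k : measurable ((FU k).2 : set (borel V)).
  by apply: (nrm_open_measurable LF); case: (FUP k).
have fin Y : measurable Y -> m Y \is a fin_num.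
  move=> mY; rewrite ge0_fin_numE //; apply: le_lt_trans fm.
  by apply: le_measure; rewrite ?inE.
pose G j : set (borel V) := \bigcup_(k < j) (FU k).1.
pose Ginf : set (borel V) := \bigcup_k (FU k).1.
pose U : set (borel V) := \bigcup_k (FU k).2.
have mG j : measurable (G j) by apply: bigcup_measurable => k _.
have mGi : measurable Ginf by apply: bigcupT_measurable.
have mUU : measurable U by apply: bigcupT_measurable.
have GGi j : G j `<=` Ginf by move=> x [k _ Fx]; exists k.
have h1 : (m (U `\` Ginf) <= (e / 2)%:E)%E.
  apply: (@le_trans _ _ (\sum_(0 <= k <oo) m ((FU k).2 `\` (FU k).1))%E).
    apply: measure_sigma_subadditive.
    - by move=> k; exact: measurableD.
    - exact: measurableD.
    - move=> x [[k _ Ux] nF]; exists k => //; split=> // Fx.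
      by apply: nF; exists k.
  apply: (@le_trans _ _ (\sum_(0 <= k <oo) (e / 2 / (2 ^ k.+1)%:R)%:E)%E).
    by apply: lee_nneseries => // k _; have [_ _ _ _ h] := FUP k; exact: ltW h.
  exact: (epsilon_trick0 xpredT (ltW e20)).
have cG : m (G j) @[j --> \oo] --> m Ginf.
  rewrite (_ : Ginf = \bigcup_j G j); last first.
    apply/seteqP; split=> [x [k _ Fx]|x [j _ /GGi//]].
    by exists k.+1 => //; exists k => //=.
  apply: nondecreasing_cvg_mu => //; first by apply: bigcupT_measurable.
  move=> i j ij; apply/subsetPset => x [k /= ki Fx]; exists k => //=.
  exact: leq_trans ki ij.
move: cG; rewrite -(fineK (fin _ mGi)) => /fine_cvgP[_].
move=> /cvgrPdist_lt/(_ _ e20)[j _ /(_ j (leqnn j)) /=] hj.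
exists (G j), U; split.
- rewrite /G setC_bigcup => x hx.
  have [d d0 dP] : exists2 d : R, 0 < d & forall k, (k < j)%N -> forall y,
      nrm (y - x) < d -> ~ (FU k).1 y.
    elim: (j) hx => [|i IH] hx; first by exists 1.
    have [|d d0 dP] := IH; first by move=> k /= ki; apply: hx => /=; exact: ltnW.
    have [oF _ _ _ _] := FUP i.
    have [d' d'0 d'P] := oF x (hx i (ltnSn i)).
    exists (Num.min d d') => [|k ki y]; first by rewrite lt_min d0.
    rewrite lt_min => /andP[yd yd'].
    move: ki; rewrite ltnS leq_eqVlt => /predU1P[->|ki]; first exact: d'P.
    exact: dP yd.
  by exists d => // y yd k /= kj; exact: dP yd.
- by apply: nrm_open_bigcup => k; case: (FUP k).
- by move=> x [k _ Fx]; exists k => //; case: (FUP k) => _ _ + _ _; exact.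
- by move=> x [k _ Xx]; exists k => //; case: (FUP k) => _ _ _ + _; exact.
have sub : U `\` G j `<=` (U `\` Ginf) `|` (Ginf `\` G j).
  move=> x [Ux nG]; have [xGi|nGi] := pselect (Ginf x); [right|left]; by split.
apply: (@le_lt_trans _ _ (m (U `\` Ginf) + m (Ginf `\` G j))%E).
  apply: le_trans (le_measure _ _ _ sub) (measureU2 _ _ _).
  - by rewrite inE; exact: measurableD.
  - by rewrite inE; apply: measurableU; exact: measurableD.
  - exact: measurableD.
  - exact: measurableD.
rewrite [e in (e%:E)%E]splitr EFinD; apply: lee_ltD => //.
  by rewrite fin //; exact: measurableD.
exact: measureD_lt.
Qed.

Lemma squeezed_measurable (m : {measure set (borel V) -> \bar R}) (X : set (borel V)) :
  (m setT < +oo)%E -> measurable X -> squeezed m X.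
Proof.
move=> fm; apply: smallest_sub; last first.
  by move=> U /(open_nrmP LF); exact: squeezed_open.
split.
- by apply: squeezed_open => // x [].
- by move=> Y sY; rewrite setTD; exact: squeezedC.
- by move=> Y sY; exact: squeezed_bigcup.
Qed.

Lemma measure_bigcup_le (m : {measure set (borel V) -> \bar R})
    (F : nat -> set (borel V)) (c : \bar R) : (forall k, measurable (F k)) ->
  (forall i j, (i <= j)%N -> F i `<=` F j) -> (forall k, m (F k) <= c)%E ->
  (m (\bigcup_k F k) <= c)%E.
Proof.
move=> mF hF Fc; have cv : m \o F @ \oo --> m (\bigcup_k F k).
  apply: nondecreasing_cvg_mu => //; first exact: bigcupT_measurable.
  by move=> i j ij; apply/subsetPset; exact: hF.
rewrite -(cvg_lim (@ereal_hausdorff R) cv); apply: lime_le.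
  by apply: cvgP cv.
by apply: nearW => k; exact: Fc.
Qed.

Variable lam : {measure set (borel V) -> \bar R}.
Hypothesis hl : haar_measure lam.
Variables (P : probability (borel V) R) (C : R).
Hypothesis C0 : 0 <= C.
Hypothesis PC : forall eps : R, 0 < eps -> exists2 e, 0 < e < eps &
  forall x0 : V, (P [set y : borel V | (nrm ((y : V) - x0) < e)%R] <=
      C%:E * lam (nball e))%E.

(** Averaging the bound on balls over their centers: by Tonelli, the volume of a
    ball times the mass of the [e]-erosion of [U] is the integral over the
    center [x] of the mass of the part of the ball at [x] that lies in the
    erosion, and this part is empty unless [x] is in [U]. *)
Lemma open_dominated U : nopen U -> (P U <= C%:E * lam U)%E.
Proof.
move=> oU; have mU := nrm_open_measurable LF oU.
rewrite -[in leLHS](erosion_bigcup oU); apply: measure_bigcup_le => [k|i j ij|k].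
- exact: measurable_erosion.
- by apply: erosion_le; rewrite lef_pV2 ?posrE // ler_nat ltnS.
have k0 : 0 < k.+1%:R^-1 :> R by rewrite invr_gt0.
have [e /andP[e0 ek] eP] := PC k0.
pose S : set (borel V) := erosion U e; have mS : measurable S by exact: measurable_erosion.
apply: (@le_trans _ _ (P S)).
  by apply: le_measure; rewrite ?inE //; [exact: measurable_erosion|apply: erosion_le; exact: ltW].
have [v v0 vE] := ball_volE LF hl e0.
pose W := [set z : borel V * borel V | S z.1 /\ (nball e) ((z.1 : V) - (z.2 : V))].
have mW : measurable W.
  apply: measurableI.
    by rewrite -[X in measurable X]setTI; apply: measurable_fst.
  exact: (measurable_preim2 (measurable_sub LF (V := V)) (measurable_ball0 LF e)).
pose m := sigma_finite_pack (haar_sigma_finite LF hl).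
have im : invariant m by case: (hl).
have E := tonelli_set P m mW.
have EL : (\int[P]_y m [set x | W (y, x)] = v%:E * P S)%E.
  rewrite -integral_restrict_cst //; apply: eq_integral => y _.
  case: ifPn => [/set_mem Sy|/negP nSy]; last first.
    rewrite (_ : [set x | _] = set0) ?measure0 //.
    by apply/seteqP; split=> x //= -[Sy _]; apply: nSy; rewrite inE.
  rewrite -vE -[lam _]/(m _) -(im (- y) _ (measurable_ball0 LF e)); congr (m _).
  apply/seteqP; split=> x /=; first by move=> [_]; rewrite (nrmC LF).
  by rewrite (nrmC LF).
have ER : (\int[m]_x P [set y | W (y, x)] <= (C%:E * v%:E) * m U)%E.
  rewrite -integral_restrict_cst //; apply: ge0_le_integral => //.
  - rewrite (_ : (fun x => _) = P \o ysection W).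
      rewrite -indic_fubini_tonelli_GE //.
      exact: indic_measurable_fun_fubini_tonelli_G.
    by apply/funext => x /=; rewrite ysectionE.
  - apply: measurable_fun_ifT => //.
    by apply: (measurable_fun_bool true); rewrite setTI; rewrite (_ : _ @^-1` _ = U) //;
      apply/seteqP; split=> x /=; [exact: set_mem|exact: mem_set].
  move=> x _; case: ifPn => [xU|nU].
    rewrite -vE; apply: le_trans (eP x); apply: le_measure; rewrite ?inE.
    - have -> : [set y | W (y, x)] = ysection W x by rewrite ysectionE.
      exact: measurable_ysection.
    - exact: (measurable_ball LF).
    - by move=> y [_].
  rewrite (_ : [set y | _] = set0) ?measure0 //.
  apply/seteqP; split=> y //= -[Sy yx]; move/negP: nU; apply.
  by rewrite inE; apply: Sy; rewrite (nrmC LF).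
move: ER; rewrite -E EL => h.
have : (v^-1%:E * (v%:E * P S) <= v^-1%:E * (C%:E * v%:E * lam U))%E.
  by apply: lee_wpmul2l => //; rewrite lee_fin invr_ge0 ltW.
rewrite [(C%:E * _)%E]muleC !muleA -!EFinM mulVf ?gt_eqF // mul1e mul1r //.
Qed.

(** On bounded sets [lam] is finite, hence outer regular: the bound passes from
    open sets to Borel sets. *)
Lemma dominated (B : set (borel V)) : measurable B -> (P B <= C%:E * lam B)%E.
Proof.
move=> mB; pose F k := B `&` nball k%:R.
have mF k : measurable (F k).
  by apply: measurableI => //; exact: (measurable_ball0 LF).
rewrite -[in leLHS](_ : \bigcup_k F k = B); last first.
  apply/seteqP; split=> [x [k _ []]//|x Bx].
  exists (Num.truncn (nrm x)).+1 => //; split => //=; exact: Num.Theory.truncnS_gt.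
apply: measure_bigcup_le => // [i j ij x [Bx /= xi]|k].
  by split => //=; apply: lt_le_trans xi _; rewrite ler_nat.
apply: (@le_trans _ _ (C%:E * lam (F k))%E); last first.
  by apply: lee_wpmul2l; rewrite ?lee_fin //; apply: le_measure; rewrite ?inE //; move=> x [].
pose mN := measurable_ball0 LF (V := V) k%:R.
pose tau : {measure set (borel V) -> \bar R} := mrestr lam mN.
have ftau : (tau setT < +oo)%E.
  by rewrite -[tau setT]/(lam _) setTI; exact: (haar_ball_fin LF).
have fin X : measurable X -> tau X \is a fin_num.
  move=> mX; rewrite ge0_fin_numE //; apply: le_lt_trans ftau.
  by apply: le_measure; rewrite ?inE.
have tauF : tau (F k) = lam (F k).
  by rewrite -[LHS]/(lam _) -setIA setIid.
rewrite -tauF; apply/lee_addgt0Pr => e e0.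
(* [1 + C] and not [C], which may vanish. *)
have e'0 : 0 < e / (1 + C) by rewrite divr_gt0 // ltr_pwDl.
have [G [U [oG oU GF FU lt]]] := squeezed_measurable ftau (mF k) e'0.
have oN : nopen (nball k%:R).
  move=> x /= xk; exists (k%:R - nrm x) => [|y]; first by rewrite subr_gt0.
  by rewrite ltrBrDr => h; have := nrmD LF (y - x) x; rewrite subrK; lra.
have mU := nrm_open_measurable LF oU.
have mG : measurable (G : set (borel V)).
  by rewrite -[X in measurable X]setCK; apply: measurableC; apply: (nrm_open_measurable LF).
have mUG : measurable ((U `\` G) : set (borel V)) by exact: measurableD.
have oUN := nrm_openI oU oN.
apply: (@le_trans _ _ (P (U `&` nball k%:R))).
  apply: le_measure; rewrite ?inE //; first exact: (nrm_open_measurable LF).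
  by move=> x Fx; split; [exact: FU|case: Fx].
apply: (le_trans (open_dominated oUN)); rewrite -[lam _]/(tau U).
have UE : (tau U <= tau (F k) + (e / (1 + C))%:E)%E.
  apply: (@le_trans _ _ (tau (F k) + tau (U `\` G))%E); last by rewrite leeD2l // ltW.
  apply: le_trans (measureU2 tau (mF k) mUG).
  apply: le_measure; rewrite ?inE //; first exact: measurableU.
  by move=> x Ux; have [Gx|nGx] := pselect (G x); [left; exact: GF|right].
apply: (@le_trans _ _ (C%:E * (tau (F k) + (e / (1 + C))%:E))%E).
  by apply: lee_wpmul2l.
rewrite -(fineK (fin _ (mF k))) -EFinD -!EFinM -EFinD lee_fin mulrDr lerD2l.
by rewrite mulrA ler_pdivrMr ?ltr_pwDl // mulrC ler_pM2l // lerDr.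
Qed.

End Domination.

(** * Continuity of smoothed functions *)

Section Density.
Variables (R : realType) (K : topFieldType) (abv ch sh : K -> R).
Hypothesis LF : local_field abv ch sh.
Variable V : vectType K.
Local Notation nrm := (@nrm R K abv V).
Local Notation nball r := ([set y : borel V | (nrm y < r)%R]).
Local Notation nopen := (@nrm_open R K abv V).
Variable lam : {measure set (borel V) -> \bar R}.
Hypothesis hl : haar_measure lam.

Definition shift_mass (Q : probability (borel V) R) (X : set (borel V)) (x : V) : R :=
  fine (Q [set y : borel V | X (x - (y : V))]).

Lemma shift_meas (X : set (borel V)) (x : V) : measurable X ->
  measurable [set y : borel V | X (x - (y : V))].
Proof. by move=> mX; apply: measurable_preim => //; exact: (measurable_reflect LF). Qed.

Lemma prob_le2 (Q : probability (borel V) R) (X Y Z : set (borel V)) :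
  measurable X -> measurable Y -> measurable Z -> X `<=` Y `|` Z ->
  fine (Q X) <= fine (Q Y) + fine (Q Z).
Proof.
move=> mX mY mZ XYZ; rewrite -fineD ?fin_num_measure //.
apply: fine_le; rewrite ?fin_numD ?fin_num_measure //.
apply: le_trans (measureU2 Q mY mZ).
by apply: le_measure; rewrite ?inE //; exact: measurableU.
Qed.

Lemma shift_mass_le Q (X Y : set (borel V)) x : measurable X -> measurable Y ->
  X `<=` Y -> shift_mass Q X x <= shift_mass Q Y x.
Proof.
move=> mX mY XY; apply: fine_le; rewrite ?fin_num_measure //; try exact: shift_meas.
by apply: le_measure; rewrite ?inE; [exact: shift_meas|exact: shift_meas|move=> y /=; exact: XY].
Qed.

Lemma shift_massC Q (X : set (borel V)) x : measurable X ->
  shift_mass Q (~` X) x = 1 - shift_mass Q X x.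
Proof.
move=> mX; rewrite /shift_mass.
rewrite (_ : [set y | _] = ~` [set y : borel V | X (x - (y : V))]) //.
rewrite probability_setC; last exact: shift_meas.
by rewrite fineB ?fin_num_measure //; exact: shift_meas.
Qed.

(** A displacement shorter than [e] moves the [e]-erosion of [U] inside [U], and
    the erosions of an open [U] exhaust its mass. *)
Lemma shift_mass_lsc Q U (x0 : V) (e : R) : nopen U -> 0 < e ->
  exists2 d, 0 < d & forall x, nrm (x - x0) < d ->
    shift_mass Q U x0 - e < shift_mass Q U x.
Proof.
move=> oU e0; pose Q' := push_prob Q (measurable_reflect LF x0).
have mU := nrm_open_measurable LF oU.
have fQ : (Q' setT < +oo)%E by rewrite probability_setT ltry.
have [k h] := erosion_approx LF fQ oU e0.
have k0 : 0 < k.+1%:R^-1 :> R by rewrite invr_gt0.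
exists k.+1%:R^-1 => // x xx0.
have h1 : fine (Q' U) - e < fine (Q' (erosion abv U k.+1%:R^-1)).
  by move: h; rewrite ltr_norml => /andP[_]; rewrite ltrBlDr => h; rewrite ltrBlDr addrC.
apply: lt_le_trans h1 _; apply: fine_le.
- by rewrite fin_num_measure //; exact: (measurable_erosion LF).
- by rewrite fin_num_measure //; exact: shift_meas.
rewrite -[leLHS]/(Q _); apply: le_measure; rewrite ?inE.
- by apply: shift_meas; exact: (measurable_erosion LF).
- exact: shift_meas.
- move=> y /= /(_ (x - y)); apply.
  by rewrite opprB addrA subrK.
Qed.

Variables (C : R) (C0 : 0 <= C).

(** [X] is squeezed between a closed [F] and an open [U].  The masses are upper
    semicontinuous for [F] and lower semicontinuous for [U]; the domination of
    [Q] makes the mass of [x - (U \ F)] small uniformly in [x], up to the mass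
    of a neighborhood of infinity. *)
Lemma shift_mass_cont (Q : probability (borel V) R) (X : set (borel V)) (x0 : V) (e : R) :
  (forall B, measurable B -> Q B <= C%:E * lam B)%E -> measurable X -> 0 < e ->
  exists2 d, 0 < d & forall x, nrm (x - x0) < d ->
    `|shift_mass Q X x - shift_mass Q X x0| < e.
Proof.
move=> QC mX e0; have e40 : 0 < e / 4 by rewrite divr_gt0.
have [M M0 MQ] := tail LF Q e40.
pose rad := M + nrm x0 + 1.
pose mN := measurable_ball0 LF (V := V) rad.
pose tau : {measure set (borel V) -> \bar R} := mrestr lam mN.
have ftau : (tau setT < +oo)%E.
  by rewrite -[tau setT]/(lam _) setTI; exact: (haar_ball_fin LF).
have e'0 : 0 < e / 4 / (1 + C) by rewrite divr_gt0 // ltr_pwDl.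
have [F [U [oF oU FX XU lt]]] := squeezed_measurable LF ftau mX e'0.
have mU : measurable (U : set (borel V)) by exact: (nrm_open_measurable LF).
have mF : measurable (F : set (borel V)).
  by rewrite -[X in measurable X]setCK; apply: measurableC; apply: (nrm_open_measurable LF).
have gap x : nrm (x - x0) < 1 -> shift_mass Q U x <= shift_mass Q F x + e / 2.
  move=> xx0; have mUF : measurable ((U `\` F) : set (borel V)) by exact: measurableD.
  pose T := [set y : borel V | M <= nrm y].
  have mT : measurable T.
    rewrite (_ : T = ~` nball M); first by apply: measurableC; exact: (measurable_ball0 LF).
    by apply/seteqP; split=> y /=; rewrite /T /= leNgt => /negP.
  pose W := (U `\` F) `&` nball rad.
  have mW : measurable (W : set (borel V)) by exact: measurableI.
  pose Z := [set y : borel V | W (x - (y : V))].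
  have mZ : measurable Z by exact: shift_meas.
  have ZE : fine (Q Z) <= e / 4.
    rewrite -lee_fin fineK ?fin_num_measure //.
    apply: le_trans (QC _ mZ) _; rewrite (haar_reflect LF hl) //.
    rewrite -[lam W]/(tau (U `\` F)).
    apply: (@le_trans _ _ (C%:E * (e / 4 / (1 + C))%:E)%E).
      by apply: lee_wpmul2l; rewrite ?lee_fin // ltW.
    rewrite -EFinM lee_fin mulrA ler_pdivrMr ?ltr_pwDl // mulrC.
    by rewrite ler_pM2l // lerDr.
  have h1 : shift_mass Q U x <= fine (Q ([set y : borel V | F (x - (y : V))] `|` Z)) + fine (Q T).
    apply: prob_le2 => //; try exact: shift_meas.
      by apply: measurableU => //; exact: shift_meas.
    move=> y /= Uy; have [yM|yM] := leP M (nrm y); first by right.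
    left; have [Fy|nFy] := pselect (F (x - (y : V))); [by left|right].
    split => //=; apply: le_lt_trans (nrmB LF _ _) _.
    by have := nrmD LF (x - x0) x0; rewrite subrK /rad; lra.
  have h2 : fine (Q ([set y : borel V | F (x - (y : V))] `|` Z)) <= shift_mass Q F x + fine (Q Z).
    apply: prob_le2 => //; try exact: shift_meas.
    by apply: measurableU => //; exact: shift_meas.
  by move: MQ; rewrite -/T; lra.
have [d1 d10 h1] := shift_mass_lsc Q x0 oU e40.
have [d2 d20 h2] := shift_mass_lsc Q x0 oF e40.
exists (Num.min 1 (Num.min d1 d2)); first by rewrite !lt_min ltr01 d10.
move=> x; rewrite !lt_min => /and3P[xx1 /h1 l1 /h2].
rewrite !shift_massC // => l2.
have g1 := gap x xx1; have g0 : shift_mass Q U x0 <= shift_mass Q F x0 + e / 2.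
  by apply: gap; rewrite subrr (nrm0 LF).
have a1 := shift_mass_le Q x mF mX FX; have a2 := shift_mass_le Q x mX mU XU.
have a3 := shift_mass_le Q x0 mF mX FX; have a4 := shift_mass_le Q x0 mX mU XU.
by rewrite ltr_norml; apply/andP; split; lra.
Qed.

(** The number of positive integers up to [a] is its floor.  Applied to the values
    of a function, this approximates it by indicators of superlevel sets. *)
Lemma layer_sum (N : nat) (a : R) : 0 <= a -> a <= N%:R ->
  a - 1 <= \sum_(k < N) ((k.+1%:R <= a)%R : nat)%:R <= a.
Proof.
have full M (b : R) : M%:R <= b -> \sum_(k < M) ((k.+1%:R <= b)%R : nat)%:R = M%:R :> R.
  move=> Mb; rewrite (eq_bigr (fun=> 1)) ?sumr_const ?card_ord //.
  by move=> k _; rewrite (le_trans _ Mb) // ler_nat.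
elim: N => [|N IH] a0 aN; first by rewrite big_ord0; lra.
have [aN'|aN'] := lerP a N%:R.
  have last0 : ((N.+1%:R <= a)%R : nat)%:R = 0 :> R.
    by rewrite leNgt (le_lt_trans aN') // ltr_nat.
  by rewrite big_ord_recr /= last0 addr0; exact: IH.
rewrite big_ord_recr /= full; last exact: ltW.
move: aN; rewrite -natr1; case: (lerP (N%:R + 1) a) => /= h1 h2; lra.
Qed.

Variable g : borel V -> R.
Hypotheses (mg : measurable_fun setT g) (g0 : forall x, 0 <= g x)
  (gC : forall x, g x <= C).

(** A density of the convolution of [g lam] with [Q]. *)
Definition smoothed (Q : probability (borel V) R) (x : V) : R :=
  mean Q (fun y => g (x - (y : V))).

Lemma bmeas_shift x : bmeas (fun y : borel V => g (x - (y : V))).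
Proof.
split; first exact: measurableT_comp mg (measurable_reflect LF x).
by exists C => y; rewrite ger0_norm.
Qed.

Lemma smoothed_ge0 Q x : 0 <= smoothed Q x.
Proof. by apply: mean_ge0 => y. Qed.

Lemma smoothed_le Q x : smoothed Q x <= C.
Proof.
rewrite -[leRHS](mean_cst Q); apply: mean_le => //; last exact: bmeas_cst.
exact: bmeas_shift.
Qed.

(** [N g] is within [1] of a sum of indicators of superlevel sets, so that
    [shift_mass_cont] applies to each of them. *)
Lemma smoothed_cont (Q : probability (borel V) R) (x0 : V) (e : R) :
  (forall B, measurable B -> Q B <= C%:E * lam B)%E -> 0 < e ->
  exists2 d, 0 < d & forall x, nrm (x - x0) < d ->
    `|smoothed Q x - smoothed Q x0| < e.
Proof.
move=> QC e0.
pose N := (Num.truncn (4 / e)).+1.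
have N0 : 0 < N%:R :> R by rewrite ltr0n.
have Ne : N%:R^-1 < e / 4.
  have h : 4 / e < N%:R by exact: Num.Theory.truncnS_gt.
  by rewrite invf_plt ?posrE ?divr_gt0 // invf_div.
pose L := (Num.truncn (C * N%:R)).+1.
have LP : C * N%:R <= L%:R by apply/ltW; exact: Num.Theory.truncnS_gt.
pose X (k : nat) : set (borel V) := [set x | k.+1%:R <= g x * N%:R].
have mX k : measurable (X k).
  have mgN : measurable_fun setT (fun x => g x * N%:R).
    by apply: measurable_funM => //; exact: measurable_cst.
  rewrite (_ : X k = (fun x => g x * N%:R) @^-1` `[k.+1%:R, +oo[); last first.
    by apply/seteqP; split=> x /=; rewrite in_itv /= andbT.
  by rewrite -[X in measurable X]setTI; exact: mgN.
pose S x := \sum_(k < L) shift_mass Q (X k) x.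
pose F x j (y : borel V) : R := \sum_(k < j) ((k.+1%:R <= g (x - (y : V)) * N%:R)%R : nat)%:R.
have FE x j : bmeas (F x j) /\ mean Q (F x j) = \sum_(k < j) shift_mass Q (X k) x.
  elim: j => [|j [IHb IHm]].
    have -> : F x 0%N = fun=> 0 by apply/funext => y; rewrite /F big_ord0.
    by split; [exact: bmeas_cst|rewrite mean_cst big_ord0].
  have mXx := shift_meas x (mX j).
  have -> : F x j.+1 = fun y => F x j y + \1_[set y : borel V | X j (x - (y : V))] y.
    apply/funext => y; rewrite /F big_ord_recr /=; congr (_ + _).
    rewrite indicE; case: (boolP (_ <= _)) => h; first by rewrite mem_set.
    by rewrite memNset //; exact/negP.
  have bI : bmeas (\1_[set y : borel V | X j (x - (y : V))] : borel V -> R).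
    exact: bmeas_indic.
  split; first exact: bmeasD.
  by rewrite meanD // IHm big_ord_recr /= mean_indic.
have close x : N%:R * smoothed Q x - 1 <= S x <= N%:R * smoothed Q x.
  have [bF mF] := FE x L; rewrite /S -mF -(meanZ Q N%:R (bmeas_shift x)).
  have bs := bmeasZ N%:R (bmeas_shift x).
  have pt y : N%:R * g (x - (y : V)) - 1 <= F x L y <= N%:R * g (x - (y : V)).
    rewrite mulrC; apply: layer_sum; first by rewrite mulr_ge0.
    by apply: le_trans LP; rewrite ler_wpM2r.
  apply/andP; split; last by apply: mean_le => // y; have /andP[] := pt y.
  rewrite -[X in _ - X](mean_cst Q) -(meanB Q bs (bmeas_cst _ 1)).
  apply: mean_le => //; first by apply: bmeasB => //; exact: bmeas_cst.
  by move=> y; have /andP[] := pt y.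
have contS j : forall e' : R, 0 < e' -> exists2 d, 0 < d & forall x, nrm (x - x0) < d ->
    `|\sum_(k < j) shift_mass Q (X k) x - \sum_(k < j) shift_mass Q (X k) x0| < e'.
  elim: j => [|j IH] e' e'0.
    by exists 1 => // x _; rewrite !big_ord0 subrr normr0.
  have e'2 : 0 < e' / 2 by rewrite divr_gt0.
  have [d d0 dP] := IH _ e'2.
  have [d' d'0 d'P] := shift_mass_cont x0 QC (mX j) e'2.
  exists (Num.min d d'); first by rewrite lt_min d0.
  move=> x; rewrite lt_min => /andP[/dP h1 /d'P h2].
  rewrite !big_ord_recr /= opprD addrACA; apply: le_lt_trans (ler_normD _ _) _; lra.
have Ne0 : 0 < N%:R * e / 2 by rewrite divr_gt0 // mulr_gt0.
have [d d0 dP] := contS L _ Ne0; exists d => // x /dP; rewrite -/(S x) -/(S x0).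
have /andP[c1 c2] := close x; have /andP[c3 c4] := close x0.
rewrite !ltr_norml => /andP[h1 h2].
have N1 : 1 < N%:R * e / 4.
  by move: Ne; rewrite invf_plt ?posrE ?divr_gt0 // invf_div ltr_pdivrMr // => h; lra.
apply/andP; split; rewrite -(ltr_pM2l N0) mulrBr; lra.
Qed.

End Density.

(** * Densities of dominated measures *)

Section ContinuousDensity.
Variables (R : realType) (K : topFieldType) (abv ch sh : K -> R).
Hypothesis LF : local_field abv ch sh.
Variable V : vectType K.
Variable lam : {measure set (borel V) -> \bar R}.
Hypothesis hl : haar_measure lam.
Variables (C : R) (C0 : 0 <= C).

Lemma dominated_ac (P : probability (borel V) R) :
  (forall B, measurable B -> P B <= C%:E * lam B)%E -> P `<< lam.
Proof.
move=> PC; apply/null_content_dominatesP => B mB lB.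
apply/eqP; rewrite -measure_le0; apply: le_trans (PC B mB) _.
by rewrite lB mule0.
Qed.

(** A Radon-Nikodym density exceeds [C + k.+1^-1] only on a null set, since
    otherwise the mass of this set would be too large; truncating at [C] then
    changes it on a null set. *)
Lemma bounded_density (P : probability (borel V) R) :
  (forall B, measurable B -> P B <= C%:E * lam B)%E ->
  exists g : borel V -> R, [/\ measurable_fun setT g, forall x, 0 <= g x,
    forall x, g x <= C & forall B, measurable B ->
    (P B = \int[lam]_(x in B) (g x)%:E)%E].
Proof.
move=> PC; pose m := sigma_finite_pack (haar_sigma_finite LF hl).
have Pm : P `<< m by exact: dominated_ac.
have [f [f0 ffin fint fE]] := radon_nikodym_sigma_finite Pm.
have mf : measurable_fun setT (fine \o f).
  by apply: measurableT_comp => //; case/integrableP: fint.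
have fx x : f x = (fine (f x))%:E by rewrite fineK.
have fine0 x : 0 <= fine (f x) by exact: fine_ge0.
have null k : lam [set x | C + k.+1%:R^-1 <= fine (f x)] = 0%E.
  set Z := [set x | _]; pose c := C + k.+1%:R^-1.
  have c0 : C < c by rewrite ltrDl invr_gt0.
  have mZ : measurable Z.
    rewrite (_ : Z = (fine \o f) @^-1` `[c, +oo[); last first.
      by apply/seteqP; split=> x /=; rewrite in_itv /= andbT.
    by rewrite -[X in measurable X]setTI; exact: mf.
  have h1 : (c%:E * lam Z <= P Z)%E.
    rewrite fE // -(integral_cst lam mZ c%:E); apply: ge0_le_integral => //.
    - by move=> x _; rewrite lee_fin (le_trans C0) // ltW.
    - by apply: measurable_funTS; case/integrableP: fint.
    - by move=> x Zx; rewrite /cst fx lee_fin.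
  have finZ : lam Z \is a fin_num.
    rewrite ge0_fin_numE //; apply: contraT; rewrite -leNgt leye_eq => /eqP E.
    have : (P Z < +oo)%E by apply: le_lt_trans (probability_le1 P mZ) _; exact: ltry.
    by move: h1; rewrite E gt0_muley ?lte_fin ?(le_lt_trans C0) // leye_eq => /eqP ->.
  have := le_trans h1 (PC Z mZ); rewrite -(fineK finZ) -!EFinM lee_fin => h2.
  have z0 : 0 <= fine (lam Z) by exact: fine_ge0.
  congr (_%:E); apply/eqP; rewrite eq_le z0 andbT leNgt; apply/negP => zp.
  by move: h2; rewrite ler_pM2r // leNgt c0.
pose g x := Num.min C (fine (f x)).
have mg : measurable_fun setT g.
  by apply: measurable_minr => //; exact: measurable_cst.
exists g; split => // [x|x|B mB].
- by rewrite le_min C0 fine0.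
- by rewrite ge_min lexx.
rewrite fE //; apply: ae_eq_integral => //.
- by apply: measurable_funTS; case/integrableP: fint.
- by apply: measurable_funTS; exact/measurable_EFinP.
pose Z k := [set x | C + k.+1%:R^-1 <= fine (f x)].
have mZ k : measurable (Z k).
  rewrite (_ : Z k = (fine \o f) @^-1` `[C + k.+1%:R^-1, +oo[); last first.
    by apply/seteqP; split=> x /=; rewrite in_itv /= andbT.
  by rewrite -[X in measurable X]setTI; exact: mf.
exists (\bigcup_k Z k); split.
- exact: bigcupT_measurable.
- apply/eqP; rewrite -measure_le0.
  apply: le_trans (measure_sigma_subadditive _ _ _ _) _ => //.
    exact: bigcupT_measurable.
  by rewrite eseries0 // => k _ _; exact: null.
move=> x /= /not_implyP[Bx fg].
have Cf : C < fine (f x).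
  rewrite ltNge; apply/negP => fC; apply: fg.
  by rewrite fx /g (min_idPr fC).
exists (Num.truncn (fine (f x) - C)^-1) => //=.
rewrite /Z /= -lerBrDl; apply/ltW; rewrite invf_plt ?posrE ?subr_gt0 //.
exact: Num.Theory.truncnS_gt.
Qed.

Lemma integral_translate (h : borel V -> \bar R) (a : V) : measurable_fun setT h ->
  (forall x, 0 <= h x)%E ->
  (\int[lam]_x h ((x : V) + a)%R = \int[lam]_x h x)%E.
Proof.
move=> mh h0; have mr := measurable_translate LF a.
have := @ge0_integral_pushforward _ _ _ _ _ _ mr lam setT _ measurableT mh.
rewrite preimage_setT => <- //.
by apply: eq_measure_integral => X mX _; case: hl => _ _; exact.
Qed.

(** Tonelli's theorem and the invariance of [lam]. *)
Lemma conv_density (P Q : probability (borel V) R) (g : borel V -> R) :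
  measurable_fun setT g -> (forall x, 0 <= g x) -> (forall x, g x <= C) ->
  (forall B, measurable B -> P B = \int[lam]_(x in B) (g x)%:E)%E ->
  forall B, measurable B ->
  (conv LF P Q B = \int[lam]_(x in B) (smoothed g Q x)%:E)%E.
Proof.
move=> mg g0 gC PE B mB; rewrite conv_set //.
pose m := sigma_finite_pack (haar_sigma_finite LF hl).
pose F (z : borel V * borel V) : \bar R :=
  ((\1_B z.1 : R) * g ((z.1 : V) - (z.2 : V)))%:E.
have mF : measurable_fun setT F.
  apply/measurable_EFinP; apply: measurable_funM.
    have mI : measurable_fun setT (\1_B : borel V -> R) by exact: measurable_indic.
    exact: measurableT_comp mI measurable_fst.
  exact: measurableT_comp mg (measurable_sub LF (V := V)).
have F0 z : (0 <= F z)%E by rewrite lee_fin mulr_ge0.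
transitivity (\int[Q]_y \int[m]_x F (x, y))%E.
  apply: eq_integral => y _.
  have mBy : measurable [set x : borel V | B ((x : V) + (y : V))].
    by apply: measurable_preim => //; exact: (measurable_translate LF).
  rewrite PE // integral_mkcond.
  have mh : measurable_fun setT (fun x : borel V => F (x, y)).
    by have := measurableT_comp mF (pair2_measurable y).
  rewrite -[RHS](integral_translate y mh) //; apply: eq_integral => x _.
  rewrite /F /patch /= addrK indicE.
  have [xB|xB] := boolP ((x : V) + (y : V) \in B).
    by rewrite mem_set ?mul1r //; exact: set_mem.
  by rewrite memNset ?mul0r //= => h; move/negP: xB; apply; rewrite inE.
transitivity (\int[m]_x \int[Q]_y F (x, y))%E.
  by apply/esym; exact: (@fubini_tonelli _ _ _ _ _ m Q F mF F0).
rewrite [RHS]integral_mkcond; apply: eq_integral => x _.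
rewrite /patch; have [xB|xB] := boolP (x \in B).
  rewrite EFin_mean; last exact: (bmeas_shift LF mg g0 gC x).
  by apply: eq_integral => y _; rewrite /F /= indicE xB mul1r.
transitivity (\int[Q]_y (0 : \bar R))%E; last exact: integral0.
by apply: eq_integral => y _; rewrite /F /= indicE (negbTE xB) mul0r.
Qed.

End ContinuousDensity.

(** * The real and the p-adic fields *)

Lemma real_local_field (R : realType) :
  @local_field R (R : topFieldType) (fun x : R => `|x|) (fun x : R => cos x) (fun x : R => sin x).
Proof.
split.
- by move=> x; exact: normr_ge0.
- by move=> x; exact: normr0_eq0.
- by move=> x y; exact: normrM.
- by move=> x y; exact: ler_normD.
- move=> x A; split=> [/nbhs_ballP[e e0 eA]|[e e0 eA]].
    by exists e => // y yx; apply: eA; rewrite /ball /= distrC.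
  apply/nbhs_ballP; exists e => // y; rewrite /ball /= distrC; exact: eA.
- move=> r; rewrite (_ : [set x | _] = `[- r, r]%classic).
    exact: segment_compact.
  by apply/seteqP; split=> x /=; rewrite in_itv /= ler_norml.
- exists (2^-1 : R); rewrite ger0_norm ?invr_ge0 ?invr_gt0 //.
  by rewrite invf_lt1 // ltr1n.
- move=> x e e0; pose b := (Num.truncn e^-1).+1; exists (Num.floor (x * b%:R)), b.
  have b0 : 0 < b%:R :> R by rewrite ltr0n.
  split; first by rewrite gt_eqF.
  have /andP[h1 h2] := Num.Theory.floor_itv (x * b%:R).
  rewrite intrD in h2.
  have -> : x - (Num.floor (x * b%:R))%:~R / b%:R = (x * b%:R - (Num.floor (x * b%:R))%:~R) / b%:R.
    by rewrite mulrBl mulfK // gt_eqF.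
  rewrite ger0_norm ?divr_ge0 ?subr_ge0 // ltr_pdivrMr //.
  apply: (@lt_trans _ _ 1); first by rewrite ltrBlDr addrC.
  rewrite mulrC -ltr_pdivrMr // div1r; exact: Num.Theory.truncnS_gt.
- left; split=> [a|M].
    have /andP[h1 h2] := Num.Theory.floor_itv a; rewrite intrD in h2.
    exists (Num.floor a); rewrite ger0_norm ?subr_ge0 // lerBlDr addrC ltW //.
  exists (Num.truncn M).+1; rewrite ger0_norm //.
  exact/ltW/Num.Theory.truncnS_gt.
- by move=> x; rewrite cos2Dsin2.
- by move=> x y; rewrite cosD.
- by move=> x y; rewrite sinD.
- move=> e e0; have := @continuous_cos R 0 => /cvgrPdist_lt/(_ e e0)/nbhs_ballP[r r0 rP].
  exists r => // x xr; have : `|cos (0 : R) - cos x| < e.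
    by apply: rP; rewrite /ball /= sub0r normrN.
  by rewrite cos0; apply: le_lt_trans; exact: ler_norm.
- exists (pi : R); rewrite cospi; apply/eqP; lra.
Qed.

Section PadicLocalField.
Variables (R : realType) (p : nat) (p_pr : prime p).
Local Notation Qp := (padic p_pr).
Local Notation nrmp := (@padic_norm p p_pr).

Let p0 : 0 < p%:R :> rat. Proof. by rewrite ltr0n prime_gt0. Qed.
Let pN0 : p%:R != 0 :> rat. Proof. by rewrite gt_eqF. Qed.
Let pX0 k : 0 < p%:R ^+ k :> rat. Proof. by rewrite exprn_gt0. Qed.

Lemma padic_norm_int (m : int) : nrmp m%:~R = padic_abs p m%:~R.
Proof. by rewrite -padic_norm_ratr ratr_int. Qed.

Lemma padic_norm_p k : nrmp (p%:R ^+ k) = p%:R ^- k.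
Proof.
elim: k => [|k IH]; first by rewrite !expr0 invr1 padic_norm1.
rewrite !exprS padic_normM IH invfM; congr (_ * _).
have -> : (p%:R : Qp) = (p%:Z)%:~R by [].
rewrite padic_norm_int -[p%:Z%:~R]divr1 (@padic_abs_frac p p_pr p 1) //=.
  by rewrite logn1 expr0 mul1r logn_prime // eqxx expr1.
by rewrite -lt0n prime_gt0.
Qed.

Lemma padic_int_neq0 (m : nat) : (0 < m)%N -> m%:R != 0 :> Qp.
Proof.
move=> m0; apply/eqP => E; have : nrmp m%:R = 0 by rewrite E padic_norm0.
rewrite -[m%:R]/((m%:Z)%:~R) padic_norm_int => /eqP; rewrite padic_abs_eq0 // intr_eq0.
by case: m m0 {E}.
Qed.

Lemma padic_normV x : nrmp x^-1 = (nrmp x)^-1.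
Proof.
have [->|x0] := eqVneq x 0; first by rewrite invr0 padic_norm0 invr0.
have nx : nrmp x != 0 by apply: contra_neq x0; exact: padic_norm_eq0.
by apply: (mulfI nx); rewrite -padic_normM !divff // padic_norm1.
Qed.

Lemma padic_pow_small (e : rat) : 0 < e -> exists k, p%:R ^- k < e.
Proof.
move=> e0; exists (Num.truncn e^-1); rewrite invf_plt ?posrE //.
apply: lt_le_trans (Num.Theory.truncnS_gt _) _.
by rewrite -natrX ler_nat ltn_expl // prime_gt1.
Qed.

(** Bezout: the denominator, being prime to [p], is invertible modulo [p ^ j]. *)
Lemma rat_near_int (q : rat) (j : nat) : padic_abs p q <= 1 ->
  exists m : int, padic_abs p (q - m%:~R) <= p%:R ^- j.
Proof.
rewrite padic_abs_le1 // => nd.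
have : coprimez (denq q) (p ^ j)%N%:Z.
  rewrite coprimezE /= coprime_sym coprimeXl // prime_coprime //.
move=> /coprimezP[[k l] /= klE].
exists (numq q * k).
have d0 : denq q != 0 by rewrite denq_eq0.
have -> : q - (numq q * k)%:~R = (numq q * l)%:~R * (p%:R ^+ j) / (denq q)%:~R.
  rewrite -{1}[q]divq_num_den; apply: (mulIf (_ : (denq q)%:~R != 0)); first by rewrite intr_eq0.
  rewrite divfK ?intr_eq0 // mulrBl divfK ?intr_eq0 //.
  rewrite -natrX -[(p ^ j)%N%:R]/((p ^ j)%N%:Z%:~R) -!intrM -intrB; congr (_%:~R).
  rewrite -[X in X - _]mulr1 -klE; ring.
rewrite !padic_absM // padic_absV // -[(denq q)%:~R]divr1 (@padic_abs_frac p p_pr _ 1) //= logn1 expr0 div1r invrK.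
have -> : logn p `|denq q|%N = 0%N by apply/eqP; rewrite -leqn0 leqNgt logn_gt0 mem_primes p_pr (negbTE nd) !andbF.
rewrite expr0 mulr1 -(padic_norm_ratr p_pr (p%:R ^+ j)).
have -> : ratr (p%:R ^+ j) = p%:R ^+ j :> Qp by rewrite -natrX -[(p ^ j)%N%:R]/((p ^ j)%N%:Z%:~R) ratr_int -natrX.
by rewrite padic_norm_p ler_piMl ?invr_ge0 ?(ltW (pX0 _)) // padic_abs_int.
Qed.

Lemma padic_near_int (x : Qp) (j : nat) : nrmp x <= 1 ->
  exists m : int, nrmp (x - m%:~R) <= p%:R ^- j.
Proof.
move=> x1; have jp : 0 < p%:R ^- j :> rat by rewrite invr_gt0.
have j1 : p%:R ^- j <= 1 :> rat.
  by rewrite invf_le1 // exprn_ege1 // ler1n prime_gt0.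
have [q xq] := padic_rat_dense x jp.
have q1 : padic_abs p q <= 1.
  rewrite -(padic_norm_ratr p_pr) -[ratr q](subKr x).
  apply: le_trans (padic_norm_ultra _ _) _; rewrite padic_normN ge_max x1.
  exact: le_trans (ltW xq) j1.
have [m qm] := rat_near_int j q1; exists m.
rewrite -(subrKA (ratr q)); apply: le_trans (padic_norm_ultra _ _) _.
by rewrite ge_max (ltW xq) -ratr_int -padic_ratrB padic_norm_ratr.
Qed.

Lemma padic_scale_unit (x : Qp) : exists k, nrmp (x * p%:R ^+ k) <= 1.
Proof.
exists (Num.truncn (nrmp x)); rewrite padic_normM padic_norm_p.
rewrite ler_pdivrMr // mul1r; apply/ltW.
apply: lt_le_trans (Num.Theory.truncnS_gt _) _.
by rewrite -natrX ler_nat ltn_expl // prime_gt1.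
Qed.

(** The fractional part: a representative of [x] modulo the unit ball among the
    rationals whose denominator is a power of [p]. *)
Definition frac_of (x : Qp) (q : rat) :=
  (exists (m : int) (k : nat), q = m%:~R / p%:R ^+ k) /\ nrmp (x - ratr q) <= 1.

Lemma ratr0_padic : ratr 0 = 0 :> Qp.
Proof. by rewrite -[0]/(0%:~R) ratr_int. Qed.

Lemma ratrN_padic q : ratr (- q) = - ratr q :> Qp.
Proof. by rewrite -[- q]sub0r padic_ratrB ratr0_padic sub0r. Qed.

Lemma ratrD_padic q r : ratr (q + r) = ratr q + ratr r :> Qp.
Proof. by rewrite -[in LHS](opprK r) padic_ratrB ratrN_padic opprK. Qed.

Lemma ratr_frac (m : int) k : ratr (m%:~R / p%:R ^+ k) = m%:~R / p%:R ^+ k :> Qp.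
Proof.
have pk : (0 < p ^ k)%N by rewrite expn_gt0 prime_gt0.
have ratrMn n q : ratr (q *+ n) = ratr q *+ n :> Qp.
  by elim: n => [|n IH]; rewrite ?mulr0n ?ratr0_padic // !mulrS ratrD_padic IH.
have pQ := padic_int_neq0 pk; rewrite natrX in pQ.
apply: (mulIf pQ); rewrite divfK // -[in RHS]ratr_int.
rewrite -(natrX Qp p k) mulr_natr -ratrMn -[in LHS](mulr_natr (_ / _)) natrX.
by rewrite divfK // gt_eqF.
Qed.

Lemma frac_of_ex x : exists q, frac_of x q.
Proof.
have [k xk] := padic_scale_unit x; have [m xm] := padic_near_int k xk.
exists (m%:~R / p%:R ^+ k); split; first by exists m, k.
have pk : (0 < p ^ k)%N by rewrite expn_gt0 prime_gt0.
have pQ := padic_int_neq0 pk; rewrite natrX in pQ.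
have -> : x - ratr (m%:~R / p%:R ^+ k) = (x * p%:R ^+ k - m%:~R) / p%:R ^+ k.
  by rewrite ratr_frac mulrBl mulfK.
rewrite padic_normM padic_normV padic_norm_p invrK.
by rewrite -ler_pdivlMr // div1r.
Qed.

Lemma frac_ofD x y q r : frac_of x q -> frac_of y r -> frac_of (x + y) (q + r).
Proof.
move=> [[m [k ->]] xq] [[n [l ->]] yr]; split.
  exists (m * p%:Z ^+ l + n * p%:Z ^+ k), (k + l)%N.
  rewrite intrD !intrM !rmorphXn exprD /= -[p%:Z%:~R]/(p%:R : rat); field.
  by rewrite !expf_neq0 // gt_eqF.
rewrite ratrD_padic opprD addrACA; apply: le_trans (padic_norm_ultra _ _) _.
by rewrite ge_max xq.
Qed.

(** The difference of two fractional parts is a rational whose denominator is a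
    power of [p] and that is a [p]-adic integer, hence an integer. *)
Lemma frac_of_uniq x q r : frac_of x q -> frac_of x r -> exists n : int, q = r + n%:~R.
Proof.
move=> [[m [k qE]] xq] [[n [l rE]] xr].
pose j := (k + l)%N; pose a : int := m * p%:Z ^+ l - n * p%:Z ^+ k.
have qrE : q - r = a%:~R / p%:R ^+ j.
  rewrite qE rE /a /j intrB !intrM !rmorphXn exprD /= -[p%:Z%:~R]/(p%:R : rat); field.
  by rewrite !expf_neq0 // gt_eqF.
have : padic_abs p (q - r) <= 1.
  rewrite -(padic_norm_ratr p_pr) padic_ratrB.
  rewrite (_ : _ - _ = (x - ratr r) - (x - ratr q)); last first.
    by rewrite opprB [RHS]addrC subrKA.
  by apply: le_trans (padic_norm_ultra _ _) _; rewrite padic_normN ge_max xr.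
have [a0|a0] := eqVneq a 0.
  by move=> _; exists 0; move: qrE; rewrite a0 mul0r addr0 => /subr0_eq.
rewrite qrE padic_absM // padic_absV // -[p%:R ^+ j]mulr1.
have -> : padic_abs p (p%:R ^+ j * 1) = p%:R ^- j.
  rewrite mulr1 -(padic_norm_ratr p_pr) (_ : ratr _ = p%:R ^+ j :> Qp) ?padic_norm_p //.
  by rewrite -natrX -[(p ^ j)%N%:R]/((p ^ j)%N%:Z%:~R) ratr_int -natrX.
rewrite invrK -[a%:~R]divr1 (@padic_abs_frac p p_pr a 1) //= logn1 expr0 mul1r mulrC.
rewrite ler_pdivrMr // mul1r ler_eXn2l ?ltr1n ?prime_gt1 // => jl.
have : (p ^ j %| `|a|)%N by rewrite pfactor_dvdn // absz_gt0.
move=> /dvdnP[b bE]; exists (sgz a * b%:Z).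
apply/eqP; rewrite addrC -subr_eq qrE; apply/eqP.
apply: (mulIf (_ : p%:R ^+ j != 0)); first by rewrite gt_eqF.
rewrite divfK ?gt_eqF // {1}[a]intEsg bE -natrX.
by rewrite -[(p ^ j)%N%:R]/((p ^ j)%N%:Z%:~R) -intrM; congr (_%:~R); rewrite PoszM mulrA.
Qed.

Definition frac x : rat := xget 0 [set q | frac_of x q].

Lemma fracP x : frac_of x (frac x).
Proof. by have [q qP] := frac_of_ex x; apply: (@xgetPex _ 0 [set q | frac_of x q]); exists q. Qed.

(** The character [exp (2 i pi {x})], where [{x}] is the fractional part. *)
Definition pch (x : Qp) : R := cos (2 * pi * ratr (frac x)).
Definition psh (x : Qp) : R := sin (2 * pi * ratr (frac x)).

Lemma trig_period (a : R) (n : int) :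
  cos (a + 2 * pi * n%:~R) = cos a /\ sin (a + 2 * pi * n%:~R) = sin a.
Proof.
have nat_case (b : R) (m : nat) :
    cos (b + 2 * pi * m%:R) = cos b /\ sin (b + 2 * pi * m%:R) = sin b.
  elim: m b => [|m IH] b; first by rewrite mulr0 addr0.
  rewrite -[m.+1%:R]natr1 mulrDr mulr1 addrA [X in _ + X]mulr_natl cosD2pi sinD2pi.
  exact: IH.
case: n => m; first exact: nat_case.
rewrite NegzE mulrNz; have [h1 h2] := nat_case (a + 2 * pi * - m.+1%:R) m.+1.
by rewrite -h1 -h2 -addrA -mulrDr addNr mulr0 addr0.
Qed.

Lemma pch_frac x q : frac_of x q ->
  pch x = cos (2 * pi * ratr q) /\ psh x = sin (2 * pi * ratr q).
Proof.
move=> xq; have [n ->] := frac_of_uniq xq (fracP x).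
rewrite rmorphD /= ratr_int mulrDr; have [h1 h2] := trig_period (2 * pi * ratr (frac x)) n.
by rewrite h1 h2.
Qed.

Definition pabv (x : Qp) : R := ratr (nrmp x).

Lemma pabv_small (e : R) : 0 < e -> exists k, ratr (p%:R ^- k) < e.
Proof.
move=> e0; have [q] := @rat_in_itvoo R 0 e e0.
rewrite in_itv /= ltr0q => /andP[q0 qe].
have [k kq] := padic_pow_small q0; exists k; apply: lt_trans qe.
by rewrite ltr_rat.
Qed.

Lemma padic_nbhsP (x : Qp) (A : set Qp) :
  nbhs x A <-> exists2 e : R, 0 < e & forall y, pabv (y - x) < e -> A y.
Proof.
split=> [/nbhs_ballP[e e0 eA]|[e e0 eA]].
  exists (ratr e) => [|y]; first by rewrite ltr0q.
  rewrite /pabv ltr_rat => yx; apply: eA; rewrite ballEmdist /=.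
  by rewrite metric_sym.
have [k ke] := pabv_small e0.
apply/nbhs_ballP; exists (p%:R ^- k); first by rewrite /= invr_gt0.
move=> y; rewrite ballEmdist /= metric_sym => yx; apply: eA.
by apply: lt_trans ke; rewrite /pabv ltr_rat.
Qed.

(** An ultrafilter concentrated on a ball concentrates on one ball of each
    radius, as finitely many of them cover; their centers converge. *)
Lemma padic_ball_compact (r : R) : compact [set x : Qp | pabv x <= r].
Proof.
rewrite compact_ultra => F UF FA.
have [k kP] : exists k, forall x : Qp, pabv x <= r -> nrmp (x * p%:R ^+ k) <= 1.
  exists (Num.truncn r).+1 => x xr; rewrite padic_normM padic_norm_p ler_pdivrMr // mul1r.
  rewrite -(ler_rat R); apply: (le_trans xr).
  have h := Num.Theory.truncnS_gt r; apply: (le_trans (ltW h)).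
  by rewrite -natrX ratr_nat ler_nat ltnW // ltn_expl // prime_gt1.
pose c (i : nat) : Qp := i%:R / p%:R ^+ k.
have cover j x : pabv x <= r -> exists2 i, (i < p ^ (j + k))%N & nrmp (x - c i) <= p%:R ^- j.
  move=> /kP x1; have [m xm] := padic_near_int (j + k) x1.
  have pjk : (0 < p ^ (j + k))%N by rewrite expn_gt0 prime_gt0.
  have pjkZ : (p ^ (j + k))%N%:Z != 0 by rewrite eqz_nat -lt0n.
  have pk : (0 < p ^ k)%N by rewrite expn_gt0 prime_gt0.
  have pQ := padic_int_neq0 pk; rewrite natrX in pQ.
  pose i := `|(m %% (p ^ (j + k))%N%:Z)%Z|%N.
  have iE : (i%:Z = (m %% (p ^ (j + k))%N%:Z)%Z) by rewrite /i gez0_abs // modz_ge0.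
  exists i; first by rewrite -ltz_nat iE ltz_pmod.
  have -> : x - c i = (x * p%:R ^+ k - i%:Z%:~R) / p%:R ^+ k.
    by rewrite mulrBl mulfK.
  rewrite padic_normM padic_normV padic_norm_p invrK -ler_pdivlMr // -invfM -exprD.
  rewrite -(subrKA m%:~R); apply: le_trans (padic_norm_ultra _ _) _.
  rewrite ge_max xm /= -intrB iE.
  have -> : m - (m %% (p ^ (j + k))%N%:Z)%Z = (m %/ (p ^ (j + k))%N%:Z)%Z * (p ^ (j + k))%N%:Z.
    by rewrite {1}(divz_eq m (p ^ (j + k))%N%:Z) addrK.
  rewrite intrM padic_normM -[X in _ * nrmp X]/((p ^ (j + k))%N%:R) natrX padic_norm_p.
  by rewrite ler_piMl ?invr_ge0 ?(ltW (pX0 _)) // padic_norm_int padic_abs_int.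
have FB j : exists i, F [set x | nrmp (x - c i) <= p%:R ^- j].
  apply: contrapT => /forallNP nF.
  have FC n : F [set x | forall i, (i < n)%N -> ~ nrmp (x - c i) <= p%:R ^- j].
    elim: n => [|n IH]; first by apply: filterS filterT => x _ i.
    have [/nF[]|FCn] := in_ultra_setVsetC [set x | nrmp (x - c n) <= p%:R ^- j] UF.
    apply: filterS (filterI IH FCn) => x [h1 h2] i.
    by rewrite ltnS leq_eqVlt => /predU1P[->//|]; exact: h1.
  have [x [xr h]] := filter_ex (filterI FA (FC (p ^ (j + k))%N)).
  by have [i /h] := cover j x xr.
have /choice[a aP] : forall j, exists y : Qp, F [set x | nrmp (x - y) <= p%:R ^- j].
  by move=> j; have [i iP] := FB j; exists (c i).
have pmono i j : (i <= j)%N -> p%:R ^- j <= p%:R ^- i :> rat.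
  by move=> ij; rewrite lef_pV2 ?posrE // ler_eXn2l // ltr1n prime_gt1.
have [|y yP] := @padic_complete p p_pr a.
  move=> e e0; have [n ne] := padic_pow_small e0; exists n => i j ni nj.
  have [x [xi xj]] := filter_ex (filterI (aP i) (aP j)).
  apply: le_lt_trans ne; rewrite -(subrKA x); apply: le_trans (padic_norm_ultra _ _) _.
  rewrite ge_max -padic_normN opprB; apply/andP; split.
    exact: le_trans xi (pmono _ _ ni).
  exact: le_trans xj (pmono _ _ nj).
have conv : F --> y.
  move=> A /padic_nbhsP[e e0 eA].
  have [n ne] := pabv_small e0; have pn : 0 < p%:R ^- n :> rat by rewrite invr_gt0.
  have [N NP] := yP _ pn.
  pose i := maxn n N; apply: filterS (aP i) => x xi; apply: eA; apply: le_lt_trans ne.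
  rewrite /pabv ler_rat -(subrKA (a i)); apply: le_trans (padic_norm_ultra _ _) _.
  rewrite ge_max (ltW (NP i (leq_maxr _ _))) andbT.
  exact: le_trans xi (pmono _ _ (leq_maxl _ _)).
exists y; split => //=.
have [->|y0] := eqVneq y 0.
  have [x [xr _]] := filter_ex (filterI FA (@filterT _ F _)).
  by apply: le_trans xr; rewrite /pabv padic_norm0 ler_rat padic_norm_ge0.
have ny : 0 < nrmp y.
  by rewrite lt_def padic_norm_ge0 andbT; apply: contra_neq y0; exact: padic_norm_eq0.
have : nbhs y [set x | nrmp (x - y) < nrmp y].
  apply/padic_nbhsP; exists (pabv y) => [|x]; first by rewrite /pabv ltr0q.
  by rewrite /pabv ltr_rat.
move=> /conv Fy; have [x [xr /= xy]] := filter_ex (filterI FA Fy).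
apply: le_trans xr; rewrite /pabv ler_rat.
have := padic_norm_ultra x (y - x); rewrite subrKC le_max => /orP[//|].
by rewrite leNgt -[nrmp (y - x)]padic_normN opprB xy.
Qed.

Lemma padic_local_field : @local_field R (padic p_pr : topFieldType) pabv pch psh.
Proof.
split.
- by move=> x; rewrite ler0q padic_norm_ge0.
- by move=> x /eqP; rewrite /pabv fmorph_eq0 => /eqP/padic_norm_eq0.
- by move=> x y; rewrite /pabv padic_normM rmorphM.
- by move=> x y; rewrite /pabv -rmorphD ler_rat padic_norm_triangle.
- exact: padic_nbhsP.
- exact: padic_ball_compact.
- exists (p%:R : Qp); rewrite /pabv -[p%:R]expr1 padic_norm_p expr1.
    by rewrite ltr0q invr_gt0.
  have : p%:R^-1 < 1 :> rat by rewrite invf_lt1 // ltr1n prime_gt1.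
  by rewrite -(ltr_rat R) rmorph1.
- move=> x e e0; have [q] := @rat_in_itvoo R 0 e e0.
  rewrite in_itv /= ltr0q => /andP[q0 qe].
  have [s xs] := padic_rat_dense x q0; exists (numq s), `|denq s|%N; split.
    by apply: padic_int_neq0; rewrite absz_gt0 denq_eq0.
  have -> : (`|denq s|%N%:R : Qp) = (denq s)%:~R by rewrite -[LHS]/((`|denq s|%N%:Z)%:~R) absz_denq.
  by apply: lt_trans qe; rewrite /pabv ltr_rat.
- right => a e a1 e0; have [k ke] := pabv_small e0.
  have n1 : nrmp a <= 1 by rewrite -(ler_rat R) (le_trans a1) // rmorph1.
  have [m am] := padic_near_int k n1; exists m; apply: le_lt_trans ke.
  by rewrite /pabv ler_rat.
- by move=> x; rewrite cos2Dsin2.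
- move=> x y; have [-> _] := pch_frac (frac_ofD (fracP x) (fracP y)).
  by rewrite rmorphD mulrDr cosD.
- move=> x y; have [_ ->] := pch_frac (frac_ofD (fracP x) (fracP y)).
  by rewrite rmorphD mulrDr sinD.
- move=> e e0; exists 1 => // x x1.
  have x0 : frac_of x 0.
    split; first by exists 0, 0%N; rewrite mul0r.
    by rewrite ratr0_padic subr0 -(ler_rat R) rmorph1 ltW.
  by have [-> _] := pch_frac x0; rewrite rmorph0 mulr0 cos0 subrr.
- have pP : frac_of (1%:~R / p%:R ^+ 1) (1%:~R / p%:R ^+ 1).
    by split; [exists 1, 1%N|rewrite ratr_frac subrr padic_norm0].
  exists (1%:~R / p%:R ^+ 1); have [-> _] := pch_frac pP.
  have pR : 0 < p%:R :> R by rewrite ltr0n prime_gt0.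
  have -> : 2 * pi * ratr (1%:~R / p%:R ^+ 1) = (pi / p%:R) *+ 2 :> R.
    by rewrite -[1%:~R]/(1 : rat) expr1 mul1r fmorphV /= ratr_nat -[RHS]mulr_natl mulrA.
  have s0 : 0 < sin (pi / p%:R : R).
    apply: sin_gt0_pi; rewrite divr_gt0 ?pi_gt0 //=.
    by rewrite ltr_pdivrMr // ltr_pMr ?pi_gt0 // ltr1n prime_gt1.
  rewrite cos_mulr2n; apply/eqP; have := cos2Dsin2 (pi / p%:R : R); nra.
Qed.

End PadicLocalField.

(** * Equality of laws *)

Section Laws.
Variables (R : realType) (K : topFieldType) (abv ch sh : K -> R).
Hypothesis LF : local_field abv ch sh.
Variable V : vectType K.
Implicit Types P Q S : probability (borel V) R.

(** Equality of laws, tested on bounded functions: this form is the one that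
    passes through convolutions by Fubini alone. *)
Definition same_law P Q := forall f : borel V -> R, bmeas f -> mean P f = mean Q f.

Lemma same_law_set P Q : same_law P Q <->
  forall B : set (borel V), measurable B -> P B = Q B.
Proof.
split=> [PQ B mB|PQ f _].
  have h := PQ _ (bmeas_indic R mB); rewrite !mean_indic // in h.
  by rewrite -(fineK (fin_num_measure P B mB)) h fineK // fin_num_measure.
rewrite /mean /Rintegral; congr fine; apply: eq_measure_integral => B mB _.
exact: PQ.
Qed.

Lemma same_law_trans Q P S : same_law P Q -> same_law Q S -> same_law P S.
Proof. by move=> PQ QS f bf; rewrite PQ // QS. Qed.

Lemma fsqr_same P Q xi : same_law P Q -> fsqr ch sh P xi = fsqr ch sh Q xi.
Proof.
move=> PQ; rewrite /fsqr /fcos /fsin (PQ _ (chv_bmeas LF xi)).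
by rewrite (PQ _ (shv_bmeas LF xi)).
Qed.

Lemma bmeas_mean_translate Q (f : borel V -> R) : bmeas f ->
  bmeas (fun x : borel V => mean Q (fun y => f ((x : V) + (y : V)))).
Proof.
move=> [mf [M fM]].
have bF : bmeas (fun z : borel V * borel V => f ((z.1 : V) + (z.2 : V))).
  split; last by exists M.
  exact: measurableT_comp mf (measurable_add LF (V := V)).
have := bmeas_mean Q Q bF; congr bmeas; apply/funext => x; congr mean.
by apply/funext => y; rewrite /= addrC.
Qed.

Lemma conv_same P P' Q Q' : same_law P P' -> same_law Q Q' ->
  same_law (conv LF P Q) (conv LF P' Q').
Proof.
move=> PP QQ f bf; rewrite !mean_conv // (PP _ (bmeas_mean_translate Q bf)).
by congr mean; apply/funext => x; apply: QQ; exact: (bmeas_translate LF).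
Qed.

Lemma convA P Q S : same_law (conv LF P (conv LF Q S)) (conv LF (conv LF P Q) S).
Proof.
move=> f bf; rewrite !mean_conv //; last exact: bmeas_mean_translate.
congr mean; apply/funext => x; rewrite mean_conv; last exact: (bmeas_translate LF).
by congr mean; apply/funext => y; congr mean; apply/funext => z; rewrite addrA.
Qed.

Lemma conv_pow1 P : same_law (conv_pow LF P 1) P.
Proof.
move=> f bf; rewrite mean_conv //; congr mean; apply/funext => x.
by rewrite (mean_conv_pow0 LF P (bmeas_translate LF x bf)) /= addr0.
Qed.

Lemma conv_powD P m n :
  same_law (conv LF (conv_pow LF P m) (conv_pow LF P n)) (conv_pow LF P (m + n)).
Proof.
elim: m => [|m IH].
  move=> f bf; rewrite mean_conv // -[RHS]/(mean _ f).
  set g := (fun x => _); have bg : bmeas g by exact: bmeas_mean_translate.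
  by rewrite (mean_conv_pow0 LF) // /g; congr mean; apply/funext => y; rewrite add0r.
apply: (@same_law_trans (conv LF P (conv LF (conv_pow LF P m) (conv_pow LF P n)))).
  by move=> f bf; rewrite -convA.
by apply: conv_same.
Qed.

Variables (f : V -> V) (lf : linear f).
Let mf := measurable_linear LF lf.

Lemma push_same P Q : same_law P Q -> same_law (push_prob P mf) (push_prob Q mf).
Proof.
move=> /same_law_set PQ; apply/same_law_set => B mB.
by rewrite -[LHS]/(P _) -[RHS]/(Q _); apply: PQ; exact: measurable_preim.
Qed.

Lemma push_conv P Q :
  same_law (conv LF (push_prob P mf) (push_prob Q mf)) (push_prob (conv LF P Q) mf).
Proof.
move=> g bg.
have bgf : bmeas (g \o f : borel V -> R).
  have [mg [M gM]] := bg; split; last by exists M => x; exact: gM.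
  exact: measurableT_comp mg mf.
rewrite mean_conv // !mean_push // ?mean_conv //; last exact: bmeas_mean_translate.
congr mean; apply/funext => x; rewrite /comp mean_push.
  congr mean; apply/funext => y; rewrite /= (_ : f (x + y) = f x + f y) //.
  by have := lf 1 x y; rewrite !scale1r.
exact: (bmeas_translate LF).
Qed.

(** Raising both sides of [P = f (P^n)] to the convolution power [m]. *)
Lemma push_conv_pow P n m : same_law P (push_prob (conv_pow LF P n) mf) ->
  same_law (conv_pow LF P m) (push_prob (conv_pow LF P (m * n)) mf).
Proof.
move=> Pn; elim: m => [|m IH].
  apply/same_law_set => B mB; rewrite -[LHS]/(\d_((0 : V) : borel V) B).
  rewrite -[RHS]/(\d_((0 : V) : borel V) [set x : borel V | B (f x)]).
  have f0 : f 0 = 0 by have := lf (-1) 0 0; rewrite !scaler0 addr0 scaleN1r addNr.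
  by rewrite !diracE; congr ((nat_of_bool _)%:R%:E); apply: asbool_equiv_eq; rewrite /= f0.
apply: (same_law_trans (conv_same Pn IH)); apply: (same_law_trans (push_conv _ _)).
by apply: push_same; rewrite mulSn; exact: conv_powD.
Qed.

End Laws.

(** * Semistable measures *)

Section Semistable.
Variables (R : realType) (K : topFieldType) (abv ch sh : K -> R).
Hypothesis LF : local_field abv ch sh.
Variable V : vectType K.
Variable lam : {measure set (borel V) -> \bar R}.
Hypothesis hl : haar_measure lam.
Implicit Types P Q : probability (borel V) R.

Definition haar_bounded P := exists2 C : R, 0 <= C &
  forall B : set (borel V), measurable B -> (P B <= C%:E * lam B)%E.

Lemma haar_bounded_same P Q : same_law P Q -> haar_bounded P -> haar_bounded Q.
Proof.
by move=> /same_law_set PQ [C C0 CP]; exists C => // B mB; rewrite -PQ // CP.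
Qed.

Lemma haar_bounded_push P (f g : V -> V) (lf : linear f) : linear g ->
  cancel f g -> cancel g f -> haar_bounded P ->
  haar_bounded (push_prob P (measurable_linear LF lf)).
Proof.
move=> lg fg gf [C C0 CP].
have [delta d0 dP] := haar_modulus LF hl lf lg fg gf.
exists (C * delta) => [|B mB]; first by rewrite mulr_ge0 // ltW.
have mfB : measurable [set x : borel V | B (f x)].
  exact: measurable_preim (measurable_linear LF lf) mB.
by rewrite EFinM -muleA -dP // -[leLHS]/(P [set x : borel V | B (f x)]) CP.
Qed.

(** A mixture of translates of [P] obeys the same bound as [P]. *)
Lemma haar_bounded_conv P Q : haar_bounded P -> haar_bounded (conv LF P Q).
Proof.
move=> [C C0 CP]; exists C => // B mB; rewrite conv_set //.
have [_ _ inv] := hl.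
have mW := measurable_preim2 (measurable_add LF (V := V)) mB.
have -> : (C%:E * lam B = \int[Q]_y (C%:E * lam B))%E.
  rewrite -[LHS]mule1 -(@probability_setT _ _ _ Q); apply/esym.
  exact: (integral_cst Q measurableT).
apply: ge0_le_integral => //.
- have := measurable_fun_ysection P mW; congr measurable_fun.
  by apply/funext => y; rewrite /= ysectionE.
- move=> y _; rewrite -(inv (y : V) B mB); apply: CP.
  exact: measurable_preim (measurable_translate LF (V := V) y) mB.
Qed.

(** [P^(n^k)] is the image of [P^(n^(k+1))] by [f], so the exponent can be
    lowered step by step; the constant changes by the modulus of [f]. *)
Lemma haar_bounded_conv_pow P (f g : V -> V) (lf : linear f) (n : nat) :
  linear g -> cancel f g -> cancel g f ->
  same_law P (push_prob (conv_pow LF P n) (measurable_linear LF lf)) ->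
  forall k, haar_bounded (conv_pow LF P (n ^ k)) -> haar_bounded (conv_pow LF P 1).
Proof.
move=> lg fg gf Pn; elim=> [//|k IH] hb; apply: IH.
have h := push_conv_pow (n ^ k) Pn.
apply: (@haar_bounded_same (push_prob (conv_pow LF P (n ^ k * n)) (measurable_linear LF lf))).
  by move=> u bu; rewrite h.
by apply: (haar_bounded_push lf lg fg gf); rewrite -expnSr.
Qed.

(** The equation [fsqr P (A x) ^+ n = fsqr P x] makes a power of [fsqr P]
    integrable, that is, makes the transform of a high convolution power of [P]
    integrable; by Parseval's formula this power is dominated by [lam], and so
    is [P]. *)
Lemma semistable_haar_bounded P (T S : V -> V) (lT : linear T) (n : nat) :
  full P -> linear S -> cancel T S -> cancel S T -> (1 < n)%N ->
  same_law P (push_prob (conv_pow LF P n) (measurable_linear LF lT)) ->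
  haar_bounded (conv_pow LF P 1).
Proof.
move=> fP lS TS ST n2 Pn.
have [A lA AP] := adjointP lT; have [B lB BP] := adjointP lS.
have dot_inj (x y : V) : (forall z, dot x z = dot y z) -> x = y.
  move=> xy; apply/subr0_eq/dot0 => z; by rewrite dotBl xy subrr.
have AB : cancel A B by move=> x; apply: dot_inj => z; rewrite BP AP ST.
have BA : cancel B A by move=> x; apply: dot_inj => z; rewrite AP BP TS.
pose u := fsqr ch sh P.
have uA (x : V) : u (A x) ^+ n = u x.
  by rewrite /u [RHS](fsqr_same LF x Pn) (fsqr_push LF _ _ _ AP) fsqr_conv_pow.
have [rho rho1 rhoP] := nrm_scale LF V.
have [c [R0 [c0 c1 cR]]] := superlevel_bounded LF (fsqr_ge0 ch sh P) (fsqr_le1 LF P)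
  (fsqr0 LF P) (fsqrN LF P) (fsqrD LF P) (fsqr_cont LF P)
  (fun x => full_fsqr LF (xi := x) fP) lA lB AB n2 uA rho1 rhoP.
have [delta d0 dP] := haar_modulus LF hl lA lB AB BA.
have mu := fsqr_meas LF P.
have fin : (lam [set x | (c <= u x)%R] < +oo)%E.
  apply: le_lt_trans (haar_ball_fin LF (R0 + 1) hl).
  apply: le_measure; rewrite ?inE; last by move=> x /= /cR; rewrite -ltrBlDr; lra.
    rewrite -[X in measurable X]setTI.
    have := mu measurableT _ (measurable_itv `[c, +oo[); congr measurable.
    by apply/seteqP; split=> x /=; rewrite in_itv /= andbT.
  exact: (measurable_ball0 LF).
have [q [q0 qint]] := integrable_power mu (fsqr_ge0 ch sh P) (fsqr_le1 LF P) uA n2 c0 c1 d0 dP fin.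
pose h (x : borel V) := u x ^+ q.
have h0 x : 0 <= h x by rewrite exprn_ge0 // fsqr_ge0.
have bh : bmeas h.
  split; first exact: measurable_funX.
  by exists 1 => x; rewrite ger0_norm // exprn_ile1 ?fsqr_ge0 ?(fsqr_le1 LF).
pose J := fine (\int[lam]_x (h x)%:E)%E.
have hJ : (\int[lam]_x (h x)%:E <= J%:E)%E.
  rewrite /J fineK // fin_real // qint andbT (lt_le_trans (ltNyr 0)) //.
  by apply: integral_ge0 => x _; rewrite lee_fin.
(* [n ^ j >= q * 2] for this [j], whence [hle]. *)
pose j := (q * 2)%N.
have hle (z : V) : fsqr ch sh (conv_pow LF P (n ^ j)) z <= h z ^+ 2.
  rewrite fsqr_conv_pow /h -exprM; apply: ler_wiXn2l; rewrite ?fsqr_ge0 ?(fsqr_le1 LF) //.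
  by apply/ltnW/ltn_expl.
have [C C0 CP] := small_ball_le LF hl bh h0 hle hJ.
apply: (haar_bounded_conv_pow lS TS ST Pn (k := j)).
by exists C => // X mX; exact: (dominated LF hl C0 CP).
Qed.

(** [P] is the convolution of [T P] and [T (P^(n-1))], both dominated by [lam];
    as [n - 1 > 0] the second is the image of a convolution having [P] as a
    factor. *)
Lemma semistable_density (P : probability (borel V) R) (T : V -> V) (n : nat) :
  full P -> continuous_automorphism T -> (2 <= n)%N -> semistable T n P ->
  P `<< lam /\
  exists f : V -> R,
    [/\ continuous (f : vtop V -> R),
        exists M : R, forall x : V, `|f x| <= M,
        forall x : V, 0 <= f x &
        forall B : set (borel V), measurable B ->
          P B = (\int[lam]_(x in B) (f x)%:E)%E].
Proof.
move=> fP [aT cT [S [TS ST cS]]] n2 sP.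
have lT : linear T := additive_continuous_linear LF aT cT.
have aS : zmod_morphism S by move=> x y; rewrite -{1}(ST x) -{1}(ST y) -aT TS.
have lS : linear S := additive_continuous_linear LF aS cS.
pose mT := measurable_linear LF lT.
have Pn : same_law P (push_prob (conv_pow LF P n) mT).
  by apply/same_law_set => B mB; rewrite -sP // -[RHS]/(conv_pow LF P n _) conv_powE.
have h1 := semistable_haar_bounded fP lS TS ST n2 Pn.
have hP := haar_bounded_same (conv_pow1 LF P) h1.
have hm m : haar_bounded (conv_pow LF P m.+1).
  exact: haar_bounded_conv.
have nE : n = (n.-2).+2 by case: n n2 {sP Pn} => [|[]].
pose P' := push_prob P mT; pose Q' := push_prob (conv_pow LF P (n.-2).+1) mT.
have PE : same_law P (conv LF P' Q').
  apply: (same_law_trans Pn) => f bf; rewrite (push_conv LF lT P _ bf).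
  by rewrite {1}nE.
have [C1 C10 hP'] := haar_bounded_push lT lS TS ST hP.
have [C2 C20 hQ'] := haar_bounded_push lT lS TS ST (hm n.-2).
have [C C0 CP] := hP; split; first exact: dominated_ac CP.
have weaken C' Q : C' <= Num.max C1 C2 ->
    (forall B : set (borel V), measurable B -> (Q B <= C'%:E * lam B)%E) ->
    forall B : set (borel V), measurable B -> (Q B <= (Num.max C1 C2)%:E * lam B)%E.
  by move=> CC QC B mB; apply: le_trans (QC B mB) _; rewrite lee_wpmul2r // lee_fin.
pose D := Num.max C1 C2.
have D0 : 0 <= D by rewrite le_max C10.
have DP : forall B : set (borel V), measurable B -> (P' B <= D%:E * lam B)%E.
  by apply: weaken hP'; rewrite le_max lexx.
have DQ : forall B : set (borel V), measurable B -> (Q' B <= D%:E * lam B)%E.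
  by apply: weaken hQ'; rewrite le_max lexx orbT.
have [g [mg g0 gD gP]] := bounded_density LF hl D0 DP.
exists (smoothed g Q'); split.
- move=> x A /nbhs_ballP[e e0 eA].
  have [d d0 dP] := smoothed_cont LF hl D0 mg g0 gD x DQ e0.
  by apply/(nbhs_nrmP LF); exists d => // y /dP yx; apply: eA; rewrite /ball /= distrC.
- exists D => x; rewrite ger0_norm ?smoothed_ge0 //; exact: (smoothed_le LF mg).
- exact: smoothed_ge0.
- move=> B mB; rewrite -(conv_density LF hl Q' mg g0 gD gP mB).
  by move/same_law_set: PE; apply.
Qed.

End Semistable.

Theorem corollary5p1 (R : realType) (p : nat) (p_pr : prime p)
    (K : topFieldType)
    (hK : K = R :> topFieldType \/ K = padic p_pr :> topFieldType)
    (V : vectType K) (mu : probability (borel V) R) (T : V -> V) (n : nat)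
    (lambda : {measure set (borel V) -> \bar R}) :
  haar_measure lambda ->
  full mu ->
  continuous_automorphism T ->
  (2 <= n)%N ->
  semistable T n mu ->
  mu `<< lambda /\
  exists f : V -> R,
    [/\ continuous (f : vtop V -> R),
        exists M : R, forall x : V, `|f x| <= M,
        forall x : V, 0 <= f x &
        forall B : set (borel V), measurable B ->
          mu B = (\int[lambda]_(x in B) (f x)%:E)%E].
Proof.
move=> hl fmu aT n2 sT.
have [abv [ch [sh LF]]] : exists abv ch sh : K -> R, local_field abv ch sh.
  case: hK => hKE; move: V mu T lambda hl fmu aT sT; rewrite hKE => *.
    by eexists _, _, _; exact: real_local_field.
  by eexists _, _, _; exact: padic_local_field.
exact: (semistable_density LF hl fmu aT n2 sT).
Qed.
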